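(* Suppose that, for every $\delta > 0$ and every $t \in \mathbb{N}$, no polynomial time algorithm solves $\textsc{PolyGapD}k\textsc{S}(\delta, t)$. Then, for every $\varepsilon > 0$, no polynomial time algorithm approximates $\textsc{DAL}k\textsc{S}$ to within a factor of $(2 - \varepsilon)$. Moreover, suppose further that, for every $\delta > 0$, $t \in \mathbb{N}$ and every function $f: \mathbb{N} \to \mathbb{N}$, no $f(k) \cdot n^{O(1)}$ time algorithm solves $\textsc{PolyGapD}k\textsc{S}(\delta, t)$. Then, for every $\varepsilon > 0$ and every function $f$, no $f(k) \cdot n^{O(1)}$ time algorithm approximates $\textsc{DAL}k\textsc{S}$ to within a factor of $(2 - \varepsilon)$.
   Context: All graphs are finite, simple and undirected; $V_G, E_G$ denote vertex and edge sets, $G[S]$ the induced subgraph on $S$, $n$ the input size. Density: $\mathrm{den}(G) = |E_G|/|V_G|$. Define $\mathrm{den}_{\geq k}(G) = \max_{S \subseteq V_G, |S| \geq k} \mathrm{den}(G[S])$ and $\mathrm{den}_{\leq k}(G) = \max_{\emptyset \neq S \subseteq V_G, |S| \leq k} \mathrm{den}(G[S])$. A copy of a $t$-clique in $G[S]$ is a $t$-element subset of $S$ that is pairwise adjacent. $\textsc{DAL}k\textsc{S}$: given a graph $G$ and integer $k$ (the parameter), find a subgraph with at least $k$ vertices of maximum density $\mathrm{den}_{\geq k}(G)$; approximating within factor $\rho$ means finding a solution with at least $k$ vertices and density at least $\mathrm{den}_{\geq k}(G)/\rho$. For $\delta \in (0,1]$ and $t \in \mathbb{N}$, $\textsc{PolyGapD}k\textsc{S}(\delta,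 t)$ is the promise problem: given a graph $G$ and $k \in \mathbb{N}$, distinguish between (Completeness) there exists $S \subseteq V_G$ with $|S| = k$ such that $G[S]$ contains at least $k^{t - \delta}$ copies of $t$-cliques, and (Soundness) $\mathrm{den}_{\leq k}(G) < k^{\delta}$. An algorithm solves it if it answers correctly on every instance satisfying one of the two cases. *)

(* Defs.v *)
From Stdlib Require Import Reals.
From mathcomp Require Import all_boot.
Set Implicit Arguments. Unset Strict Implicit. Unset Printing Implicit Defensive.

Definition simple_graph (n : nat) (E : rel 'I_n) : Prop :=
  (forall x y, E x y = E y x) /\ (forall x, ~~ E x x).

Definition n_edges (n : nat) (E : rel 'I_n) (S : {set 'I_n}) : nat :=
  #|[set p : 'I_n * 'I_n | [&& (p.1 < p.2)%N, E p.1 p.2, p.1 \in S & p.2 \in S]]|.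

Definition den (n : nat) (E : rel 'I_n) (S : {set 'I_n}) : R :=
  Rdiv (INR (n_edges E S)) (INR #|S|).

Definition den_ge (n : nat) (E : rel 'I_n) (k : nat) : R :=
  \big[Rmax/R0]_(S : {set 'I_n} | (k <= #|S|)%N) den E S.

Definition den_le (n : nat) (E : rel 'I_n) (k : nat) : R :=
  \big[Rmax/R0]_(S : {set 'I_n} | (0 < #|S| <= k)%N) den E S.

Definition n_cliques (n : nat) (E : rel 'I_n) (t : nat) (S : {set 'I_n}) : nat :=
  #|[set T : {set 'I_n} | [&& T \subset S, #|T| == t &
       [forall x in T, forall y in T, (x != y) ==> E x y]]]|.

(* Model of computation: deterministic single-tape Turing machines      *)
(* with finitely many states over the tape alphabet {0,1,blank}.        *)
Inductive sym := S0 | S1 | SB.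
Inductive dir := DL | DR | DS.

(* states are 'I_(nQ.+1), the start state is ord0; a transition result  *)
(* None means that the machine halts.                                   *)
Record TM := mkTM {
  nQ : nat;
  trans : 'I_nQ.+1 -> sym -> option ('I_nQ.+1 * sym * dir) }.

(* configuration: state, tape left of the head (nearest cell first),   *)
(* scanned symbol, tape right of the head; both sides padded by blanks *)
Record config (M : TM) := mkConfig {
  cstate : 'I_(nQ M).+1; cleft : list sym; chead : sym; cright : list sym }.

Definition sym_of_bool (b : bool) : sym := if b then S1 else S0.

Definition init (M : TM) (w : list bool) : config M :=
  match map sym_of_bool w with
  | [::] => @mkConfig M ord0 [::] SB [::]
  | a :: r => @mkConfig M ord0 [::] a r
  end.

Definition move (M : TM) (q : 'I_(nQ M).+1) (l : list sym) (a : sym)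
    (r : list sym) (d : dir) : config M :=
  match d with
  | DS => @mkConfig M q l a r
  | DL => match l with
          | [::] => @mkConfig M q [::] SB (a :: r)
          | b :: l' => @mkConfig M q l' b (a :: r)
          end
  | DR => match r with
          | [::] => @mkConfig M q (a :: l) SB [::]
          | b :: r' => @mkConfig M q (a :: l) b r'
          end
  end.

Fixpoint run (M : TM) (T : nat) (c : config M) : option (config M) :=
  match trans (cstate c) (chead c) with
  | None => Some c
  | Some (q, a, d) =>
      match T with
      | 0 => None
      | T'.+1 => run T' (move q (cleft c) a (cright c) d)
      end
  end.

Fixpoint read_bits (s : list sym) : list bool :=
  match s with
  | S0 :: s' => false :: read_bits s'
  | S1 :: s' => true :: read_bits s'
  | _ => [::]
  end.

Definition output (M : TM) (c : config M) : list bool :=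
  read_bits (chead c :: cright c).

Definition runs_within (M : TM) (T : nat) (w : list bool) (out : list bool) : Prop :=
  exists c, run T (init M w) = Some c /\ output c = out.

Definition encode (n : nat) (E : rel 'I_n) (k : nat) : list bool :=
  nseq n true ++ [:: false] ++ nseq k true ++ [:: false] ++
  [seq E p.1 p.2 | p <- [seq (i, j) | i <- enum 'I_n, j <- enum 'I_n]].

Definition decode_set (n : nat) (out : list bool) : {set 'I_n} :=
  [set i : 'I_n | nth false out i].

Definition poly_bound (c : nat) (size : nat) (k : nat) : nat := c * size ^ c + c.
Definition fpt_bound (f : nat -> nat) (c : nat) (size : nat) (k : nat) : nat :=
  f k * size ^ c.

Definition gap_complete (delta : R) (t : nat) (n : nat) (E : rel 'I_n) (k : nat) : Prop :=
  exists S : {set 'I_n}, #|S| = k /\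
    Rle (Rpower (INR k) (Rminus (INR t) delta)) (INR (n_cliques E t S)).

Definition gap_sound (delta : R) (n : nat) (E : rel 'I_n) (k : nat) : Prop :=
  Rlt (den_le E k) (Rpower (INR k) delta).

Definition solves_gap (bound : nat -> nat -> nat) (delta : R) (t : nat) (M : TM) : Prop :=
  forall (n : nat) (E : rel 'I_n) (k : nat), simple_graph E -> (1 <= k)%N ->
    exists out, runs_within M (bound (size (encode E k)) k) (encode E k) out /\
      (gap_complete delta t E k -> out = [:: true]) /\
      (gap_sound delta E k -> out = [:: false]).

Definition approximates_dalks (bound : nat -> nat -> nat) (rho : R) (M : TM) : Prop :=
  forall (n : nat) (E : rel 'I_n) (k : nat), simple_graph E -> (1 <= k <= n)%N ->
    exists out, runs_within M (bound (size (encode E k)) k) (encode E k) out /\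
      (k <= #|decode_set n out|)%N /\
      Rle (Rdiv (den_ge E k) rho) (den E (decode_set n out)).

(* Main.v *)
Require Import Defs.
From Stdlib Require Import ZArith Reals Lra FunctionalExtensionality.
From mathcomp Require Import all_boot zify.
Set Implicit Arguments. Unset Strict Implicit. Unset Printing Implicit Defensive.

(* From G and k one builds a graph whose nodes are t-tuples of vertices ("T-nodes"), pairs (i, w) of a
   coordinate and a t-tuple in which w_i < r ~ sqrt k only serves as a copy number ("A-nodes"), and a
   complete bipartite core K_{a,b}.  A T-node v is joined to (i, w) when v is a clique of G and v, w
   agree off i, so it has t r possible neighbours.  With N = c t r k^(t-1), a = c t r and
   b = t r k^(t-1), the core has a b = t r N edges.

   If some k-set spans N cliques of size t, then N T-nodes over it, the t r k^(t-1) = N / c A-nodes over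
   it and the core form a set of density about 2 t r.  Conversely let a set of sg >= N nodes have density
   at least (1 + 1/c) t r.  The core pays for only t r N of its edges, so its T-nodes retain a fixed
   fraction of their A-neighbours while there are at most c N A-nodes in all.  After fixing the set X of
   the coordinates at which this happens and deleting sparse lines, one is left with a nonempty family of
   clique tuples in which every line in a direction of X has at least 16 s points, where s bounds the
   density of the sets of at most k vertices.  Sparsity forces the number of extensions to grow by a
   factor r with every freed coordinate, so the family has at least r^(d(d-1)/2) > k^t members, d = |X|,
   contradicting sg <= c N.  Thus a (2 - eps)-approximation decides the gap problem; for k below a
   constant completeness fails outright if delta is small, because a k-set spans at most k^t / 2 cliques.

   The reduction runs on a Turing machine obtained by compiling programs over finitely many bit stacks,
   which also simulate the given machine. *)

(** * Compiling stack programs to Turing machines *)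

(** The core is the source of the factor 2. Padded to N nodes it has density at least t r whatever
    the graph, and the T-nodes over a good k-set supply t r once more; their A-nodes are few because
    a k-set has k^t tuples but only k^(t-1) lines in each direction. The copy numbers make lines
    expensive. A T-node that keeps a fixed fraction of its neighbours in a direction accounts for
    about r A-nodes of its line, so about N T-nodes sharing O(N) A-nodes must crowd about r to a
    line, up to constants depending on c and t. Sparsity bites only beyond s points on a line; with
    s about k^(1/4) and r about k^(1/2), s is far below r and s r far below k, as the growth step
    needs. The exponent d (d - 1) / 2 is quadratic in d, while the room k^t is linear in it, since t
    = 4 c d; d = 24 c + 1 makes the exponent 3 t, and r^3 exceeds k. The constants are chosen in the
    order eps, c, t, k0, with delta = 1 / k0. *)

Definition row := sym -> nat * sym * dir.

(** A move to the left increases the position, so that the registers, which lie to the left of home,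
    get nonnegative coordinates. *)
Definition sgd (d : dir) : Z := match d with DL => 1%Z | DR => (-1)%Z | DS => 0%Z end.

Definition tupd (T : Z -> sym) (x : Z) (a : sym) : Z -> sym :=
  fun y => if Z.eqb y x then a else T y.

Definition mcfg := (nat * Z * (Z -> sym))%type.

(** An address past the end of the code is a halting state, and the step fixes it, so that a run can
    be iterated beyond its end. *)
Definition mstep (C : seq row) (c : mcfg) : mcfg :=
  let: (p, x, T) := c in
  if p < size C then
    let: (p', a, d) := nth (fun a => (p, a, DS)) C p (T x) in
    (p', (x + sgd d)%Z, tupd T x a)
  else c.

Definition reach (C : seq row) (n : nat) (c c' : mcfg) : Prop :=
  exists2 m, m <= n & iter m (mstep C) c = c'.

Lemma tupd_id (T : Z -> sym) x : tupd T x (T x) = T.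
Proof.
apply: functional_extensionality => y; rewrite /tupd.
by case: Z.eqb_spec => [->|].
Qed.

Lemma reach_refl C n c : reach C n c c.
Proof. by exists 0. Qed.

Lemma reach_trans C c2 n1 n2 c1 c3 :
  reach C n1 c1 c2 -> reach C n2 c2 c3 -> reach C (n1 + n2) c1 c3.
Proof.
move=> [m1 h1 e1] [m2 h2 e2]; exists (m2 + m1); first lia.
by rewrite iterD e1 e2.
Qed.

Lemma reach_weak C n1 n2 c1 c2 : reach C n1 c1 c2 -> n1 <= n2 -> reach C n2 c1 c2.
Proof. by move=> [m h e] h2; exists m => //; lia. Qed.

Definition row0 : row := fun a => (0, a, DS).

Definition code_at (C : seq row) (p : nat) (s : seq row) : Prop :=
  forall i, i < size s -> p + i < size C /\ nth row0 C (p + i) = nth row0 s i.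

Lemma at_cat C p s1 s2 : code_at C p (s1 ++ s2) -> code_at C p s1 /\ code_at C (p + size s1) s2.
Proof.
move=> h; split=> i hi.
  have := h i; rewrite size_cat nth_cat hi; apply; lia.
have := h (size s1 + i); rewrite size_cat nth_cat addKn addnA.
have -> : (size s1 + i < size s1) = false by lia.
by apply; lia.
Qed.

Lemma at_cons C p r s : code_at C p (r :: s) -> code_at C p [:: r] /\ code_at C p.+1 s.
Proof. by rewrite -cat1s => /at_cat; rewrite addn1. Qed.

Lemma at_cons1 C p r s : code_at C p (r :: s) -> code_at C p [:: r] /\ code_at C (p + 1) s.
Proof. by rewrite -cat1s => /at_cat. Qed.

Lemma reach1 C p r x T p' a d :
  code_at C p [:: r] -> r (T x) = (p', a, d) ->
  reach C 1 (p, x, T) (p', (x + sgd d)%Z, tupd T x a).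
Proof.
move=> /(_ 0 isT); rewrite addn0 /= => -[hp e1] e2; exists 1 => //=.
by rewrite hp (set_nth_default row0) // e1 e2.
Qed.

Lemma reach1_id C p r x T p' d : code_at C p [:: r] ->
  r (T x) = (p', T x, d) ->
  reach C 1 (p, x, T) (p', (x + sgd d)%Z, T).
Proof. by move=> h e; rewrite -{2}(tupd_id T x); apply: reach1 h e. Qed.

Definition mv (d : dir) (q : nat) : row := fun a => (q, a, d).

Lemma mv_reach C p d q x T : code_at C p [:: mv d q] ->
  reach C 1 (p, x, T) (q, (x + sgd d)%Z, T).
Proof. by move=> h; apply: (reach1_id h). Qed.

Fixpoint movs (d : dir) (n p : nat) : seq row :=
  if n is n'.+1 then mv d p.+1 :: movs d n' p.+1 else [::].

Lemma size_movs d n p : size (movs d n p) = n.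
Proof. by elim: n p => //= n IH p; rewrite IH. Qed.

Lemma movs_reach C d n p x T : code_at C p (movs d n p) ->
  reach C n (p, x, T) (p + n, (x + sgd d * Z.of_nat n)%Z, T).
Proof.
elim: n p x => [|n IH] p x /=.
  by move=> _; rewrite addn0 Z.mul_0_r Z.add_0_r; apply: reach_refl.
move=> /at_cons [h1 h2]; have := reach_trans (mv_reach x T h1) (IH _ _ h2).
by rewrite addnS addSn; have -> : (x + sgd d + sgd d * Z.of_nat n = x + sgd d * Z.of_nat n.+1)%Z by lia.
Qed.

(** Registers are interleaved with period [W.+1]: each round of the loop crosses one period, so the
    test always sees the same register. [W = 0] gives the cell-by-cell walk used on the input. *)
Definition walk (t : sym -> bool) (d : dir) (p e W : nat) : seq row :=
  (fun a => if t a then (e, a, DS) else (p.+1, a, DS)) :: movs d W p.+1 ++ [:: mv d p].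

Lemma size_walk t d p e W : size (walk t d p e W) = W.+2.
Proof. by rewrite /= size_cat size_movs addn1. Qed.

Lemma walk_reach C t d p e W x T h :
  code_at C p (walk t d p e W) ->
  (forall i, i < h -> ~~ t (T (x + sgd d * Z.of_nat (i * W.+1))%Z)) ->
  t (T (x + sgd d * Z.of_nat (h * W.+1))%Z) ->
  reach C (h * W.+3 + 1) (p, x, T) (e, (x + sgd d * Z.of_nat (h * W.+1))%Z, T).
Proof.
move=> hat; move: (hat) => /at_cons [h1 /at_cat [h2]].
rewrite size_movs => h3.
elim: h x => [|h IH] x hb hend.
  have := reach1_id (x:=x) (T := T) (p' := e) (d := DS) h1.
  by rewrite mul0n /= Z.mul_0_r in hend *; rewrite Z.add_0_r in hend *; rewrite hend; apply.
have h0 := hb 0 isT; rewrite mul0n Z.mul_0_r Z.add_0_r in h0.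
have s1 : reach C 1 (p, x, T) (p.+1, x, T).
  by have := reach1_id (x:=x) (T := T) (p' := p.+1) (d := DS) h1; rewrite (negbTE h0) /= Z.add_0_r; apply.
have E i : (x + sgd d * Z.of_nat W + sgd d + sgd d * Z.of_nat (i * W.+1)
     = x + sgd d * Z.of_nat (i.+1 * W.+1))%Z by lia.
have := IH (x + sgd d * Z.of_nat W + sgd d)%Z; rewrite E => s4.
apply: (@reach_weak _ (1 + (W + (1 + (h * W.+3 + 1))))); last lia.
apply: reach_trans s1 (reach_trans (movs_reach x T h2) (reach_trans (mv_reach _ T h3) (s4 _ hend))).
by move=> i hi; rewrite E; apply: hb.
Qed.

(** The head of the list lies farthest from home, so that a push or a pop changes one cell and
    shifts nothing. *)
Definition ssym (o : seq bool) (i : nat) : sym := nth SB (map sym_of_bool (rev o)) i.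

Definition store := nat -> seq bool.

Definition upd (s : store) (j : nat) (l : seq bool) : store :=
  fun i => if i == j then l else s i.

(* Register 0 is the input, which stays in place to the right of the head's home cell; register
   j > 0 occupies the cells i * (W + 1) + j to the left of home, bottom of the stack first.
   Coordinates grow to the left. *)
Definition tape (W : nat) (s : store) : Z -> sym := fun x =>
  if (x <? -1)%Z then ssym (s 0) (Z.to_nat (-2 - x))
  else if (x =? -1)%Z then SB else
    let i := Z.to_nat x %/ W.+1 in let j := Z.to_nat x %% W.+1 in
    if j == 0 then (if i == 0 then S1 else SB) else ssym (s j) i.

Lemma ssym_cons b l i :
  ssym (b :: l) i = if i == size l then sym_of_bool b else ssym l i.
Proof.
rewrite /ssym rev_cons map_rcons nth_rcons size_map size_rev.
case: ltngtP => // h; rewrite nth_default // size_map size_rev; lia.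
Qed.

Lemma ssym_out l i : size l <= i -> ssym l i = SB.
Proof. by move=> h; rewrite /ssym nth_default // size_map size_rev. Qed.

Lemma ssym_in l i : i < size l -> ssym l i <> SB.
Proof.
elim: l => //= b l IH h; rewrite ssym_cons.
case: eqP => [_|ne]; first by case: b.
by apply: IH; lia.
Qed.

Lemma upd_same s j : upd s j (s j) = s.
Proof. by apply: functional_extensionality => i; rewrite /upd; case: eqP => [->|]. Qed.

Lemma tape_reg W s i j : 0 < j <= W ->
  tape W s (Z.of_nat j + 1 * Z.of_nat (i * W.+1))%Z = ssym (s j) i.
Proof.
move=> hj; rewrite /tape.
have -> : (Z.of_nat j + 1 * Z.of_nat (i * W.+1) <? -1)%Z = false by apply/Z.ltb_spec0; lia.
have -> : (Z.of_nat j + 1 * Z.of_nat (i * W.+1) =? -1)%Z = false by apply/Z.eqb_spec; lia.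
have -> : Z.to_nat (Z.of_nat j + 1 * Z.of_nat (i * W.+1)) = i * W.+1 + j by lia.
rewrite divnMDl // modnMDl modn_small; last lia.
rewrite divn_small; last lia.
by rewrite addn0; case: j hj.
Qed.

Lemma tape_home W s i :
  tape W s (Z.of_nat (i * W.+1))%Z = if i == 0 then S1 else SB.
Proof.
rewrite /tape.
have -> : (Z.of_nat (i * W.+1) <? -1)%Z = false by apply/Z.ltb_spec0; lia.
have -> : (Z.of_nat (i * W.+1) =? -1)%Z = false by apply/Z.eqb_spec; lia.
have -> : Z.to_nat (Z.of_nat (i * W.+1)) = i * W.+1 by lia.
by rewrite mulnK // modnMl.
Qed.

Lemma tape_inp W s i : tape W s (-2 - Z.of_nat i)%Z = ssym (s 0) i.
Proof.
rewrite /tape.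
have -> : (-2 - Z.of_nat i <? -1)%Z by apply/Z.ltb_spec0; lia.
by congr (ssym _ _); lia.
Qed.

Lemma tupd_reg W s i j a l : 0 < j <= W ->
  (forall i', ssym l i' = if i' == i then a else ssym (s j) i') ->
  tupd (tape W s) (Z.of_nat j + 1 * Z.of_nat (i * W.+1))%Z a = tape W (upd s j l).
Proof.
move=> hj hl; apply: functional_extensionality => y; rewrite /tupd.
case: Z.eqb_spec => [->|ne].
  by rewrite tape_reg // /upd eqxx hl eqxx.
rewrite /tape /upd; case: (y <? -1)%Z; first by case: j hj {hl ne}.
case e1: (y =? -1)%Z => //; case: eqP => // /eqP m0; case: eqP => // ej.
rewrite hl; case: eqP => [ei|_]; last by rewrite ej.
case: ne; have := divn_eq (Z.to_nat y) W.+1; rewrite ei ej => ey.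
case: (Z.ltb_spec0 y 0) => hy; last lia.
have y0 : Z.to_nat y = 0 by lia.
by move: m0; rewrite y0 mod0n.
Qed.

Lemma tupd_inp W s i a l :
  (forall i', ssym l i' = if i' == i then a else ssym (s 0) i') ->
  tupd (tape W s) (-2 - Z.of_nat i)%Z a = tape W (upd s 0 l).
Proof.
move=> hl; apply: functional_extensionality => y; rewrite /tupd.
case: Z.eqb_spec => [->|ne].
  by rewrite tape_inp // /upd eqxx hl eqxx.
rewrite /tape /upd; case: (Z.ltb_spec0 y (-1)) => hy.
  by rewrite eqxx hl; case: eqP => // h; case: ne; lia.
by case: (y =? -1)%Z => //; case: eqP.
Qed.

Definition isSB a := if a is SB then true else false.
Definition isS1 a := if a is S1 then true else false.

Lemma isSB_ssym l i : isSB (ssym l i) = (size l <= i).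
Proof.
case: leqP => h; first by rewrite ssym_out.
by have := ssym_in h; case: (ssym l i).
Qed.

Definition push_code W j b p : seq row :=
  movs DL j p ++ walk isSB DL (p + j) (p + j + W.+2) W ++
  [:: fun _ => (p + j + W.+3, sym_of_bool b, DS)] ++
  movs DR j (p + j + W.+3) ++
  walk isS1 DR (p + j + W.+3 + j) (p + j + W.+3 + j + W.+2) W.

Lemma size_push_code W j b p : size (push_code W j b p) = j + j + (W.+3 + W.+2).
Proof. rewrite /push_code !size_cat !size_movs !size_walk /=; lia. Qed.

(** The cells at multiples of [W.+1] carry a single [S1], the one at home, so a walk to the right
    along them stops exactly there. *)
Lemma return_reach C W s j p e h :
  code_at C p (movs DR j p ++ walk isS1 DR (p + j) e W) ->
  reach C (j + (h * W.+3 + 1)) (p, (Z.of_nat j + 1 * Z.of_nat (h * W.+1))%Z, tape W s) (e, 0%Z, tape W s).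
Proof.
move=> /at_cat [h1]; rewrite size_movs => h2.
apply: reach_trans (movs_reach _ _ h1) _.
have -> : (Z.of_nat j + 1 * Z.of_nat (h * W.+1) + sgd DR * Z.of_nat j = Z.of_nat (h * W.+1))%Z by rewrite /sgd; lia.
have := @walk_reach _ _ _ _ _ _ (Z.of_nat (h * W.+1)) (tape W s) h h2.
have -> : (Z.of_nat (h * W.+1) + sgd DR * Z.of_nat (h * W.+1) = 0)%Z by rewrite /sgd; lia.
apply; last by rewrite (tape_home W s 0).
move=> i hi.
have -> : (Z.of_nat (h * W.+1) + sgd DR * Z.of_nat (i * W.+1) = Z.of_nat ((h - i) * W.+1))%Z.
  have := leq_mul (ltnW hi) (leqnn W.+1); rewrite mulnBl /sgd; lia.
by rewrite tape_home; have -> : (h - i == 0) = false by lia.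
Qed.

Lemma push_reach C W s j b p : 0 < j <= W ->
  code_at C p (push_code W j b p) ->
  reach C (10 * W.+1 * (size (s j)).+1) (p, 0%Z, tape W s)
    (p + size (push_code W j b p), 0%Z, tape W (upd s j (b :: s j))).
Proof.
move=> hj; rewrite size_push_code /push_code.
move=> /at_cat [h1]; rewrite size_movs => /at_cat [h2]; rewrite size_walk => /at_cat [h3 h4].
set h := size (s j).
have r1 := movs_reach 0 (tape W s) h1.
have r2 := @walk_reach _ _ _ _ _ _ (Z.of_nat j) (tape W s) h h2.
have r3 := @reach1 _ _ _ (Z.of_nat j + 1 * Z.of_nat (h * W.+1))%Z (tape W s) _ _ _ h3 erefl.
rewrite (@tupd_reg _ _ _ _ _ (b :: s j)) // ?Z.add_0_r in r3; last first.
  by move=> i; rewrite ssym_cons.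
rewrite addn1 -!addnS in h4.
have r4 := @return_reach _ _ (upd s j (b :: s j)) _ _ _ h h4.
apply: (@reach_weak _ (j + (h * W.+3 + 1 + (1 + (j + (h * W.+3 + 1)))))); last by nia.
rewrite Z.mul_1_l Z.add_0_l in r1; apply: (reach_trans r1).
apply: (reach_trans (r2 _ _)).
- by move=> i hi; rewrite tape_reg // isSB_ssym -ltnNge.
- by rewrite tape_reg // isSB_ssym.
apply: (reach_trans r3).
have -> : p + (j + j + (W.+3 + W.+2)) = p + j + W.+3 + j + W.+2 by lia.
exact: r4.
Qed.

(** The outcome of the pop is remembered only in the machine state, hence three copies of the way
    home, one for each exit. *)
Definition pop_code (W j p eE e0 e1 : nat) : seq row :=
  let q := p + j in
  let rE := q + W.+3 + W.+1 + 1 in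
  let r0 := rE + (j + W.+2) in
  let r1 := r0 + (j + W.+2) in
  movs DL j p ++
  [:: fun a => (if isSB a then rE else q + 1, a, DS)] ++
  walk isSB DL (q + 1) (q + W.+3) W ++
  movs DR W.+1 (q + W.+3) ++
  [:: fun a => (if isS1 a then r1 else r0, SB, DS)] ++
  (movs DR j rE ++ walk isS1 DR (rE + j) eE W) ++
  (movs DR j r0 ++ walk isS1 DR (r0 + j) e0 W) ++
  (movs DR j r1 ++ walk isS1 DR (r1 + j) e1 W).

Lemma pop_reg_reach C W s j p eE e0 e1 : 0 < j <= W ->
  code_at C p (pop_code W j p eE e0 e1) ->
  reach C (10 * W.+1 * (size (s j)).+1) (p, 0%Z, tape W s)
    (match s j with [::] => eE | b :: _ => if b then e1 else e0 end, 0%Z,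
     tape W (upd s j (behead (s j)))).
Proof.
move=> hj; rewrite /pop_code; set q := p + j; set rE := _ + 1.
set r0 := rE + _; set r1 := r0 + _.
move=> /at_cat [h1]; rewrite size_movs => /at_cat [h2] /at_cat [h3]; rewrite size_walk.
move=> /at_cat [h4]; rewrite size_movs => /at_cat [h5] /at_cat [hE].
rewrite !size_cat !size_movs !size_walk => /at_cat [h0 h1'].
rewrite !size_cat !size_movs !size_walk -/q in h1' h2 h3 h4 h5 hE h0.
have E1 : q + size [:: fun a => (if isSB a then rE else q + 1, a, DS)] = q + 1 by [].
have E2 : q + 1 + W.+2 = q + W.+3 by lia.
rewrite /= -/q in h3 h4 h5 hE h0 h1'.
rewrite E2 in h4 h5 hE h0 h1'.
rewrite -/rE in hE h0 h1'; rewrite -/r0 in h0 h1'; rewrite -/r1 in h1'.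
set h := size (s j).
have := movs_reach 0 (tape W s) h1; rewrite Z.mul_1_l Z.add_0_l -/q => m1.
have tj0 : tape W s (Z.of_nat j) = ssym (s j) 0.
  by have := @tape_reg W s 0 j hj; rewrite mul0n Z.mul_0_r Z.add_0_r.
have := @reach1_id _ _ _ (Z.of_nat j) (tape W s) (if isSB (ssym (s j) 0) then rE else q + 1) DS h2.
rewrite tj0 Z.add_0_r => /(_ erefl) m2.
case es : (s j) => [|b l] /=.
  have -> : upd s j [::] = s by rewrite -es upd_same.
  have m3 := @return_reach _ _ s _ _ _ 0 hE.
  rewrite mul0n Z.mul_0_r Z.add_0_r in m3.
  rewrite es /= in m2.
  apply: (@reach_weak _ (j + (1 + (j + (0 * W.+3 + 1))))); first by apply: reach_trans m1 (reach_trans m2 m3).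
  by rewrite /h es /=; nia.
have hl : h = (size l).+1 by rewrite /h es.
have hsb : isSB (ssym (s j) 0) = false by rewrite isSB_ssym es.
rewrite hsb in m2.
have m3 := @walk_reach _ _ _ _ _ _ (Z.of_nat j) (tape W s) h h3.
have := @movs_reach _ _ W.+1 _ (Z.of_nat j + 1 * Z.of_nat (h * W.+1)) (tape W s) h4.
have -> : (Z.of_nat j + 1 * Z.of_nat (h * W.+1) + sgd DR * Z.of_nat W.+1 = Z.of_nat j + 1 * Z.of_nat (size l * W.+1))%Z.
  by rewrite hl mulSn /sgd; lia.
move=> m4.
have m5 := @reach1 _ _ _ (Z.of_nat j + 1 * Z.of_nat (size l * W.+1))%Z (tape W s) _ _ _ h5 erefl.
rewrite (@tupd_reg _ _ _ _ _ l) // ?Z.add_0_r in m5; last first.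
  move=> i; rewrite es ssym_cons; case: eqP => [->|//]; by rewrite ssym_out.
have eb : tape W s (Z.of_nat j + 1 * Z.of_nat (size l * W.+1)) = sym_of_bool b.
  by rewrite tape_reg // es ssym_cons eqxx.
rewrite eb in m5.
have m6 : reach C (j + (size l * W.+3 + 1)) (if isS1 (sym_of_bool b) then r1 else r0, (Z.of_nat j + 1 * Z.of_nat (size l * W.+1))%Z, tape W (upd s j l)) (if b then e1 else e0, 0%Z, tape W (upd s j l)).
  by case: b {es eb m5}; [apply: return_reach h1' | apply: return_reach h0].
apply: (@reach_weak _ (j + (1 + ((h * W.+3 + 1) + (W.+1 + (1 + (j + (size l * W.+3 + 1)))))))); last by rewrite hl; nia.
apply: (reach_trans m1); apply: (reach_trans m2).
apply: (reach_trans (m3 _ _)).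
- by move=> i hi; rewrite tape_reg // isSB_ssym -ltnNge.
- by rewrite tape_reg // isSB_ssym.
exact: reach_trans m4 (reach_trans m5 m6).
Qed.

(* The input is consumed from its right end; the blank cell -1 between home and the input stops the
   head on its way back. *)
Definition inp_code (p eE e0 e1 : nat) : seq row :=
  movs DR 2 p ++
  [:: fun a => (if isSB a then p + 13 else p + 3, a, DS)] ++
  walk isSB DR (p + 3) (p + 5) 0 ++
  [:: mv DL (p + 6)] ++
  [:: fun a => (if isS1 a then p + 9 else p + 7, SB, DL)] ++
  walk isSB DL (p + 7) (p + 11) 0 ++
  walk isSB DL (p + 9) (p + 12) 0 ++
  [:: mv DL e0] ++ [:: mv DL e1] ++ [:: mv DL (p + 14)] ++ [:: mv DL eE].

Lemma pop_inp_reach C W s p eE e0 e1 :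
  code_at C p (inp_code p eE e0 e1) ->
  reach C (10 * W.+1 * (size (s 0)).+1) (p, 0%Z, tape W s)
    (match s 0 with [::] => eE | b :: _ => if b then e1 else e0 end, 0%Z,
     tape W (upd s 0 (behead (s 0)))).
Proof.
move=> /at_cat [h1] /at_cat [h2] /at_cat [h3] /at_cat [h4] /at_cat [h5] /at_cat [h6].
move=> /at_cat [h7] /at_cat [h8] /at_cat [h9] /at_cat [h10 h11].
rewrite !size_movs ?size_walk -?addnA in h2 h3 h4 h5 h6 h7 h8 h9 h10 h11.
have m1 := movs_reach 0 (tape W s) h1.
have m2 := @reach1_id _ _ _ (-2)%Z (tape W s) (if isSB (ssym (s 0) 0) then p + 13 else p + 3) DS h2.
have t0 : tape W s (-2)%Z = ssym (s 0) 0 by exact: (tape_inp W s 0).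
rewrite t0 in m2; have {}m2 := m2 erefl.
case es : (s 0) => [|b l].
  rewrite es /= in m2.
  have -> : upd s 0 (behead [::]) = s by rewrite -[behead _]/[::] -es upd_same.
  have m3 := mv_reach (-2) (tape W s) h10.
  have m4 := mv_reach (-1) (tape W s) h11.
  apply: (@reach_weak _ (2 + (1 + (1 + 1)))); last by lia.
  exact: reach_trans m1 (reach_trans m2 (reach_trans m3 m4)).
rewrite isSB_ssym es /= in m2.
set h := size l.
have m3 := @walk_reach _ _ _ _ _ _ (-2) (tape W s) h.+1 h3.
have E i : (-2 + sgd DR * Z.of_nat (i * 1) = -2 - Z.of_nat i)%Z by rewrite muln1 /sgd; lia.
rewrite E in m3.
have m4 := mv_reach (-2 - Z.of_nat h.+1) (tape W s) h4.
have m5 := @reach1 _ _ _ (-2 - Z.of_nat h)%Z (tape W s) _ _ _ h5 erefl.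
rewrite (@tupd_inp _ _ _ _ l) in m5; last first.
  by move=> i; rewrite es ssym_cons; case: eqP => [->|//]; rewrite ssym_out.
rewrite tape_inp es ssym_cons eqxx in m5.
have back q e : code_at C q (walk isSB DL q e 0) -> reach C (h * 3 + 1) (q, (-2 - Z.of_nat h + sgd DL)%Z, tape W (upd s 0 l)) (e, (-1)%Z, tape W (upd s 0 l)).
  move=> hq; have := @walk_reach _ _ _ _ _ _ (-2 - Z.of_nat h + sgd DL) (tape W (upd s 0 l)) h hq.
  have E' i : i <= h -> (-2 - Z.of_nat h + sgd DL + sgd DL * Z.of_nat (i * 1) = if i == h then -1 else -2 - Z.of_nat (h - i.+1))%Z.
    by move=> hi; case: eqP; rewrite /sgd; lia.
  rewrite E' // eqxx; apply => // i hi; rewrite E'; last lia.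
  have -> : (i == h) = false by lia.
  by rewrite tape_inp isSB_ssym /upd /= -ltnNge; lia.
have m6 : reach C (h * 3 + 2) (if isS1 (sym_of_bool b) then p + 9 else p + 7, (-2 - Z.of_nat h + sgd DL)%Z, tape W (upd s 0 l)) (if b then e1 else e0, 0%Z, tape W (upd s 0 l)).
  have -> : h * 3 + 2 = h * 3 + 1 + 1 by lia.
  case: b {es m2 m5} => /=.
    exact: reach_trans (back _ _ h7) (mv_reach _ _ h9).
  exact: reach_trans (back _ _ h6) (mv_reach _ _ h8).
apply: (@reach_weak _ (2 + (1 + (h.+1 * 3 + 1 + (1 + (1 + (h * 3 + 2))))))); last by rewrite /= -/h; nia.
apply: (reach_trans m1); apply: (reach_trans m2).
apply: (reach_trans (m3 _ _)).
- by move=> i hi; rewrite E tape_inp isSB_ssym es /= -ltnNge.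
- by rewrite tape_inp isSB_ssym es.
apply: (reach_trans m4).
have -> : (-2 - Z.of_nat h.+1 + sgd DL = -2 - Z.of_nat h)%Z by rewrite /sgd; lia.
exact: reach_trans m5 m6.
Qed.

(** * Stack programs and their compilation *)

Inductive cmd :=
| Skip
| Push (j : nat) (b : bool)
| Seq (c1 c2 : cmd)
| Case (j : nat) (cE c0 c1 : cmd)
| Loop (j : nat) (c0 c1 : cmd).

(** [Case] and [Loop] pop the register that they test; there is no other way to read. One unit of
    time pays for one stack access, a second one for the jump that closes a branch. [ExWeak] makes
    the time an upper bound. *)
Inductive exec : cmd -> store -> store -> nat -> Prop :=
| ExSkip s : exec Skip s s 0
| ExPush s j b : exec (Push j b) s (upd s j (b :: s j)) 1
| ExSeq c1 c2 s s1 s2 T1 T2 :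
    exec c1 s s1 T1 -> exec c2 s1 s2 T2 -> exec (Seq c1 c2) s s2 (T1 + T2)
| ExCaseE j cE c0 c1 s s' T :
    s j = [::] -> exec cE s s' T -> exec (Case j cE c0 c1) s s' T.+2
| ExCase j cE c0 c1 s b l s' T :
    s j = b :: l -> exec (if b then c1 else c0) (upd s j l) s' T ->
    exec (Case j cE c0 c1) s s' T.+2
| ExLoopE j c0 c1 s : s j = [::] -> exec (Loop j c0 c1) s s 1
| ExLoop j c0 c1 s b l s1 s2 T1 T2 :
    s j = b :: l -> exec (if b then c1 else c0) (upd s j l) s1 T1 ->
    exec (Loop j c0 c1) s1 s2 T2 -> exec (Loop j c0 c1) s s2 (T1 + T2).+2
| ExWeak c s s' T T' : exec c s s' T -> T <= T' -> exec c s s' T'.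

Definition popc W j p (eE e0 e1 : nat) : seq row :=
  if j == 0 then inp_code p eE e0 e1 else pop_code W j p eE e0 e1.

Definition popsz W j := size (popc W j 0 0 0 0).

Lemma size_popc W j p eE e0 e1 : size (popc W j p eE e0 e1) = popsz W j.
Proof.
rewrite /popsz /popc; case: eqP => _ //.
by rewrite /pop_code !size_cat !size_movs !size_walk.
Qed.

Definition pushsz W j := j + j + (W.+3 + W.+2).

Fixpoint csize W c : nat :=
  match c with
  | Skip => 0
  | Push j b => pushsz W j
  | Seq c1 c2 => csize W c1 + csize W c2
  | Case j cE c0 c1 => popsz W j + (csize W cE + (1 + (csize W c0 + (1 + csize W c1))))
  | Loop j c0 c1 => popsz W j + (csize W c0 + (1 + (csize W c1 + 1)))
  end.

Fixpoint compile W c p : seq row :=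
  match c with
  | Skip => [::]
  | Push j b => push_code W j b p
  | Seq c1 c2 => compile W c1 p ++ compile W c2 (p + csize W c1)
  | Case j cE c0 c1 =>
      let pE := p + popsz W j in
      let p0 := pE + csize W cE + 1 in
      let p1 := p0 + csize W c0 + 1 in
      let e := p1 + csize W c1 in
      popc W j p pE p0 p1 ++ compile W cE pE ++ [:: mv DS e] ++
      compile W c0 p0 ++ [:: mv DS e] ++ compile W c1 p1
  | Loop j c0 c1 =>
      let p0 := p + popsz W j in
      let p1 := p0 + csize W c0 + 1 in
      let e := p1 + csize W c1 + 1 in
      popc W j p e p0 p1 ++ compile W c0 p0 ++ [:: mv DS p] ++ compile W c1 p1 ++ [:: mv DS p]
  end.

Lemma size_compile W c p : size (compile W c p) = csize W c.
Proof.
elim: c p => [|j b|c1 IH1 c2 IH2|j cE IHE c0 IH0 c1 IH1|j c0 IH0 c1 IH1] p //=.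
- by rewrite size_push_code.
- by rewrite size_cat IH1 IH2.
- by rewrite !(size_cat, IHE, IH0, IH1, size_popc, size_movs) /= !(size_cat, IHE, IH0, IH1) /= !(size_cat, IHE, IH0, IH1) /=.
- by rewrite !(size_cat, IH0, IH1, size_popc) /= !(size_cat, IH0, IH1) /=.
Qed.

Fixpoint cwf W c : bool :=
  match c with
  | Skip => true
  | Push j b => 0 < j <= W
  | Seq c1 c2 => cwf W c1 && cwf W c2
  | Case j cE c0 c1 => [&& j <= W, cwf W cE, cwf W c0 & cwf W c1]
  | Loop j c0 c1 => [&& j <= W, cwf W c0 & cwf W c1]
  end.

Lemma cwf_weak W W' c : W <= W' -> cwf W c -> cwf W' c.
Proof.
move=> h; elim: c => [|j b|c1 IH1 c2 IH2|j cE IHE c0 IH0 c1 IH1|j c0 IH0 c1 IH1] //=.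
- by lia.
- by move=> /andP [/IH1-> /IH2->].
- by move=> /and4P [h1 /IHE-> /IH0-> /IH1->]; rewrite (leq_trans h1 h).
- by move=> /and3P [h1 /IH0-> /IH1->]; rewrite (leq_trans h1 h).
Qed.

Lemma popc_reach C W s j p eE e0 e1 : j <= W ->
  code_at C p (popc W j p eE e0 e1) ->
  reach C (10 * W.+1 * (size (s j)).+1) (p, 0%Z, tape W s)
    (match s j with [::] => eE | b :: _ => if b then e1 else e0 end, 0%Z,
     tape W (upd s j (behead (s j)))).
Proof.
rewrite /popc; case: eqP => [->|ne] hj h; first exact: pop_inp_reach h.
by apply: pop_reg_reach h; lia.
Qed.

(** Only a push lengthens a stack, and it costs a unit; time therefore bounds the heights and with
    them the cost of every stack access. *)
Lemma exec_size c s s' T : exec c s s' T ->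
  forall H, (forall j, size (s j) <= H) -> forall j, size (s' j) <= H + T.
Proof.
elim=> {c s s' T}.
- by move=> s H h j; rewrite addn0.
- by move=> s j b H h i; rewrite /upd addn1; case: eqP => [_|_] /=; have := h j; have := h i; lia.
- by move=> c1 c2 s s1 s2 T1 T2 _ IH1 _ IH2 H h j; rewrite addnA; apply: IH2; apply: IH1.
- by move=> j cE c0 c1 s s' T _ _ IH H h i; have := IH _ h i; lia.
- move=> j cE c0 c1 s b l s' T e _ IH H h i; have h' := IH H _ i.
  apply: (@leq_trans (H + T)); last lia.
  by apply: h' => k; rewrite /upd; case: eqP => [_|//]; have := h j; rewrite e /=; lia.
- by move=> j c0 c1 s _ H h i; have := h i; lia.
- move=> j c0 c1 s b l s1 s2 T1 T2 e _ IH1 _ IH2 H h i.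
  have := IH2 (H + T1) _ i => h'; apply: (@leq_trans (H + T1 + T2)); last lia.
  apply: h'; apply: IH1 => k; rewrite /upd.
  by case: eqP => [_|//]; have := h j; rewrite e /=; lia.
- by move=> c s s' T T' _ IH hT H h i; have := IH _ h i; lia.
Qed.

(** During the run all stacks have height at most [H + T], so each unit of time is worth at most
    [10 * W.+1 * (H + T).+1] machine steps. *)
Lemma compile_reach C W c s s' T : exec c s s' T ->
  forall H p, (forall j, size (s j) <= H) -> cwf W c -> code_at C p (compile W c p) ->
  reach C (T * (10 * W.+1 * (H + T).+1)) (p, 0%Z, tape W s) (p + csize W c, 0%Z, tape W s').
Proof.
elim=> {c s s' T}.
- by move=> s H p h _ _; rewrite /= [p + _]addn0; apply: reach_refl.
- move=> s j b H p h /= hj ha; have := push_reach s hj ha; rewrite size_push_code => r.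
  by apply: reach_weak r _; rewrite mul1n; have := h j; nia.
- move=> c1 c2 s s1 s2 T1 T2 e1 IH1 e2 IH2 H p h /= /andP [w1 w2] /at_cat [h1 h2].
  rewrite size_compile in h2; rewrite [p + (_ + _)]addnA.
  apply: reach_weak (reach_trans (IH1 _ _ h w1 h1) (IH2 _ _ (exec_size e1 h) w2 h2)) _.
  by nia.
- move=> j cE c0 c1 s s' T es e IH H p h /= /and4P [hj wE w0 w1].
  move=> /at_cat [ha] /at_cat [hE] /at_cons1 [hm _].
  rewrite ?size_popc ?size_compile in hE hm.
  have := popc_reach s hj ha; rewrite es /= => r1.
  have eu : upd s j [::] = s by rewrite -es upd_same.
  rewrite eu in r1.
  have r2 := IH H _ h wE hE.
  have r3 := mv_reach 0 (tape W s') hm.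
  set e1 := p + _; set e2 := _ + csize W c1 in r3.
  have -> : e1 = e2 by rewrite /e1 /e2; lia.
  by apply: reach_weak (reach_trans r1 (reach_trans r2 r3)) _; nia.
- move=> j cE c0 c1 s b l s' T es e IH H p h /= /and4P [hj wE w0 w1].
  move=> /at_cat [ha] /at_cat [hE] /at_cons1 [hm] /at_cat [h0] /at_cons1 [hm0 h1].
  rewrite ?size_popc ?size_compile in hE hm h0 hm0 h1.
  have := popc_reach s hj ha; rewrite es /= => r1.
  have hh k : size (upd s j l k) <= H.
    by rewrite /upd; case: eqP => [_|//]; have := h j; rewrite es /=; lia.
  have hl : (size l).+1 <= H by have := h j; rewrite es.
  case: b es e IH r1 => es e IH r1.
    have r2 := IH H _ hh w1 h1.
    set e1 := p + _; set e2 := _ + csize W c1 in r2.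
    have -> : e1 = e2 by rewrite /e1 /e2; lia.
    by apply: reach_weak (reach_trans r1 r2) _; nia.
  have r2 := IH H _ hh w0 h0.
  have r3 := mv_reach 0 (tape W s') hm0.
  set e1 := p + _; set e2 := _ + csize W c1 in r3.
  have -> : e1 = e2 by rewrite /e1 /e2; lia.
  by apply: reach_weak (reach_trans r1 (reach_trans r2 r3)) _; nia.
- move=> j c0 c1 s es H p h /= /and3P [hj w0 w1] /at_cat [ha _].
  have := popc_reach s hj ha; rewrite es /= => r1.
  have eu : upd s j [::] = s by rewrite -es upd_same.
  rewrite eu in r1.
  set e1 := p + _; set e2 := _ + 1 in r1.
  have -> : e1 = e2 by rewrite /e1 /e2; lia.
  by apply: reach_weak r1 _; nia.
- move=> j c0 c1 s b l s1 s2 T1 T2 es e1 IH1 e2 IH2 H p h hw hat.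
  move: (hw) => /= /and3P [hj w0 w1].
  move: (hat) => /= /at_cat [ha] /at_cat [h0] /at_cons1 [hm0] /at_cat [h1 hm1].
  rewrite ?size_popc ?size_compile in h0 hm0 h1 hm1.
  have := popc_reach s hj ha; rewrite es /= => r1.
  have hh k : size (upd s j l k) <= H.
    by rewrite /upd; case: eqP => [_|//]; have := h j; rewrite es /=; lia.
  have hl : (size l).+1 <= H by have := h j; rewrite es.
  have r4 := IH2 _ _ (exec_size e1 hh) hw hat.
  case: b es e1 IH1 r1 => es e1 IH1 r1.
    have r2 := IH1 H _ hh w1 h1.
    have r3 := mv_reach 0 (tape W s1) hm1.
    by apply: reach_weak (reach_trans r1 (reach_trans r2 (reach_trans r3 r4))) _; nia.
  have r2 := IH1 H _ hh w0 h0.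
  have r3 := mv_reach 0 (tape W s1) hm0.
  by apply: reach_weak (reach_trans r1 (reach_trans r2 (reach_trans r3 r4))) _; nia.
- move=> c s s' T T' e IH hT H p h hw ha.
  by apply: reach_weak (IH _ _ h hw ha) _; rewrite !leq_mul //; lia.
Qed.

(** State [size C] is the only halting state; all jump targets beyond the code are clipped to it. *)
Definition tm_of (C : seq row) : TM :=
  @mkTM (size C) (fun q a =>
    if q < size C then
      let: (q', b, d) := nth row0 C q a in Some (inord (minn q' (size C)), b, d)
    else None).

Definition zip_ok (C : seq row) (c : config (tm_of C)) (x : Z) (T : Z -> sym) : Prop :=
  [/\ chead c = T x,
      forall i, nth SB (cleft c) i = T (x + 1 + Z.of_nat i)%Z
    & forall i, nth SB (cright c) i = T (x - 1 - Z.of_nat i)%Z].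

Lemma zip_move C (q : 'I_(nQ (tm_of C)).+1) (c : config (tm_of C)) x T a d :
  zip_ok c x T ->
  zip_ok (move q (cleft c) a (cright c) d) (x + sgd d)%Z (tupd T x a).
Proof.
case: c => q0 l h r [/= hh hl hr].
have tne y : y <> x -> tupd T x a y = T y by rewrite /tupd; case: Z.eqb_spec.
have teq y : y = x -> tupd T x a y = a by rewrite /tupd => ->; rewrite Z.eqb_refl.
case: d => /=.
- case: l hl => [|b l] hl; split=> /=.
  + by rewrite tne; [have := hl 0; rewrite /= Z.add_0_r|lia].
  + move=> i; rewrite nth_nil tne; last lia.
    by have := hl i.+1; rewrite nth_nil => ->; congr T; lia.
  + case=> [|i] /=; first by rewrite teq //; lia.
    by rewrite hr tne; [congr T; lia|lia].
  + by rewrite tne; [have := hl 0; rewrite /= Z.add_0_r|lia].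
  + move=> i; rewrite tne; last lia.
    by have := hl i.+1 => /= ->; congr T; lia.
  + case=> [|i] /=; first by rewrite teq //; lia.
    by rewrite hr tne; [congr T; lia|lia].
- case: r hr => [|b r] hr; split=> /=.
  + by rewrite tne; [have := hr 0; rewrite /= => ->; congr T; lia|lia].
  + case=> [|i] /=; first by rewrite teq //; lia.
    by rewrite hl tne; [congr T; lia|lia].
  + move=> i; rewrite nth_nil tne; last lia.
    by have := hr i.+1; rewrite nth_nil => ->; congr T; lia.
  + by rewrite tne; [have := hr 0; rewrite /= => ->; congr T; lia|lia].
  + case=> [|i] /=; first by rewrite teq //; lia.
    by rewrite hl tne; [congr T; lia|lia].
  + move=> i; rewrite tne; last lia.
    by have := hr i.+1 => /= ->; congr T; lia.
- split=> /=; first by rewrite teq //; lia.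
    by move=> i; rewrite tne; [rewrite hl; congr T; lia|lia].
  by move=> i; rewrite tne; [rewrite hr; congr T; lia|lia].
Qed.

Lemma run_sim C m p x T p' x' T' (c : config (tm_of C)) :
  iter m (mstep C) (p, x, T) = (p', x', T') -> size C <= p' ->
  zip_ok c x T -> cstate c = inord (minn p (size C)) ->
  exists2 c', run m c = Some c' & zip_ok c' x' T'.
Proof.
elim: m p x T c => [|m IH] p x T c.
  move=> [-> -> ->] hp hz hs; exists c => //=.
  by rewrite hs inordK ?ltnS ?geq_minr // (minn_idPr hp) ltnn.
rewrite iterSr /= => hi hp hz hs.
rewrite hs inordK ?ltnS ?geq_minr //.
case: (ltnP p (size C)) hi => hpC.
  rewrite hpC; have [hh _ _] := hz.
  rewrite hh (set_nth_default row0) //.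
  case: (nth row0 C p (T x)) => [[q a] d] hi.
  apply: (IH _ _ _ _ hi hp); last by case: (d) => /=; case: (cleft c); case: (cright c).
  exact: zip_move.
move=> hi; rewrite ltnn; exists c => //.
have : iter m (mstep C) (p, x, T) = (p, x, T).
  by elim: (m) => //= k ->; rewrite /= ltnNge hpC.
by rewrite hi => -[_ -> ->].
Qed.

Lemma run_mono (M : TM) m n (c c' : config M) : m <= n -> run m c = Some c' -> run n c = Some c'.
Proof.
elim: m n c => [|m IH] n c /=.
  by move=> _; case: n => [|n] /=; case: (trans _ _) => [[[q a] d]|].
case: n => //= n hn; case: (trans _ _) => [[[q a] d]|] //.
exact: IH.
Qed.

(* The first three rows mark the home cell two cells to the left of the input. *)
Definition prog (W : nat) (c : cmd) (j : nat) : seq row :=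
  let p := 3 + csize W c in
  let e := p + popsz W j in
  [:: mv DL 1; mv DL 2; (fun _ => (3, S1, DS))] ++
  compile W c 3 ++ popc W j p e e (e + 1) ++
  [:: (fun _ => (e + 2, S0, DS)); (fun _ => (e + 2, S1, DS))].

Definition st0 (w : seq bool) : store := fun i => if i == 0 then rev w else [::].

Definition tape0 (w : seq bool) : Z -> sym :=
  fun x => if (x <? -1)%Z then nth SB (map sym_of_bool w) (Z.to_nat (-2 - x)) else SB.

Lemma tape0E W w : tupd (tape0 w) 0 S1 = tape W (st0 w).
Proof.
apply: functional_extensionality => y; rewrite /tupd /tape /tape0.
case: Z.eqb_spec => [->|ne]; first by rewrite /= ?div0n ?mod0n.
case: (Z.ltb_spec0 y (-1)) => hy; first by rewrite /ssym /st0 eqxx revK.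
case e1: (y =? -1)%Z => //.
case: eqP => m0; last by rewrite /ssym /st0; case: eqP => //= _; rewrite nth_nil.
case: eqP => // d0; case: ne.
have := divn_eq (Z.to_nat y) W.+1; rewrite m0 d0; move: e1 => /Z.eqb_spec; lia.
Qed.

Lemma init_zip C w : zip_ok (init (tm_of C) w) (-2)%Z (tape0 w).
Proof.
have hl i : SB = tape0 w (-2 + 1 + Z.of_nat i)%Z.
  by rewrite /tape0; case: Z.ltb_spec0 => // h; lia.
have hr i : nth SB (map sym_of_bool w) i.+1 = tape0 w (-2 - 1 - Z.of_nat i)%Z.
  rewrite /tape0; case: Z.ltb_spec0 => [_|h]; last lia.
  by congr (nth SB _ _); lia.
by case: w hl hr => [|a w] hl hr; split=> // i; rewrite /= ?nth_nil -?hl -?hr.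
Qed.

Lemma prog_runs W c j w s' T b : j <= W -> cwf W c ->
  exec c (st0 w) s' T -> s' j = [:: b] ->
  runs_within (tm_of (prog W c j)) (100 * W.+1 * (size w + T).+2 ^ 2) w [:: b].
Proof.
move=> hj hw he hb.
set C := prog W c j.
have hat : code_at C 0 C by move=> i hi; rewrite add0n.
rewrite {2}/C /prog in hat.
move: hat => /at_cat [h0] /at_cat [h1] /at_cat [h2 h3].
rewrite /= !add0n in h1 h2 h3; rewrite size_compile in h2 h3; rewrite size_popc in h3.
move: h0 => /at_cons [a1] /at_cons [a2 a3].
move: h3 => /at_cons1 [b1 b2].
set e := 3 + csize W c + popsz W j in b1 b2 h2.
have r1 := mv_reach (-2) (tape0 w) a1.
have r2 := mv_reach (-1) (tape0 w) a2.
have r3 := @reach1 _ _ _ 0%Z (tape0 w) _ _ _ a3 erefl.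
rewrite (tape0E W) in r3.
have hs0 k : size (st0 w k) <= size w by rewrite /st0; case: eqP => // _; rewrite size_rev.
have r4 := compile_reach he hs0 hw h1.
have r5 := popc_reach s' hj h2; rewrite hb /= in r5.
set s2 := upd s' j [::] in r5.
have r6 : reach C 1 (if b then e + 1 else e, 0%Z, tape W s2) (e + 2, 0%Z, tupd (tape W s2) 0%Z (sym_of_bool b)).
  case: b {hb r5} => /=.
    exact: (@reach1 _ _ _ 0%Z (tape W s2) _ _ _ b2 erefl).
  exact: (@reach1 _ _ _ 0%Z (tape W s2) _ _ _ b1 erefl).
have [m hm im] := reach_trans r1 (reach_trans r2 (reach_trans r3 (reach_trans r4 (reach_trans r5 r6)))).
have hsz : size C <= e + 2.
  by rewrite /C /prog !size_cat size_compile size_popc /= /e; lia.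
have [|//|c' hr hz] := run_sim (c := init (tm_of C) w) im hsz.
- exact: init_zip.
- by case: (w) => [|a w'] /=; apply: val_inj; rewrite /= inordK // ?min0n.
exists c'; split.
  apply: run_mono hr; apply: leq_trans hm _.
  rewrite expnS expn1.
  have : T * (10 * W.+1 * (size w + T).+1) + 10 * W.+1 * 2 + 4 <= 100 * W.+1 * ((size w + T).+2 * (size w + T).+2) by nia.
  by apply: leq_trans; lia.
(* Cell -1, between home and the input, is blank, so the output read from home on is the one bit
   just written. *)
case: hz => hh _ hrr; rewrite /output hh /tupd Z.eqb_refl.
have := hrr 0; rewrite /tupd /= => h.
case: (cright c') h => [|x l] /=; first by case: (b).
by move=> ->; case: (b).
Qed.

(** * Functions computed by stack programs in polynomial time *)

(** One constant serves as coefficient and as exponent, so closure under sums and products only has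
    to enlarge it; the successor keeps powers monotone in the exponent. *)
Definition poly_bounded X (m T : X -> nat) : Prop := exists a, forall x, T x <= a * (m x).+1 ^ a.

Lemma poly_bounded_le X (m T T' : X -> nat) : poly_bounded m T' -> (forall x, T x <= T' x) -> poly_bounded m T.
Proof. by move=> [a h] h2; exists a => x; apply: leq_trans (h2 x) (h x). Qed.

Lemma leq_monom a b c d n : a <= b -> c <= d -> a * n.+1 ^ c <= b * n.+1 ^ d.
Proof. by move=> h1 h2; rewrite leq_mul // leq_pexp2l. Qed.

Lemma poly_bounded_const X (m : X -> nat) k : poly_bounded m (fun _ => k).
Proof. by exists k => x; rewrite leq_pmulr // expn_gt0. Qed.

Lemma poly_bounded_id X (m : X -> nat) : poly_bounded m m.
Proof. by exists 1 => x; rewrite expn1 mul1n. Qed.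

Lemma poly_bounded_add X (m T1 T2 : X -> nat) : poly_bounded m T1 -> poly_bounded m T2 -> poly_bounded m (fun x => T1 x + T2 x).
Proof.
move=> [a h1] [b h2]; exists (a + b) => x; rewrite mulnDl.
by apply: leq_add; [apply: leq_trans (h1 x) _|apply: leq_trans (h2 x) _];
  rewrite leq_monom // ?leq_addr ?leq_addl.
Qed.

Lemma poly_bounded_mul X (m T1 T2 : X -> nat) : poly_bounded m T1 -> poly_bounded m T2 -> poly_bounded m (fun x => T1 x * T2 x).
Proof.
move=> [a h1] [b h2]; exists (a * b + (a + b)) => x.
apply: leq_trans (leq_mul (h1 x) (h2 x)) _.
by rewrite mulnACA -expnD leq_monom // ?leq_addr ?leq_addl.
Qed.

Lemma leq_exp m n e : m <= n -> m ^ e <= n ^ e.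
Proof. by case: e => // e h; rewrite leq_exp2r. Qed.

Definition tot (l : seq (seq bool)) : nat := sumn (map size l).

(* In the registers [rho] the program finds the data [ctx x]; it may use all registers from [b]
   on, which are empty at the start, and leaves [f x] in register [b] and the others as they were. *)
Definition polycomp X (ctx : X -> seq (seq bool)) (f : X -> seq bool) : Prop :=
  poly_bounded (fun x => tot (ctx x)) (fun x => size (f x)) /\
  forall rho b, 0 < b -> all (fun i => 0 < i < b) rho ->
  exists c W, cwf W c /\
  exists2 tm, poly_bounded (fun x => tot (ctx x)) tm &
    forall x s, map s rho = ctx x -> (forall i, b <= i -> s i = [::]) ->
    exec c s (upd s b (f x)) (tm x).

Ltac upd_ext := intros; apply: functional_extensionality => ?; rewrite /upd;
  repeat (case: eqP => //= ?); first [congruence | exfalso; lia].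

Lemma updE s a l : upd s a l a = l.
Proof. by rewrite /upd eqxx. Qed.

Lemma updN s a b l : b <> a -> upd s a l b = s b.
Proof. by rewrite /upd; case: eqP. Qed.

Lemma exec_eq c s s' s'' T : exec c s s' T -> s' = s'' -> exec c s s'' T.
Proof. by move=> h <-. Qed.

(** A move reverses the stack. Moves are therefore paired to restore the order, except for the
    input, which is stored reversed. *)
Definition moveP a b := Loop a (Push b false) (Push b true).

Lemma exec_move a b s : a <> b ->
  exec (moveP a b) s (upd (upd s a [::]) b (catrev (s a) (s b))) (size (s a) * 3 + 1).
Proof.
move=> ne; move e: (s a) => l; elim: l s e => [|x l IH] s e.
  apply: exec_eq (ExLoopE _ _ e) _.
  by rewrite /= -e upd_same upd_same.
have e1 : exec (if x then Push b true else Push b false) (upd s a l)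
   (upd (upd s a l) b (x :: s b)) 1.
  have := ExPush (upd s a l) b x; rewrite updN; last by lia.
  by case: (x).
have e2 := IH (upd (upd s a l) b (x :: s b)).
have ea : upd (upd s a l) b (x :: s b) a = l.
  by rewrite updN // updE.
have eb : upd (upd s a l) b (x :: s b) b = x :: s b by rewrite /upd eqxx.
have := ExLoop e e1 (e2 ea); rewrite eb /=.
have -> : (1 + (size l * 3 + 1)).+2 = (size l).+1 * 3 + 1 by lia.
move=> h; apply: exec_eq h _.
upd_ext.
Qed.

Definition clearP a := Loop a Skip Skip.

Lemma exec_clear a s : exec (clearP a) s (upd s a [::]) (size (s a) * 2 + 1).
Proof.
move e: (s a) => l; elim: l s e => [|x l IH] s e.
  by apply: exec_eq (ExLoopE _ _ e) _; rewrite -e upd_same.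
have e1 : exec (if x then Skip else Skip) (upd s a l) (upd s a l) 0 by case: x {e}; apply: ExSkip.
have ea : upd s a l a = l by rewrite /upd eqxx.
have := ExLoop e e1 (IH _ ea).
have -> : (0 + (size l * 2 + 1)).+2 = (size l).+1 * 2 + 1 by lia.
by move=> h; apply: exec_eq h _; upd_ext.
Qed.

Definition move2P t r b :=
  Loop t (Seq (Push r false) (Push b false)) (Seq (Push r true) (Push b true)).

Lemma exec_move2 t r b s : t <> r -> t <> b -> r <> b ->
  exec (move2P t r b) s
    (upd (upd (upd s t [::]) r (catrev (s t) (s r))) b (catrev (s t) (s b))) (size (s t) * 4 + 1).
Proof.
move=> n1 n2 n3; move e: (s t) => l; elim: l s e => [|x l IH] s e.
  apply: exec_eq (ExLoopE _ _ e) _.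
  by rewrite /= -e upd_same upd_same upd_same.
set s1 := upd (upd (upd s t l) r (x :: s r)) b (x :: s b).
have e1 : exec (if x then Seq (Push r true) (Push b true) else Seq (Push r false) (Push b false))
   (upd s t l) s1 2.
  have h1 := ExPush (upd s t l) r x.
  have := ExSeq h1 (ExPush _ b x).
  have -> : upd (upd s t l) r (x :: upd s t l r) b = s b.
    by rewrite !updN //; lia.
  have -> : upd s t l r = s r by rewrite updN //; lia.
  by rewrite /s1; case: (x).
have et : s1 t = l.
  by rewrite /s1 updN // updN // updE.
have er : s1 r = x :: s r.
  by rewrite /s1 updN // updE.
have eb : s1 b = x :: s b by rewrite /s1 /upd eqxx.
have := ExLoop e e1 (IH _ et); rewrite er eb /=.
have -> : (2 + (size l * 4 + 1)).+2 = (size l).+1 * 4 + 1 by lia.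
by move=> h; apply: exec_eq h _; rewrite /s1; upd_ext.
Qed.

Definition copyP r b := Seq (moveP r b.+1) (move2P b.+1 r b).

Lemma exec_copy r b s : r < b -> s b.+1 = [::] ->
  exec (copyP r b) s (upd s b (s r ++ s b)) (size (s r) * 7 + 2).
Proof.
move=> h et; have n1 : r <> b.+1 by lia.
have e1 := exec_move s n1.
rewrite et -/(rev (s r)) in e1.
set s1 := upd _ _ _ in e1.
have e2 := @exec_move2 b.+1 r b s1.
have E1 : s1 b.+1 = rev (s r) by rewrite /s1 /upd eqxx.
have E2 : s1 r = [::] by rewrite /s1 updN // updE.
have E3 : s1 b = s b.
  by rewrite /s1 !updN //; lia.
rewrite E1 E2 E3 -/(rev _) revK size_rev in e2.
rewrite [catrev (rev _) (s b)]catrevE revK in e2.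
have -> : size (s r) * 7 + 2 = size (s r) * 3 + 1 + (size (s r) * 4 + 1) by lia.
apply: exec_eq (ExSeq e1 (e2 _ _ _)) _; try lia.
rewrite /s1; upd_ext.
Qed.

Lemma comp_ext X (ctx : X -> seq (seq bool)) f g : f =1 g -> polycomp ctx f -> polycomp ctx g.
Proof. by move=> /functional_extensionality ->. Qed.

Lemma size_nth_tot l i : size (nth [::] l i) <= tot l.
Proof.
rewrite /tot; elim: l i => [|a l IH] [|i] //=; first by rewrite leq_addr.
exact: leq_trans (IH i) (leq_addl _ _).
Qed.

Lemma comp_var X (ctx : X -> seq (seq bool)) i : polycomp ctx (fun x => nth [::] (ctx x) i).
Proof.
split; first by apply: poly_bounded_le (poly_bounded_id _) _ => x; apply: size_nth_tot.
move=> rho b b0 hrho; case: (ltnP i (size rho)) => hi.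
  exists (copyP (nth 0 rho i) b), b.+1.
  have /andP [r0 rb] : 0 < nth 0 rho i < b by apply: (allP hrho); apply: mem_nth.
  split; first by rewrite /=; lia.
  exists (fun x => tot (ctx x) * 7 + 2).
    by apply: poly_bounded_add (poly_bounded_const _ _); apply: poly_bounded_mul (poly_bounded_id _) (poly_bounded_const _ _).
  move=> x s <- hs.
  have := exec_copy rb (hs b.+1 (leqnSn b)).
  rewrite (hs b) // cats0 (nth_map 0) //.
  move=> h; apply: ExWeak h _; rewrite -(nth_map 0 [::]) //.
  by have := size_nth_tot (map s rho) i; lia.
exists Skip, 0; split => //; exists (fun => 0); first exact: poly_bounded_const.
move=> x s e hs; apply: exec_eq (ExSkip s) _.
rewrite nth_default; last by rewrite -e size_map.
by rewrite -(hs b) // upd_same.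
Qed.

Lemma comp_const X (ctx : X -> seq (seq bool)) l : polycomp ctx (fun _ => l).
Proof.
split; first exact: poly_bounded_const.
move=> rho b b0 _; elim: l => [|a l [c [W [hw [tm ht h]]]]].
  exists Skip, 0; split => //; exists (fun=> 0); first exact: poly_bounded_const.
  move=> x s e hs; apply: exec_eq (ExSkip s) _.
  by rewrite -(hs b) // upd_same.
exists (Seq c (Push b a)), (maxn W b); split.
  by rewrite /= (cwf_weak (leq_maxl W b) hw) b0 leq_maxr.
exists (fun x => tm x + 1); first by apply: poly_bounded_add (poly_bounded_const _ _).
move=> x s e hs; apply: exec_eq (ExSeq (h x s e hs) (ExPush _ _ _)) _.
by rewrite updE; upd_ext.
Qed.

Lemma rho_weak b b' rho : b <= b' -> all (fun i => 0 < i < b) rho -> all (fun i => 0 < i < b') rho.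
Proof. by move=> h; apply: sub_all => i /=; lia. Qed.

Lemma map_upd s b l rho b' : b <= b' -> all (fun i => 0 < i < b) rho ->
  map (upd s b' l) rho = map s rho.
Proof.
by move=> hb /allP h; apply/eq_in_map => i /h hi; rewrite updN //; lia.
Qed.

Lemma comp_cat X (ctx : X -> seq (seq bool)) f g :
  polycomp ctx f -> polycomp ctx g -> polycomp ctx (fun x => f x ++ g x).
Proof.
move=> [pf hf] [pg hg]; split.
  by apply: poly_bounded_le (poly_bounded_add pf pg) _ => x; rewrite size_cat.
move=> rho b b0 hrho.
have [cf [Wf [wf [tf ptf hcf]]]] := hf rho b.+1 isT (rho_weak (leqnSn b) hrho).
have [cg [Wg [wg [tg ptg hcg]]]] := hg rho b b0 hrho.
(* The head of a list is the top of its stack, so [g x] is computed first and [f x] is put on top of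
   it. *)
exists (Seq cg (Seq cf (Seq (moveP b.+1 b.+2) (moveP b.+2 b)))), (maxn (maxn Wf Wg) b.+2).
split.
  rewrite /= (cwf_weak _ wf) ?(cwf_weak _ wg) /=; lia.
exists (fun x => tg x + (tf x + ((size (f x) * 3 + 1) + (size (f x) * 3 + 1)))).
  apply: poly_bounded_add ptg _; apply: poly_bounded_add ptf _.
  by apply: poly_bounded_add; apply: poly_bounded_add (poly_bounded_const _ _); apply: poly_bounded_mul (poly_bounded_const _ _).
move=> x s e hs.
have e1 := hcg x s e hs.
have e2 : exec cf (upd s b (g x)) (upd (upd s b (g x)) b.+1 (f x)) (tf x).
  apply: hcf; first by rewrite (map_upd _ _ (leqnn b)).
  by move=> i hi; rewrite updN ?hs //; lia.
set s2 := upd (upd s b (g x)) _ _ in e2.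
have e3 : exec (moveP b.+1 b.+2) s2 (upd (upd s b (g x)) b.+2 (rev (f x))) (size (f x) * 3 + 1).
  have := @exec_move b.+1 b.+2 s2; rewrite /s2 updE updN; last lia.
  rewrite updN; last lia.
  rewrite hs; last lia.
  move=> h; apply: exec_eq (h _) _; first by lia.
  have := hs b.+1 (leqnSn b) => hb1.
  upd_ext.
set s3 := upd (upd s b (g x)) b.+2 _ in e3.
have e4 := @exec_move b.+2 b s3.
rewrite {3 4 5}/s3 updE updN in e4; last lia.
rewrite updE catrevE revK size_rev in e4.
apply: exec_eq (ExSeq e1 (ExSeq e2 (ExSeq e3 (e4 _)))) _; first by lia.
have hb2 : s b.+2 = [::] by apply: hs; lia.
rewrite /s3; upd_ext.
Qed.

(** * Arithmetic and logic on unary numbers *)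

Definition CN X (ctx : X -> seq (seq bool)) (f : X -> nat) := polycomp ctx (fun x => nseq (f x) true).
Definition CB X (ctx : X -> seq (seq bool)) (f : X -> bool) := CN ctx (fun x => nat_of_bool (f x)).

(** In unary the size of a number is its value, so a size bound also bounds the number of rounds of
    a loop. *)
Lemma CN_poly_bounded X (ctx : X -> seq (seq bool)) f : CN ctx f -> poly_bounded (fun x => tot (ctx x)) f.
Proof. by move=> [h _]; apply: poly_bounded_le h _ => x; rewrite size_nseq. Qed.

Lemma comp_if X (ctx : X -> seq (seq bool)) (B : X -> bool) g h :
  CB ctx B -> polycomp ctx g -> polycomp ctx h -> polycomp ctx (fun x => if B x then g x else h x).
Proof.
move=> [_ hB] [pg hg] [ph hh]; split.
  by apply: poly_bounded_le (poly_bounded_add pg ph) _ => x; case: (B x); rewrite ?leq_addr ?leq_addl.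
move=> rho b b0 hrho.
have [cB [WB [wB [tB ptB hcB]]]] := hB rho b b0 hrho.
have [cg [Wg [wg [tg ptg hcg]]]] := hg rho b b0 hrho.
have [ch [Wh [wh [th pth hch]]]] := hh rho b b0 hrho.
exists (Seq cB (Case b ch Skip cg)), (maxn b (maxn WB (maxn Wg Wh))); split.
  by rewrite /= (cwf_weak _ wB) ?(cwf_weak _ wg) ?(cwf_weak _ wh) /=; lia.
exists (fun x => tB x + ((tg x + th x) + 2)).
  by apply: poly_bounded_add => //; apply: poly_bounded_add (poly_bounded_const _ _); apply: poly_bounded_add.
move=> x s e hs.
have e1 := hcB x s e hs.
have sb : upd s b [::] = s by rewrite -(hs b) // upd_same.
apply: ExSeq e1 _; rewrite addn2.
case: (B x) => /=.
  have eu : upd s b [:: true] b = [:: true] by rewrite updE.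
  apply: ExCase eu _; apply: (@ExWeak _ _ _ (tg x)); last by lia.
  have -> : upd (upd s b [:: true]) b [::] = s by rewrite -[RHS]sb; upd_ext.
  exact: hcg.
apply: ExCaseE; first by rewrite updE.
by apply: (@ExWeak _ _ _ (th x)); [rewrite sb; apply: hch|lia].
Qed.

(** The loop index enters as one more register, in unary, at the end of the context. *)
Definition ext X (ctx : X -> seq (seq bool)) (p : X * nat) : seq (seq bool) :=
  rcons (ctx p.1) (nseq p.2 true).

Lemma tot_ext X (ctx : X -> seq (seq bool)) p : tot (ext ctx p) = tot (ctx p.1) + p.2.
Proof. by rewrite /tot /ext map_rcons -cats1 sumn_cat /= size_nseq addn0. Qed.

Lemma poly_bounded_weak X (m T : X -> nat) (m' : X * nat -> nat) :
  (forall p, m p.1 <= m' p) -> poly_bounded m T -> poly_bounded m' (fun p => T p.1).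
Proof.
move=> h [a ha]; exists a => p; apply: leq_trans (ha _) _.
by rewrite leq_mul // leq_exp // ltnS.
Qed.

Lemma comp_weak X (ctx : X -> seq (seq bool)) f : polycomp ctx f -> polycomp (ext ctx) (fun p => f p.1).
Proof.
have htot (p : X * nat) : tot (ctx p.1) <= tot (ext ctx p) by rewrite tot_ext leq_addr.
move=> [pf hf]; split; first by apply: (poly_bounded_weak _ pf).
move=> rho b b0 hrho.
have hr : all (fun i => 0 < i < b) (take (size rho).-1 rho).
  by apply/allP => i /mem_take; apply: (allP hrho).
have [c [W [w [tm pt h]]]] := hf _ b b0 hr.
exists c, W; split=> //; exists (fun p => tm p.1); first by apply: (poly_bounded_weak _ pt).
move=> p s e hs; apply: h => //.
have := congr1 (fun l => take (size l).-1 l) e.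
by rewrite -map_take size_map /= /ext size_rcons -cats1 take_size_cat.
Qed.

Lemma CN_idx X (ctx : X -> seq (seq bool)) : CN (ext ctx) (fun p => p.2).
Proof.
split; first by apply: poly_bounded_le (poly_bounded_id _) _ => p; rewrite size_nseq tot_ext leq_addl.
move=> rho b b0 hrho; have [_ h] := comp_var (ext ctx) (size rho).-1.
have [c [W [hw [tm pt hc]]]] := h rho b b0 hrho.
exists c, W; split=> //; exists tm => // p s e hs.
have := hc p s e hs; rewrite -{1}e.
have -> : nth [::] (map s rho) (size rho).-1 = nseq p.2 true; last by [].
by rewrite e -(size_map s rho) e /ext size_rcons nth_rcons ltnn eqxx.
Qed.

Lemma poly_bounded_exp X (m T : X -> nat) a : poly_bounded m T -> poly_bounded m (fun x => T x ^ a).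
Proof.
move=> h; elim: a => [|a IH]; first exact: poly_bounded_const.
by apply: poly_bounded_le (poly_bounded_mul h IH) _ => x; rewrite expnS.
Qed.

(** The index stays below the polynomially bounded [f x], so a bound polynomial in the extended
    context is polynomial in the old one, uniformly in the index. *)
Lemma poly_bounded_sup X (ctx : X -> seq (seq bool)) (f : X -> nat) (T : X * nat -> nat) :
  poly_bounded (fun x => tot (ctx x)) f -> poly_bounded (fun p => tot (ext ctx p)) T ->
  exists2 B, poly_bounded (fun x => tot (ctx x)) B & forall x i, i < f x -> T (x, i) <= B x.
Proof.
move=> hf [a ha]; exists (fun x => a * (tot (ctx x) + f x + 1) ^ a).
  apply: poly_bounded_mul; first exact: poly_bounded_const.
  by apply: poly_bounded_exp; apply: poly_bounded_add (poly_bounded_const _ _); apply: poly_bounded_add hf; apply: poly_bounded_id.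
move=> x i hi; apply: leq_trans (ha _) _; rewrite tot_ext /=.
by rewrite leq_mul // leq_exp //; lia.
Qed.

(* Popping the loop counter leaves the index in unary in the same register; the indices come in
   decreasing order, so each output is put in front. *)
Lemma comp_for X (ctx : X -> seq (seq bool)) f (g : X -> nat -> seq bool) :
  CN ctx f -> polycomp (ext ctx) (fun p => g p.1 p.2) ->
  polycomp ctx (fun x => flatten [seq g x i | i <- iota 0 (f x)]).
Proof.
move=> cf [pg hg]; have pf := CN_poly_bounded cf; have [_ hf] := cf.
have [S pS hS] := poly_bounded_sup pf pg; split.
  apply: poly_bounded_le (poly_bounded_mul pf pS) _ => x; rewrite size_flatten /shape -map_comp.
  have : forall i, i \in iota 0 (f x) -> size (g x i) <= S x.
    by move=> i; rewrite mem_iota => /andP [_ hi]; apply: hS.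
  rewrite -{3}(size_iota 0 (f x)); elim: (iota 0 (f x)) => //= i l IH h.
  by rewrite mulSn leq_add // ?h ?mem_head // IH // => j hj; apply: h; rewrite inE hj orbT.
move=> rho b b0 hrho.
have [c1 [W1 [w1 [t1 pt1 h1]]]] := hf rho b.+1 isT (rho_weak (leqnSn b) hrho).
have hrho2 : all (fun i => 0 < i < b.+2) (rcons rho b.+1).
  by rewrite all_rcons ltnS leqnn /= (rho_weak _ hrho) //; lia.
have [c2 [W2 [w2 [t2 pt2 h2]]]] := hg (rcons rho b.+1) b.+2 isT hrho2.
have [B pB hB] := poly_bounded_sup pf pt2.
pose body := Seq c2 (Seq (moveP b.+2 b.+3) (moveP b.+3 b)).
pose K x := B x + ((S x * 3 + 1) + (S x * 3 + 1)) + 2.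
exists (Seq c1 (Loop b.+1 Skip body)), (maxn b.+3 (maxn W1 W2)); split.
  by rewrite /= (cwf_weak _ w1) ?(cwf_weak _ w2) /=; lia.
have pK : poly_bounded (fun x => tot (ctx x)) K.
  apply: poly_bounded_add (poly_bounded_const _ _); apply: poly_bounded_add pB _.
  by apply: poly_bounded_add; apply: poly_bounded_add (poly_bounded_const _ _); apply: poly_bounded_mul pS (poly_bounded_const _ _).
exists (fun x => t1 x + (f x * K x + 1)).
  by apply: poly_bounded_add pt1 _; apply: poly_bounded_add (poly_bounded_const _ _); apply: poly_bounded_mul.
move=> x s e hs.
have e1 : exec c1 s (upd s b.+1 (nseq (f x) true)) (t1 x).
  by apply: h1 => // i hi; apply: hs; lia.
pose sti i acc := upd (upd s b acc) b.+1 (nseq i true).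
have main : forall i acc, i <= f x ->
    exec (Loop b.+1 Skip body) (sti i acc)
      (upd s b (flatten [seq g x j | j <- iota 0 i] ++ acc)) (i * K x + 1).
  elim=> [|i IH] acc hi.
    have ei : sti 0 acc b.+1 = [::] by rewrite /sti updE.
    apply: exec_eq (ExLoopE _ _ ei) _; rewrite /sti /=.
    have := hs b.+1 (leqnSn _); upd_ext.
  have ei : sti i.+1 acc b.+1 = true :: nseq i true by rewrite /sti updE.
  have eb : exec body (sti i acc) (sti i (g x i ++ acc)) (B x + ((S x * 3 + 1) + (S x * 3 + 1))).
    have x1 : exec c2 (sti i acc) (upd (sti i acc) b.+2 (g x i)) (B x).
      apply: ExWeak (h2 (x, i) (sti i acc) _ _) (hB _ _ hi).
        rewrite map_rcons /ext /= /sti updE; congr rcons.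
        by rewrite !(map_upd _ _ _ hrho) //.
      by move=> j hj; rewrite /sti updN ?updN ?hs //; lia.
    have sz := hS x i hi.
    set s2 := upd (sti i acc) _ _ in x1.
    have x2 := @exec_move b.+2 b.+3 s2.
    have E1 : s2 b.+2 = g x i by rewrite /s2 updE.
    have E2 : s2 b.+3 = [::] by rewrite /s2 /sti !updN ?hs //; lia.
    rewrite E1 E2 -/(rev _) in x2.
    set s3 := upd (upd s2 _ _) _ _ in x2.
    have x3 := @exec_move b.+3 b s3.
    have E3 : s3 b.+3 = rev (g x i) by rewrite /s3 updE.
    have E4 : s3 b = acc by rewrite /s3 /s2 /sti; do 4 (rewrite updN; last by lia); rewrite updE.
    rewrite E3 E4 catrevE revK size_rev in x3.
    have {}x2 := ExWeak (x2 _) (leq_add (leq_mul sz (leqnn 3)) (leqnn 1)).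
    have {}x3 := ExWeak (x3 _) (leq_add (leq_mul sz (leqnn 3)) (leqnn 1)).
    apply: exec_eq (ExSeq x1 (ExSeq (x2 _) (x3 _))) _; try lia.
    have := hs b.+2; have := hs b.+3 => hb3 hb2.
    rewrite /s3 /s2 /sti; have {hb2} := hb2 _; have {hb3} := hb3 _ => hb3 hb2.
    have {hb3} := hb3 (leq_trans (leqnSn b) (leq_trans (leqnSn _) (leqnSn _))).
    have {hb2} := hb2 (leq_trans (leqnSn b) (leqnSn _)).
    upd_ext.
  have eu : upd (sti i.+1 acc) b.+1 (nseq i true) = sti i acc by rewrite /sti; upd_ext.
  have := ExLoop (c0 := Skip) (c1 := body) ei; rewrite eu => h.
  have {h} := h _ _ _ _ eb (IH (g x i ++ acc) (ltnW hi)).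
  rewrite -(addn1 i) iotaD map_cat flatten_cat /= cats0 -catA => h.
  by apply: ExWeak h _; rewrite /K; nia.
apply: ExSeq e1 _.
have -> : upd s b.+1 (nseq (f x) true) = sti (f x) [::].
  by rewrite /sti; have := hs b (leqnn b); upd_ext.
by have := main (f x) [::] (leqnn _); rewrite cats0.
Qed.

Definition dropP a b := Loop a Skip (Case b Skip Skip Skip).

Lemma exec_drop a b s n : a <> b -> s a = nseq n true ->
  exec (dropP a b) s (upd (upd s a [::]) b (drop n (s b))) (n * 4 + 1).
Proof.
move=> ne; elim: n s => [|n IH] s e.
  apply: exec_eq (ExLoopE _ _ e) _.
  by rewrite drop0 -[ [::]]/(nseq 0 true) -e upd_same upd_same.
have eb : upd s a (nseq n true) b = s b by rewrite updN //; lia.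
have e1 : exec (Case b Skip Skip Skip) (upd s a (nseq n true))
    (upd (upd s a (nseq n true)) b (behead (s b))) 2.
  case es: (s b) eb => [|y l] eb.
    by rewrite /= -eb upd_same; apply: ExCaseE eb (ExSkip _).
  by apply: ExCase eb _; case: (y); apply: ExSkip.
have := ExLoop (c0 := Skip) e e1 => h.
set s1 := upd (upd s a _) b _ in h.
have ea : s1 a = nseq n true by rewrite /s1 updN // updE.
have {h} := h _ _ (IH s1 ea).
have -> : s1 b = behead (s b) by rewrite /s1 updE.
have -> : drop n (behead (s b)) = drop n.+1 (s b) by rewrite -drop1 drop_drop addn1.
move=> h; apply: (@ExWeak _ _ _ _ _ (exec_eq h _)); last by lia.
rewrite /s1; upd_ext.
Qed.

Lemma comp_drop X (ctx : X -> seq (seq bool)) l i :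
  polycomp ctx l -> CN ctx i -> polycomp ctx (fun x => drop (i x) (l x)).
Proof.
move=> [pl hl] ci; have pi := CN_poly_bounded ci; have [_ hi] := ci; split.
  by apply: poly_bounded_le pl _ => x; rewrite size_drop leq_subr.
move=> rho b b0 hrho.
have [c1 [W1 [w1 [t1 pt1 h1]]]] := hl rho b b0 hrho.
have [c2 [W2 [w2 [t2 pt2 h2]]]] := hi rho b.+1 isT (rho_weak (leqnSn b) hrho).
exists (Seq c1 (Seq c2 (dropP b.+1 b))), (maxn b.+1 (maxn W1 W2)); split.
  by rewrite /= (cwf_weak _ w1) ?(cwf_weak _ w2) /=; lia.
exists (fun x => t1 x + (t2 x + (i x * 4 + 1))).
  apply: poly_bounded_add pt1 _; apply: poly_bounded_add pt2 _; apply: poly_bounded_add (poly_bounded_const _ _).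
  exact: poly_bounded_mul pi (poly_bounded_const _ _).
move=> x s e hs.
have e1 := h1 x s e hs.
have e2 : exec c2 (upd s b (l x)) (upd (upd s b (l x)) b.+1 (nseq (i x) true)) (t2 x).
  apply: h2; first by rewrite (map_upd _ _ (leqnn b)).
  by move=> j hj; rewrite updN ?hs //; lia.
have := @exec_drop b.+1 b (upd (upd s b (l x)) b.+1 (nseq (i x) true)) (i x).
rewrite updE updN ?updE; last by lia.
move=> e3; apply: exec_eq (ExSeq e1 (ExSeq e2 (e3 _ erefl))) _; first by lia.
by have := hs b.+1 (leqnSn b); upd_ext.
Qed.

Lemma CN_size X (ctx : X -> seq (seq bool)) l : polycomp ctx l -> CN ctx (fun x => size (l x)).
Proof.
move=> [pl hl]; split; first by apply: poly_bounded_le pl _ => x; rewrite size_nseq.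
move=> rho b b0 hrho.
have [c1 [W1 [w1 [t1 pt1 h1]]]] := hl rho b.+1 isT (rho_weak (leqnSn b) hrho).
exists (Seq c1 (Loop b.+1 (Push b true) (Push b true))), (maxn b.+1 W1); split.
  by rewrite /= (cwf_weak _ w1) /=; lia.
exists (fun x => t1 x + (size (l x) * 3 + 1)).
  apply: poly_bounded_add pt1 _; apply: poly_bounded_add (poly_bounded_const _ _).
  exact: poly_bounded_mul pl (poly_bounded_const _ _).
move=> x s e hs.
have e1 : exec c1 s (upd s b.+1 (l x)) (t1 x) by apply: h1 => // j hj; apply: hs; lia.
apply: ExSeq e1 _.
have main : forall k m, exec (Loop b.+1 (Push b true) (Push b true))
    (upd (upd s b.+1 k) b (nseq m true)) (upd s b (nseq (size k + m) true)) (size k * 3 + 1).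
  elim=> [|y k IH] m.
    have ek : upd (upd s b.+1 [::]) b (nseq m true) b.+1 = [::] by rewrite updN ?updE //; lia.
    by apply: exec_eq (ExLoopE _ _ ek) _; have := hs b.+1 (leqnSn b); upd_ext.
  have ek : upd (upd s b.+1 (y :: k)) b (nseq m true) b.+1 = y :: k by rewrite updN ?updE //; lia.
  have ep : exec (if y then Push b true else Push b true)
     (upd (upd (upd s b.+1 (y :: k)) b (nseq m true)) b.+1 k)
     (upd (upd s b.+1 k) b (nseq m.+1 true)) 1.
    have := ExPush (upd (upd (upd s b.+1 (y :: k)) b (nseq m true)) b.+1 k) b true.
    rewrite updN ?updE; last by lia.
    move=> h; case: (y) in ek h *; apply: exec_eq h _; upd_ext.
  have := ExLoop ek ep (IH m.+1); rewrite addnS => h.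
  by apply: ExWeak h _ => /=; lia.
have := main (l x) 0; rewrite addn0.
have -> : upd (upd s b.+1 (l x)) b (nseq 0 true) = upd s b.+1 (l x); last by [].
by have := hs b (leqnn b); upd_ext.
Qed.

Lemma CB_head X (ctx : X -> seq (seq bool)) l : polycomp ctx l -> CB ctx (fun x => head false (l x)).
Proof.
move=> [pl hl]; split; first by apply: poly_bounded_le (poly_bounded_const _ 1) _ => x; rewrite size_nseq; case: head.
move=> rho b b0 hrho.
have [c1 [W1 [w1 [t1 pt1 h1]]]] := hl rho b b0 hrho.
exists (Seq c1 (Case b Skip (clearP b) (Seq (clearP b) (Push b true)))), (maxn b W1); split.
  by rewrite /= (cwf_weak _ w1) /=; lia.
exists (fun x => t1 x + (size (l x) * 2 + 4)).
  apply: poly_bounded_add pt1 _; apply: poly_bounded_add (poly_bounded_const _ _).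
  exact: poly_bounded_mul pl (poly_bounded_const _ _).
move=> x s e hs.
apply: ExSeq (h1 x s e hs) _.
case el: (l x) => [|y k] /=.
  apply: ExWeak (ExCaseE _ _ _ (ExSkip _)) _; first by rewrite updE.
  by [].
have eu : upd s b (y :: k) b = y :: k by rewrite updE.
have := exec_clear b (upd (upd s b (y :: k)) b k); rewrite updE => e2.
have e3 : upd (upd (upd s b (y :: k)) b k) b [::] = upd s b [::] by upd_ext.
rewrite e3 in e2.
case: y el eu e2 e3 => el eu e2 e3.
  have := ExSeq e2 (ExPush (upd s b [::]) b true); rewrite updE => e4.
  have e5 := @ExCase b Skip (clearP b) (Seq (clearP b) (Push b true)) _ true k _ _ eu e4.
  by apply: ExWeak (exec_eq e5 _) _; [upd_ext|lia].
have e5 := @ExCase b Skip (clearP b) (Seq (clearP b) (Push b true)) _ false k _ _ eu e2.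
by apply: ExWeak (exec_eq e5 _) _; [upd_ext|lia].
Qed.

Lemma CN_ext X (ctx : X -> seq (seq bool)) f g : f =1 g -> CN ctx f -> CN ctx g.
Proof. by move=> e; apply: comp_ext => x; rewrite e. Qed.

Lemma CB_ext X (ctx : X -> seq (seq bool)) f g : f =1 g -> CB ctx f -> CB ctx g.
Proof. by move=> e; apply: CN_ext => x; rewrite e. Qed.

Lemma CN_const X (ctx : X -> seq (seq bool)) k : CN ctx (fun _ => k).
Proof. exact: comp_const. Qed.

Lemma CN_add X (ctx : X -> seq (seq bool)) f g :
  CN ctx f -> CN ctx g -> CN ctx (fun x => f x + g x).
Proof. by move=> h1 h2; apply: comp_ext (comp_cat h1 h2) => x; rewrite nseqD. Qed.

(** Unary addition is concatenation, so a loop that collects its outputs computes a sum. Products,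
    quotients, square roots and bounded quantifiers all reduce to this. *)
Lemma CN_sum X (ctx : X -> seq (seq bool)) f (g : X -> nat -> nat) :
  CN ctx f -> CN (ext ctx) (fun p => g p.1 p.2) ->
  CN ctx (fun x => \sum_(0 <= i < f x) g x i).
Proof.
move=> h1 h2; apply: comp_ext (comp_for (g := fun x i => nseq (g x i) true) h1 h2) => x.
rewrite /index_iota subn0; elim: (iota 0 (f x)) => [|i l IH] /=; first by rewrite big_nil.
by rewrite IH big_cons nseqD.
Qed.

Lemma CN_weak X (ctx : X -> seq (seq bool)) f : CN ctx f -> CN (ext ctx) (fun p => f p.1).
Proof. exact: comp_weak. Qed.

Lemma CN_mul X (ctx : X -> seq (seq bool)) f g :
  CN ctx f -> CN ctx g -> CN ctx (fun x => f x * g x).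
Proof.
move=> h1 h2; apply: CN_ext (CN_sum (g := fun x _ => g x) h1 (CN_weak h2)) => x.
by rewrite sum_nat_const_nat subn0.
Qed.

Lemma CN_sub X (ctx : X -> seq (seq bool)) f g :
  CN ctx f -> CN ctx g -> CN ctx (fun x => f x - g x).
Proof. by move=> h1 h2; apply: comp_ext (comp_drop h1 h2) => x; rewrite drop_nseq. Qed.

Lemma CB_pos X (ctx : X -> seq (seq bool)) f : CN ctx f -> CB ctx (fun x => 0 < f x).
Proof. by move=> h; apply: CB_ext (CB_head h) => x; case: (f x). Qed.

Lemma CN_if X (ctx : X -> seq (seq bool)) (b : X -> bool) f g :
  CB ctx b -> CN ctx f -> CN ctx g -> CN ctx (fun x => if b x then f x else g x).
Proof.
by move=> hb hf hg; apply: comp_ext (comp_if hb hf hg) => x; case: (b x).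
Qed.

Lemma CB_and X (ctx : X -> seq (seq bool)) (a b : X -> bool) :
  CB ctx a -> CB ctx b -> CB ctx (fun x => a x && b x).
Proof.
by move=> ha hb; apply: CN_ext (CN_if ha hb (CN_const ctx 0)) => x; case: (a x).
Qed.

Lemma CB_or X (ctx : X -> seq (seq bool)) (a b : X -> bool) :
  CB ctx a -> CB ctx b -> CB ctx (fun x => a x || b x).
Proof.
by move=> ha hb; apply: CN_ext (CN_if ha (CN_const ctx 1) hb) => x; case: (a x).
Qed.

Lemma CB_not X (ctx : X -> seq (seq bool)) (a : X -> bool) :
  CB ctx a -> CB ctx (fun x => ~~ a x).
Proof.
by move=> ha; apply: CN_ext (CN_if ha (CN_const ctx 0) (CN_const ctx 1)) => x; case: (a x).
Qed.

Lemma CB_leq X (ctx : X -> seq (seq bool)) f g :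
  CN ctx f -> CN ctx g -> CB ctx (fun x => f x <= g x).
Proof.
by move=> hf hg; apply: CB_ext (CB_not (CB_pos (CN_sub hf hg))) => x; rewrite -leqNgt leqn0.
Qed.

Lemma CN_S X (ctx : X -> seq (seq bool)) f : CN ctx f -> CN ctx (fun x => (f x).+1).
Proof. by move=> h; apply: CN_ext (CN_add h (CN_const ctx 1)) => x; rewrite addn1. Qed.

Lemma CB_ltn X (ctx : X -> seq (seq bool)) f g :
  CN ctx f -> CN ctx g -> CB ctx (fun x => f x < g x).
Proof. by move=> hf hg; apply: CB_leq (CN_S hf) hg. Qed.

Lemma CB_eq X (ctx : X -> seq (seq bool)) f g :
  CN ctx f -> CN ctx g -> CB ctx (fun x => f x == g x).
Proof.
by move=> hf hg; apply: CB_ext (CB_and (CB_leq hf hg) (CB_leq hg hf)) => x; rewrite -eqn_leq.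
Qed.

Lemma CB_true X (ctx : X -> seq (seq bool)) : CB ctx (fun _ => true).
Proof. exact: CN_const. Qed.

Lemma CB_all X I (ctx : X -> seq (seq bool)) (P : X -> I -> bool) (l : seq I) :
  (forall i, CB ctx (fun x => P x i)) -> CB ctx (fun x => all (P x) l).
Proof. by move=> h; elim: l => [|i l IH] /=; [apply: CB_true|apply: CB_and]. Qed.

Lemma CB_has X I (ctx : X -> seq (seq bool)) (P : X -> I -> bool) (l : seq I) :
  (forall i, CB ctx (fun x => P x i)) -> CB ctx (fun x => has (P x) l).
Proof. by move=> h; elim: l => [|i l IH] /=; [apply: CN_const|apply: CB_or]. Qed.

Lemma CB_nth X (ctx : X -> seq (seq bool)) l f :
  polycomp ctx l -> CN ctx f -> CB ctx (fun x => nth false (l x) (f x)).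
Proof.
move=> hl hf; apply: CB_ext (CB_head (comp_drop hl hf)) => x.
by rewrite -nth0 nth_drop addn0.
Qed.

Lemma CN_expn X (ctx : X -> seq (seq bool)) f k : CN ctx f -> CN ctx (fun x => f x ^ k).
Proof.
move=> h; elim: k => [|k IH]; first exact: CN_const.
by apply: CN_ext (CN_mul h IH) => x; rewrite expnS.
Qed.

Lemma sum_ltn k m : k <= m -> \sum_(0 <= i < m) (i < k) = k.
Proof.
move=> h; rewrite (@big_cat_nat _ _ _ k) //=.
rewrite (eq_big_nat _ _ (F2 := fun=> 1)); last by move=> i /andP [_ ->].
rewrite [X in _ + X](eq_big_nat _ _ (F2 := fun=> 0)); last by move=> i /andP [hi _]; rewrite ltnNge hi.
by rewrite !sum_nat_const_nat; lia.
Qed.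

(** The quotient counts the positive multiples of [d] up to [m]; the guard reproduces the convention
    that division by 0 gives 0. *)
Lemma divn_sum m d : m %/ d = \sum_(0 <= i < m) ((0 < d) && (i.+1 * d <= m)).
Proof.
case: d => [|d]; first by rewrite big1_seq.
rewrite -[LHS](sum_ltn (leq_div m d.+1)); apply: eq_bigr => i _.
by rewrite leq_divRL.
Qed.

Lemma CN_div X (ctx : X -> seq (seq bool)) f g :
  CN ctx f -> CN ctx g -> CN ctx (fun x => f x %/ g x).
Proof.
move=> hf hg; apply: CN_ext (CN_sum
  (g := fun x i => (0 < g x) && (i.+1 * g x <= f x) : nat) hf _) => [x|].
  by rewrite divn_sum.
apply: CB_and; first exact: CB_pos (CN_weak hg).
by apply: CB_leq (CN_weak hf); apply: CN_mul (CN_weak hg); apply: CN_S (CN_idx ctx).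
Qed.

Lemma CN_mod X (ctx : X -> seq (seq bool)) f g :
  CN ctx f -> CN ctx g -> CN ctx (fun x => f x %% g x).
Proof.
move=> hf hg; apply: CN_ext (CN_sub hf (CN_mul (CN_div hf hg) hg)) => x.
by rewrite {1}(divn_eq (f x) (g x)) addKn.
Qed.

Lemma CB_forall X (ctx : X -> seq (seq bool)) f (P : X -> nat -> bool) :
  CN ctx f -> CB (ext ctx) (fun p => P p.1 p.2) -> CB ctx (fun x => all (P x) (iota 0 (f x))).
Proof.
move=> hf hP.
have h := CN_sum (g := fun x i => ~~ P x i : nat) hf (CB_not hP).
apply: CB_ext (CB_not (CB_pos h)) => x; rewrite -leqNgt leqn0 /index_iota subn0.
elim: (iota 0 (f x)) => [|i l IH] /=; first by rewrite big_nil.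
by rewrite big_cons addn_eq0 IH; case: (P x i).
Qed.

(** * Simulating a Turing machine on stacks *)

Definition bits (a : sym) : seq bool :=
  match a with S0 => [:: true; false] | S1 => [:: true; true] | SB => [:: false; false] end.

Definition bitsl (l : seq sym) : seq bool := flatten (map bits l).

Definition pushS r a : cmd :=
  match a with
  | S0 => Seq (Push r false) (Push r true)
  | S1 => Seq (Push r true) (Push r true)
  | SB => Seq (Push r false) (Push r false)
  end.

Definition popS r (kE : cmd) (k : sym -> cmd) : cmd :=
  Case r kE (Case r Skip (k SB) Skip) (Case r Skip (k S0) (k S1)).

Lemma exec_pushS r a s : exec (pushS r a) s (upd s r (bits a ++ s r)) 2.
Proof.
case: a => /=;
  apply: exec_eq (ExSeq (ExPush _ _ _) (ExPush _ _ _)) _; rewrite updE; upd_ext.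
Qed.

Lemma exec_popS r kE k a l s s' T : s r = bits a ++ l ->
  exec (k a) (upd s r l) s' T -> exec (popS r kE k) s s' (T + 4).
Proof.
move=> e h; rewrite addn4.
have eu z : upd (upd s r z) r l = upd s r l by upd_ext.
by case: a e h => /= e h; apply: (@ExCase r kE _ _ _ _ _ _ _ e) => /=;
  (apply: ExCase; [by rewrite updE|]); rewrite /= eu.
Qed.

Lemma exec_popS_nil r kE k s s' T : s r = [::] ->
  exec kE s s' T -> exec (popS r kE k) s s' (T + 2).
Proof. by move=> e h; rewrite addn2; apply: ExCaseE. Qed.

Definition pushn r n : cmd := iter n (fun c => Seq c (Push r true)) Skip.

Lemma exec_pushn r n s : s r = [::] -> exec (pushn r n) s (upd s r (nseq n true)) n.
Proof.
move=> e; elim: n => [|n IH].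
  by apply: exec_eq (ExSkip _) _; rewrite -[nseq _ _]/[::] -e upd_same.
have := ExSeq IH (ExPush _ r true); rewrite updE addn1 => h.
by apply: exec_eq h _; upd_ext.
Qed.

(** The stacks hold only a finite part of the tape; when the head leaves it, a blank is supplied. *)
Definition act d a : cmd :=
  match d with
  | DS => pushS 2 a
  | DR => Seq (pushS 3 a) (popS 2 (pushS 2 SB) (pushS 2))
  | DL => Seq (pushS 2 a) (popS 3 (pushS 2 SB) (pushS 2))
  end.

Definition stepc (M : TM) (q : 'I_(nQ M).+1) : cmd :=
  popS 2 Skip (fun a =>
    match trans q a with
    | None => pushS 2 a
    | Some (q', b, d) => Seq (act d b) (pushn 4 (nat_of_ord q').+1)
    end).

(** Popping register 4 bit by bit turns the unary state into a position in the program, and leaves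
    the register empty for the next state. *)
Fixpoint disp (M : TM) (fuel i : nat) : cmd :=
  if fuel is fuel'.+1 then Case 4 (stepc (inord i : 'I_(nQ M).+1)) Skip (disp M fuel' i.+1)
  else Skip.

(* Register 2 holds the scanned symbol and the tape to its right, register 3 the tape to its
   left, and register 4 the state q as q + 1 ones; an empty register 4 stops the loop. *)
Definition simc (M : TM) : cmd := Loop 4 Skip (disp M (nQ M).+1 0).

Definition simst (s : store) (l r : seq sym) (q : seq bool) : store :=
  upd (upd (upd s 2 (bitsl r)) 3 (bitsl l)) 4 q.

Lemma simst3 s l r q a : upd (simst s l r q) 3 (bits a ++ bitsl l) = simst s (a :: l) r q.
Proof. by rewrite /simst; upd_ext. Qed.

Lemma simst2 s l r q a : upd (simst s l r q) 2 (bits a ++ bitsl r) = simst s l (a :: r) q.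
Proof. by rewrite /simst; upd_ext. Qed.

Lemma simst2' s l r r' q : upd (simst s l r q) 2 (bitsl r') = simst s l r' q.
Proof. by rewrite /simst; upd_ext. Qed.

Lemma simst3' s l r l' q : upd (simst s l r q) 3 (bitsl l') = simst s l' r q.
Proof. by rewrite /simst; upd_ext. Qed.

Lemma exec_push2 s l r q a : exec (pushS 2 a) (simst s l r q) (simst s l (a :: r) q) 2.
Proof. by have := exec_pushS 2 a (simst s l r q); rewrite simst2. Qed.

Lemma exec_push3 s l r q a : exec (pushS 3 a) (simst s l r q) (simst s (a :: l) r q) 2.
Proof. by have := exec_pushS 3 a (simst s l r q); rewrite simst3. Qed.

Lemma exec_act (M : TM) (q : 'I_(nQ M).+1) s l r a d :
  let c := move q l a r d in
  exec (act d a) (simst s l r [::]) (simst s (cleft c) (chead c :: cright c) [::]) 8.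
Proof.
case: d => /=.
- case: l => [|b l] /=.
    have h := exec_popS_nil (pushS 2) (erefl : simst s [::] (a :: r) [::] 3 = [::])
      (exec_push2 s [::] (a :: r) [::] SB).
    by apply: ExWeak (ExSeq (exec_push2 s _ r _ a) h) _.
  have h := @exec_popS 3 (pushS 2 SB) (pushS 2) b (bitsl l) (simst s (b :: l) (a :: r) [::]) _ _ erefl.
  rewrite simst3' in h.
  by apply: ExWeak (ExSeq (exec_push2 s _ r _ a) (h _ _ (exec_push2 s l _ _ b))) _.
- case: r => [|b r] /=.
    have h := exec_popS_nil (pushS 2) (erefl : simst s (a :: l) [::] [::] 2 = [::])
      (exec_push2 s (a :: l) [::] [::] SB).
    by apply: ExWeak (ExSeq (exec_push3 s l _ _ a) h) _.
  have h := @exec_popS 2 (pushS 2 SB) (pushS 2) b (bitsl r) (simst s (a :: l) (b :: r) [::]) _ _ erefl.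
  rewrite simst2' in h.
  by apply: ExWeak (ExSeq (exec_push3 s l _ _ a) (h _ _ (exec_push2 s _ r _ b))) _.
- by apply: ExWeak (exec_push2 s l r _ a) _.
Qed.

Lemma exec_stepc (M : TM) (c : config M) s :
  exec (stepc (cstate c)) (simst s (cleft c) (chead c :: cright c) [::])
    (match trans (cstate c) (chead c) with
     | None => simst s (cleft c) (chead c :: cright c) [::]
     | Some (q', b, d) => let c' := move q' (cleft c) b (cright c) d in
        simst s (cleft c') (chead c' :: cright c') (nseq (nat_of_ord q').+1 true)
     end) (nQ M + 13).
Proof.
pose k a := match trans (cstate c) a with
  | None => pushS 2 a
  | Some (q', b, d) => Seq (act d b) (pushn 4 (nat_of_ord q').+1)
  end.
have h s' T := @exec_popS 2 Skip k (chead c) (bitsl (cright c))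
  (simst s (cleft c) (chead c :: cright c) [::]) s' T erefl.
rewrite simst2' {1}/k in h; case e: trans h => [[[q' b] d]|] h; last first.
  apply: ExWeak (h _ _ (exec_push2 s (cleft c) (cright c) [::] (chead c))) _; lia.
have /= h2 := exec_act q' s (cleft c) (cright c) b d.
set c' := move _ _ _ _ _ in h2 *.
set sc := simst _ (cleft c') _ _ in h2.
have h3 := @exec_pushn 4 (nat_of_ord q').+1 sc erefl.
apply: ExWeak (exec_eq (h _ _ (ExSeq h2 h3)) _) _; first by rewrite /sc /simst; upd_ext.
by have := ltn_ord q'; lia.
Qed.

Lemma exec_disp (M : TM) fuel i m s l r s' T : m < fuel ->
  exec (stepc (inord (i + m) : 'I_(nQ M).+1)) (simst s l r [::]) s' T ->
  exec (disp M fuel i) (simst s l r (nseq m true)) s' (T + m.+1 * 2).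
Proof.
elim: fuel i m => //= fuel IH i [|m] hm h.
  by rewrite mul1n addn2; apply: ExCaseE; rewrite // -(addn0 i).
have e : simst s l r (nseq m.+1 true) 4 = true :: nseq m true by [].
have -> : T + m.+2 * 2 = (T + m.+1 * 2).+2 by lia.
apply: ExCase e _ => /=.
have -> : upd (simst s l r (nseq m.+1 true)) 4 (nseq m true) = simst s l r (nseq m true).
  by rewrite /simst; upd_ext.
by apply: IH => //; rewrite addSnnS.
Qed.

(** The factor per simulated step is made of [nQ M + 13] for the step itself, at most
    [2 * (nQ M).+1] for finding the state, and the overhead of the loop. *)
Lemma exec_simc (M : TM) T (c c' : config M) s : run T c = Some c' ->
  exec (simc M) (simst s (cleft c) (chead c :: cright c) (nseq (nat_of_ord (cstate c)).+1 true))
    (simst s (cleft c') (chead c' :: cright c') [::]) (T.+1 * (3 * nQ M + 20)).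
Proof.
elim: T c => [|T IH] c /=.
  case e: trans => [[[q a] d]|] // [<-].
  have h := exec_stepc c s; rewrite e in h.
  rewrite -[cstate c]inord_val -[nat_of_ord (cstate c)]add0n in h.
  have h2 := exec_disp (ltn_ord (cstate c)) h.
  set s1 := simst _ _ _ (nseq _.+1 true).
  have e1 : s1 4 = true :: nseq (cstate c) true by [].
  have eu : upd s1 4 (nseq (cstate c) true) = simst s (cleft c) (chead c :: cright c) (nseq (cstate c) true).
    by rewrite /s1 /simst; upd_ext.
  have h3 := @ExLoop 4 Skip (disp M (nQ M).+1 0) s1 true _ _ _ _ _ e1.
  rewrite eu in h3; have {}h3 := h3 _ _ _ _ h2 (ExLoopE _ _ erefl).
  by apply: ExWeak h3 _; have := ltn_ord (cstate c); lia.
case e: trans => [[[q a] d]|]; last first.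
  move=> hr.
  have h := IH c; case: (T) h {IH} => [|T'] /=; rewrite e => /(_ hr) h.
    by apply: ExWeak h _; lia.
  by apply: ExWeak h _; lia.
move=> hr; have h := exec_stepc c s; rewrite e in h.
rewrite -[cstate c]inord_val -[nat_of_ord (cstate c)]add0n in h.
have h2 := exec_disp (ltn_ord (cstate c)) h.
set s1 := simst _ _ _ (nseq (cstate c).+1 true).
have e1 : s1 4 = true :: nseq (cstate c) true by [].
have eu : upd s1 4 (nseq (cstate c) true) = simst s (cleft c) (chead c :: cright c) (nseq (cstate c) true).
  by rewrite /s1 /simst; upd_ext.
have h3 := @ExLoop 4 Skip (disp M (nQ M).+1 0) s1 true _ _ _ _ _ e1.
have h4 := IH _ hr.
have eq' : cstate (move q (cleft c) a (cright c) d) = q.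
  by case: (d) => //=; [case: (cleft c)|case: (cright c)].
rewrite eq' in h4; rewrite eu in h3; have {}h3 := h3 _ _ _ _ h2 h4.
by apply: ExWeak h3 _; have := ltn_ord (cstate c); lia.
Qed.

Lemma cwf_pushS W r a : 0 < r <= W -> cwf W (pushS r a).
Proof. by case: a => /= ->. Qed.

Lemma cwf_popS W r kE k : r <= W -> cwf W kE -> (forall a, cwf W (k a)) -> cwf W (popS r kE k).
Proof. by move=> h hE hk; rewrite /= h hE !hk. Qed.

Lemma cwf_Case W j cE c0 c1 : j <= W -> cwf W cE -> cwf W c0 -> cwf W c1 ->
  cwf W (Case j cE c0 c1).
Proof. by move=> /= -> -> -> ->. Qed.

Lemma cwf_Seq W c1 c2 : cwf W c1 -> cwf W c2 -> cwf W (Seq c1 c2).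
Proof. by move=> /= -> ->. Qed.

Lemma cwf_disp M fuel i : cwf 4 (disp M fuel i).
Proof.
have hp n : cwf 4 (pushn 4 n) by elim: n => //= n ->.
elim: fuel i => [//|fuel IH] i.
apply: cwf_Case => //.
apply: cwf_popS => // a.
case: trans => [[[q b] d]|]; last exact: cwf_pushS.
apply: cwf_Seq; last exact: hp.
case: d; last exact: cwf_pushS.
  by apply: cwf_Seq; [apply: cwf_pushS|apply: cwf_popS => // b'; apply: cwf_pushS].
by apply: cwf_Seq; [apply: cwf_pushS|apply: cwf_popS => // b'; apply: cwf_pushS].
Qed.

Lemma cwf_simc M : cwf 4 (simc M).
Proof. by rewrite /simc [cwf _ _]/= -[_ && _]/(cwf 4 (disp M (nQ M).+1 0)) cwf_disp. Qed.

(** * The reduction as a program *)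

(** The length of the leading block of ones. This count, like [k_of] and the integer square root
    [root2], is written as a sum of Booleans in order to be programmable through [CN_sum]. *)
Definition n_of (w : seq bool) : nat :=
  \sum_(0 <= i < size w) all (fun j => nth false w j) (iota 0 i.+1).
Definition k_of (w : seq bool) : nat :=
  \sum_(0 <= i < size w) all (fun j => nth false w ((n_of w).+1 + j)) (iota 0 i.+1).
Definition adj_of (w : seq bool) (u v : nat) : bool :=
  nth false w ((n_of w + k_of w).+2 + (u * n_of w + v)).

Definition root2 (k : nat) : nat := \sum_(0 <= i < k) (i.+1 * i.+1 <= k).

(* Node number x has type x / n^t, and its tuple is given by the t last base-n digits of x.  Types
   i < t are the A-nodes of coordinate i, type t the T-nodes; the two sides of the core are the
   nodes of types t + 1 and t + 2 with small x mod n^t, the other nodes of these types are isolated. *)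
Definition big_n (t n : nat) : nat := (t + 3) * n ^ t.
Definition big_k (c t k : nat) : nat := c * t * root2 k * k ^ t.-1.
Definition digit (n j x : nat) : nat := (x %/ n ^ j) %% n.
Definition node_type (t n x : nat) : nat := x %/ n ^ t.
Definition node_low (t n x : nat) : nat := x %% n ^ t.

(** [x] is the T-node and [y] the A-node. The clique test is part of the incidence: tuples that are
    no cliques remain as isolated nodes, so the number of nodes depends on [t] and [n] only. *)
Definition incA (t n k : nat) (A : nat -> nat -> bool) (x y : nat) : bool :=
  has (fun i => [&& node_type t n y == i, digit n i y < root2 k, node_type t n x == t,
        all (fun j => (j == i) || (digit n j x == digit n j y)) (iota 0 t)
      & all (fun j => all (fun j' => (j == j') || A (digit n j x) (digit n j' x)) (iota 0 t))
          (iota 0 t)]) (iota 0 t).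

Definition incC (c t n k : nat) (x y : nat) : bool :=
  [&& node_type t n x == t.+1, node_type t n y == t.+2, node_low t n x < c * t * root2 k
    & node_low t n y < t * root2 k * k ^ t.-1].

Definition inc c t n k A x y : bool := incA t n k A x y || incC c t n k x y.

Definition edge c t n k A x y : bool := inc c t n k A x y || inc c t n k A y x.

Definition edgew c t w x y := edge c t (n_of w) (k_of w) (adj_of w) x y.

(** Where it fails, the answer is [false]: completeness is impossible for [k > n], and also for
    [k < k0] once delta is [1 / k0]. *)
Definition guard k0 (w : seq bool) : bool := (k0 <= k_of w) && (k_of w <= n_of w).

Definition wout c t (w : seq bool) : seq bool :=
  nseq (big_n t (n_of w)) true ++ [:: false] ++ nseq (big_k c t (k_of w)) true ++ [:: false] ++
  flatten [seq flatten [seq [:: edgew c t w i j] | j <- iota 0 (big_n t (n_of w))]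
          | i <- iota 0 (big_n t (n_of w))].

Definition verdict c t (w : seq bool) (S : nat -> bool) : bool :=
  (* ordered pairs count every edge twice *)
  2 * c.+1 * t * root2 (k_of w) * \sum_(0 <= i < big_n t (n_of w)) S i <=
  c * \sum_(0 <= i < big_n t (n_of w)) \sum_(0 <= j < big_n t (n_of w))
        [&& S i, S j & edgew c t w i j].

(* The bit stack z holds tape cells as pairs (nonblank, value); the output ends at the first blank. *)
Definition tapeout (z : seq bool) (i : nat) : bool :=
  nth false z (2 * i + 1) && all (fun j => nth false z (2 * j)) (iota 0 i.+1).

Lemma CN_n_of X (ctx : X -> seq (seq bool)) W : polycomp ctx W -> CN ctx (fun x => n_of (W x)).
Proof.
move=> h; apply: (CN_sum (g := fun x i => all (fun j => nth false (W x) j) (iota 0 i.+1) : nat)).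
  exact: CN_size.
apply: (CB_forall (P := fun p j => nth false (W p.1) j) (f := fun p => p.2.+1)).
  exact: CN_S (CN_idx _).
exact: CB_nth (comp_weak (comp_weak h)) (CN_idx _).
Qed.

Lemma CN_k_of X (ctx : X -> seq (seq bool)) W : polycomp ctx W -> CN ctx (fun x => k_of (W x)).
Proof.
move=> h; apply: (CN_sum (g := fun x i => all (fun j => nth false (W x) ((n_of (W x)).+1 + j)) (iota 0 i.+1) : nat)).
  exact: CN_size.
apply: (CB_forall (P := fun p j => nth false (W p.1) ((n_of (W p.1)).+1 + j)) (f := fun p => p.2.+1)).
  exact: CN_S (CN_idx _).
have h2 := comp_weak (comp_weak h).
exact: CB_nth h2 (CN_add (CN_S (CN_n_of h2)) (CN_idx _)).
Qed.

Lemma CB_adj_of X (ctx : X -> seq (seq bool)) W f g : polycomp ctx W -> CN ctx f -> CN ctx g ->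
  CB ctx (fun x => adj_of (W x) (f x) (g x)).
Proof.
move=> h hf hg; apply: (CB_nth (f := fun x => (n_of (W x) + k_of (W x)).+2 + (f x * n_of (W x) + g x)) h).
have hN := CN_n_of h; apply: CN_add (CN_add (CN_mul hf hN) hg).
exact: CN_S (CN_S (CN_add hN (CN_k_of h))).
Qed.

Lemma CN_root2 X (ctx : X -> seq (seq bool)) f : CN ctx f -> CN ctx (fun x => root2 (f x)).
Proof.
move=> h; apply: (CN_sum (g := fun x i => (i.+1 * i.+1 <= f x) : nat) h).
have hi := CN_S (CN_idx ctx); exact: CB_leq (CN_mul hi hi) (CN_weak h).
Qed.

Lemma CN_big_n X (ctx : X -> seq (seq bool)) t f : CN ctx f -> CN ctx (fun x => big_n t (f x)).
Proof. by move=> h; apply: CN_mul (CN_const _ _) (CN_expn _ h). Qed.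

Lemma CN_big_k X (ctx : X -> seq (seq bool)) c t f : CN ctx f -> CN ctx (fun x => big_k c t (f x)).
Proof.
move=> h; apply: CN_mul (CN_expn _ h); apply: CN_mul (CN_root2 h); exact: CN_const.
Qed.

Lemma CN_digit X (ctx : X -> seq (seq bool)) n j x :
  CN ctx n -> CN ctx x -> CN ctx (fun a => digit (n a) j (x a)).
Proof. by move=> hn hx; apply: CN_mod (hn); apply: CN_div hx (CN_expn _ hn). Qed.

Lemma CN_node_type X (ctx : X -> seq (seq bool)) t n x :
  CN ctx n -> CN ctx x -> CN ctx (fun a => node_type t (n a) (x a)).
Proof. by move=> hn hx; apply: CN_div hx (CN_expn _ hn). Qed.

Lemma CN_node_low X (ctx : X -> seq (seq bool)) t n x :
  CN ctx n -> CN ctx x -> CN ctx (fun a => node_low t (n a) (x a)).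
Proof. by move=> hn hx; apply: CN_mod hx (CN_expn _ hn). Qed.

Lemma CB_inc X (ctx : X -> seq (seq bool)) c t W x y :
  polycomp ctx W -> CN ctx x -> CN ctx y ->
  CB ctx (fun a => inc c t (n_of (W a)) (k_of (W a)) (adj_of (W a)) (x a) (y a)).
Proof.
move=> h hx hy; have hn := CN_n_of h; have hr := CN_root2 (CN_k_of h); apply: CB_or.
  apply: (CB_has (P := fun a i => [&& _, _, _, _ & _])) => i.
  apply: CB_and; first exact: CB_eq (CN_node_type _ hn hy) (CN_const _ _).
  apply: CB_and; first exact: CB_ltn (CN_digit _ hn hy) hr.
  apply: CB_and; first exact: CB_eq (CN_node_type _ hn hx) (CN_const _ _).
  apply: CB_and.
    apply: (CB_all (P := fun a j => (j == i) || (_ == _))) => j.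
    apply: CB_or; first by case: (j == i); apply: CN_const.
    exact: CB_eq (CN_digit _ hn hx) (CN_digit _ hn hy).
  apply: (CB_all (P := fun a j => all (fun j' => (j == j') || _) _)) => j.
  apply: (CB_all (P := fun a j' => (j == j') || _)) => j'.
  apply: CB_or; first by case: (j == j'); apply: CN_const.
  exact: CB_adj_of h (CN_digit _ hn hx) (CN_digit _ hn hx).
apply: CB_and; first exact: CB_eq (CN_node_type _ hn hx) (CN_const _ _).
apply: CB_and; first exact: CB_eq (CN_node_type _ hn hy) (CN_const _ _).
apply: CB_and.
  apply: CB_ltn (CN_node_low _ hn hx) _; apply: CN_mul hr; exact: CN_const.
apply: CB_ltn (CN_node_low _ hn hy) _; apply: CN_mul (CN_expn _ (CN_k_of h)).
by apply: CN_mul hr; exact: CN_const.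
Qed.

Lemma CB_edgew X (ctx : X -> seq (seq bool)) c t W x y :
  polycomp ctx W -> CN ctx x -> CN ctx y ->
  CB ctx (fun a => edgew c t (W a) (x a) (y a)).
Proof. by move=> h hx hy; apply: CB_or; apply: CB_inc. Qed.

Lemma CB_guard X (ctx : X -> seq (seq bool)) k0 W :
  polycomp ctx W -> CB ctx (fun a => guard k0 (W a)).
Proof.
move=> h; apply: CB_and (CB_leq (CN_k_of h) (CN_n_of h)).
exact: CB_leq (CN_const _ _) (CN_k_of h).
Qed.

Lemma comp_bit X (ctx : X -> seq (seq bool)) b : CB ctx b -> polycomp ctx (fun x => [:: b x]).
Proof.
move=> h; apply: comp_ext (comp_if h (comp_const _ [:: true]) (comp_const _ [:: false])) => x.
by case: (b x).
Qed.

Lemma comp_wout X (ctx : X -> seq (seq bool)) c t W :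
  polycomp ctx W -> polycomp ctx (fun a => wout c t (W a)).
Proof.
move=> h; have hn := CN_big_n t (CN_n_of h).
apply: comp_cat; first exact: hn.
apply: comp_cat; first exact: comp_const.
apply: comp_cat; first exact: (CN_big_k c t (CN_k_of h)).
apply: comp_cat; first exact: comp_const.
apply: (comp_for (g := fun x i => flatten [seq [:: edgew c t (W x) i j] | j <- iota 0 (big_n t (n_of (W x)))]) hn).
apply: (comp_for (g := fun p j => [:: edgew c t (W p.1) p.2 j]) (f := fun p => big_n t (n_of (W p.1)))).
  exact: CN_weak hn.
apply: comp_bit; apply: (CB_edgew c t (W := fun p => W p.1.1) (x := fun p => p.1.2) (y := fun p => p.2)).
- exact: (comp_weak (comp_weak h)).
- exact: (CN_weak (CN_idx ctx)).
- exact: CN_idx.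
Qed.

Definition pairs (w : seq bool) : seq bool :=
  flatten [seq [:: true; nth false w i] | i <- iota 0 (size w)].

Lemma comp_pairs X (ctx : X -> seq (seq bool)) W :
  polycomp ctx W -> polycomp ctx (fun a => pairs (W a)).
Proof.
move=> h; apply: (comp_for (g := fun x i => [:: true; nth false (W x) i]) (CN_size h)).
apply: (comp_cat (f := fun _ => [:: true]) (g := fun p => [:: nth false (W p.1) p.2])).
  exact: comp_const.
exact: comp_bit (CB_nth (comp_weak h) (CN_idx ctx)).
Qed.

Lemma pairsE w : pairs w = bitsl (map sym_of_bool w).
Proof.
rewrite /pairs /bitsl -map_comp; congr flatten.
rewrite -{3}(mkseq_nth false w) /mkseq -map_comp; apply: eq_map => i /=.
by case: (nth false w i).
Qed.

Lemma CB_tapeout X (ctx : X -> seq (seq bool)) z f :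
  polycomp ctx z -> CN ctx f -> CB ctx (fun a => tapeout (z a) (f a)).
Proof.
move=> hz hf; apply: CB_and.
  by apply: CB_nth hz (CN_add (CN_mul (CN_const _ _) hf) (CN_const _ _)).
apply: (CB_forall (P := fun x j => nth false (z x) (2 * j)) (CN_S hf)).
exact: CB_nth (comp_weak hz) (CN_mul (CN_const _ _) (CN_idx _)).
Qed.

Lemma CB_verdict X (ctx : X -> seq (seq bool)) c t W z :
  polycomp ctx W -> polycomp ctx z ->
  CB ctx (fun a => verdict c t (W a) (tapeout (z a))).
Proof.
move=> h hz; have hn := CN_big_n t (CN_n_of h); apply: CB_leq.
  apply: CN_mul; first by apply: CN_mul (CN_root2 (CN_k_of h)); exact: CN_const.
  apply: (CN_sum (g := fun x i => tapeout (z x) i : nat) hn).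
  exact: CB_tapeout (comp_weak hz) (CN_idx _).
apply: CN_mul; first exact: CN_const.
apply: (CN_sum (g := fun x i => \sum_(0 <= j < big_n t (n_of (W x)))
  [&& tapeout (z x) i, tapeout (z x) j & edgew c t (W x) i j]) hn).
apply: (CN_sum (g := fun p j => [&& tapeout (z p.1) p.2, tapeout (z p.1) j & edgew c t (W p.1) p.2 j] : nat)
  (f := fun p => big_n t (n_of (W p.1)))); first exact: CN_weak hn.
have hi := CN_weak (CN_idx ctx); have hj := CN_idx (ext ctx).
have h2 := comp_weak (comp_weak h); have hz2 := comp_weak (comp_weak hz).
apply: CB_and; first exact: CB_tapeout hz2 hi.
by apply: CB_and; [exact: CB_tapeout hz2 hj|exact: CB_edgew h2 hi hj].
Qed.

Lemma tapeoutE l i : tapeout (bitsl l) i = nth false (read_bits l) i.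
Proof.
elim: l i => [|a l IH] i; first by rewrite /tapeout !nth_nil.
rewrite /tapeout /bitsl /= -/(bitsl l).
case: i => [|i]; first by case: a.
have -> : 2 * i.+1 + 1 = (2 * i + 1).+2 by lia.
have -> : 2 * 0 = 0 by [].
have -> : all (fun j => nth false (bits a ++ bitsl l) (2 * j)) (iota 1 i.+1) =
          all (fun j => nth false (bitsl l) (2 * j)) (iota 0 i.+1).
  rewrite -[1]addn0 iotaDl all_map; apply: eq_all => j /=.
  have -> : 2 * (1 + j) = (2 * j).+2 by lia.
  by case: a.
have h := IH i; rewrite /tapeout in h.
by case: a => /=; rewrite ?andbF // -h.
Qed.

Lemma poly_bounded_subst X Y (m : X -> nat) (m' : Y -> nat) (T : X -> nat) (u : Y -> X) :
  poly_bounded m T -> (forall y, m (u y) <= m' y) -> poly_bounded m' (fun y => T (u y)).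
Proof.
move=> [a h] hu; exists a => y; apply: leq_trans (h (u y)) _.
by rewrite leq_mul // leq_exp // ltnS.
Qed.

Lemma wout_neq0 c t w : wout c t w != [::].
Proof. by rewrite -size_eq0 !size_cat /=; lia. Qed.

Lemma init_cfg M w : w != [::] ->
  [/\ cstate (init M w) = ord0, cleft (init M w) = [::]
    & chead (init M w) :: cright (init M w) = map sym_of_bool w].
Proof. by case: w. Qed.

(** A Boolean is computed in unary, as an empty or a one-element stack, whereas the output must be
    one bit in either case. *)
Definition finishP := Case 5 (Push 5 false) Skip (Push 5 true).

Lemma exec_finish s (b : bool) : s 5 = nseq b true ->
  exists2 s', exec finishP s s' 3 & s' 5 = [:: b].
Proof.
case: b => /= e.
  exists (upd (upd s 5 [::]) 5 [:: true]); last by rewrite updE.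
  by have := ExPush (upd s 5 [::]) 5 true; rewrite updE; apply: (@ExCase 5 (Push 5 false) Skip _ _ true _ _ _ e).
exists (upd s 5 [:: false]); last by rewrite updE.
by have := ExPush s 5 false; rewrite e; apply: ExCaseE.
Qed.

Lemma exec_post c t : exists cv W a, cwf W cv /\
  forall w z s, s 1 = w -> s 2 = z -> (forall i, 5 <= i -> s i = [::]) ->
  exec cv s (upd s 5 (nseq (verdict c t w (tapeout z)) true)) (a * (size w + size z).+1 ^ a).
Proof.
pose ctx (x : seq bool * seq bool) := [:: x.1; x.2].
have [_ h] := CB_verdict c t (comp_var ctx 0) (comp_var ctx 1).
have [cv [W [hW [tm [a ptm] ht]]]] := h [:: 1; 2] 5 isT isT.
exists cv, W, a; split=> // w z s e1 e2 hs.
have h3 := ht (w, z) s _ hs; rewrite /= e1 e2 in h3.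
apply: ExWeak (h3 erefl) _; apply: leq_trans (ptm _) _.
by rewrite /tot /= addn0.
Qed.

Lemma exec_pre c t k0 : exists cg cw W, [/\ cwf W cg, cwf W cw &
  exists2 tp, poly_bounded (fun n => n) tp &
  forall w, let s := upd (fun=> [::]) 1 w in
  [/\ exec cg s (upd s 2 (nseq (guard k0 w) true)) (tp (size w)),
      exec cw s (upd s 2 (pairs (wout c t w))) (tp (size w))
    & size (pairs (wout c t w)) <= tp (size w)]].
Proof.
pose ctx (w : seq bool) := [:: w].
have [_ hg] := CB_guard k0 (comp_var ctx 0).
have [cg [Wg [wg [tg [a pg] htg]]]] := hg [:: 1] 2 isT isT.
have [[a3 p3] hw] := comp_pairs (comp_wout c t (comp_var ctx 0)).
have [cw [Ww [ww [tw [a2 pw] htw]]]] := hw [:: 1] 2 isT isT.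
exists cg, cw, (maxn Wg Ww); split; [exact: cwf_weak (leq_maxl _ _) wg|exact: cwf_weak (leq_maxr _ _) ww|].
exists (fun n => (a * n.+1 ^ a + a2 * n.+1 ^ a2) + a3 * n.+1 ^ a3).
  by apply: poly_bounded_add; [apply: poly_bounded_add|]; eexists.
move=> w s.
have tw' : tot (ctx w) = size w by rewrite /tot /= addn0.
have hs i : 1 < i -> s i = [::] by move=> hi; rewrite /s updN //; lia.
have := pg w; have := pw w; have := p3 w; rewrite tw' => h3 h2 h1.
split.
- by apply: ExWeak (htg w s _ hs) _; [rewrite /s /= updE|lia].
- by apply: ExWeak (htw w s _ hs) _; [rewrite /s /= updE|lia].
- by apply: leq_trans h3 _; lia.
Qed.

Lemma machine c t k0 M : exists M' a, forall w,
  (guard k0 w = false -> runs_within M' (a * (size w).+1 ^ a) w [:: false]) /\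
  (guard k0 w -> forall T out, runs_within M T (wout c t w) out ->
     runs_within M' (a * (size w + T).+1 ^ a) w [:: verdict c t w (nth false out)]).
Proof.
have [cg [cw [W1 [wg ww [tp ptp hp]]]]] := exec_pre c t k0.
have [cv [W2 [av [wv hv]]]] := exec_post c t.
pose simP := Seq (Push 4 true) (simc M).
pose main := Seq (moveP 0 1) (Seq cg (Case 2 (Push 5 false) Skip
   (Seq cw (Seq simP (Seq cv finishP))))).
pose W := maxn 5 (maxn W1 W2).
have wmain : cwf W main.
  have w5 : 5 <= W by rewrite leq_maxl.
  have w51 : W1 <= W by rewrite /W; lia.
  have w52 : W2 <= W by rewrite /W; lia.
  have ws := cwf_weak (leq_trans (leqnSn 4) w5) (cwf_simc M).
  apply: cwf_Seq; first by rewrite /=; lia.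
  apply: cwf_Seq; first exact: cwf_weak w51 wg.
  apply: cwf_Case => //; first by lia.
  apply: cwf_Seq; first exact: cwf_weak w51 ww.
  apply: cwf_Seq; first by apply: cwf_Seq => //=; lia.
  apply: cwf_Seq; first exact: cwf_weak w52 wv.
  by rewrite /=; lia.
pose K := 3 * nQ M + 20.
(* [zs] bounds the height of the simulated tape at the end of the simulation, [total] the time of
   [main]. *)
pose zs n T := n + tp n + 1 + T.+1 * K.
pose total n T := (n * 3 + 1) + (tp n + (tp n + ((1 + T.+1 * K) + (av * (n + zs n T).+1 ^ av + 3))).+2).
have [a1 hprog] : exists a, forall n T, 100 * W.+1 * (n + total n T).+2 ^ 2 <= a * (n + T).+1 ^ a.
  pose m (p : nat * nat) := p.1 + p.2.
  have p1 : poly_bounded m (fun p => p.1) by apply: poly_bounded_le (poly_bounded_id m) _ => p; apply: leq_addr.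
  have p2 : poly_bounded m (fun p => p.2.+1 * K).
    apply: poly_bounded_mul (poly_bounded_const _ _).
    by apply: poly_bounded_le (poly_bounded_add (poly_bounded_id m) (poly_bounded_const m 1)) _ => p; rewrite /m; lia.
  have p3 : poly_bounded m (fun p => tp p.1) by apply: poly_bounded_subst ptp _ => p; apply: leq_addr.
  have pz : poly_bounded m (fun p => zs p.1 p.2).
    by apply: poly_bounded_add p2; apply: poly_bounded_add (poly_bounded_const _ _); apply: poly_bounded_add.
  have pt : poly_bounded m (fun p => total p.1 p.2).
    apply: poly_bounded_add; first by apply: poly_bounded_add (poly_bounded_const _ _); apply: poly_bounded_mul p1 (poly_bounded_const _ _).
    apply: (poly_bounded_add p3).
    apply: poly_bounded_le (poly_bounded_add (poly_bounded_add p3 (poly_bounded_add (poly_bounded_add (poly_bounded_const m 1) p2)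
      (poly_bounded_add (poly_bounded_mul (poly_bounded_const m av) (poly_bounded_exp av (poly_bounded_add (poly_bounded_add p1 pz) (poly_bounded_const m 1)))) (poly_bounded_const m 3)))) (poly_bounded_const m 2)) _ => p.
    by rewrite !addn1 addn2.
  have : poly_bounded m (fun p => 100 * W.+1 * (p.1 + total p.1 p.2 + 2) ^ 2).
    by apply: poly_bounded_mul (poly_bounded_const _ _) _; apply: poly_bounded_exp; apply: poly_bounded_add (poly_bounded_const _ _); apply: poly_bounded_add.
  by move=> [a ha]; exists a => n T; have := ha (n, T); rewrite addn2.
exists (tm_of (prog W main 5)), a1 => w.
pose s1 := upd (fun=> [::]) 1 w.
have [hg1 hc1 hsz] := hp w; rewrite -/s1 in hg1 hc1.
have e1 : exec (moveP 0 1) (st0 w) s1 (size w * 3 + 1).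
  have := @exec_move 0 1 (st0 w); rewrite /st0 /= size_rev catrevE revK cats0 => h.
  by apply: exec_eq (h _) _ => //; rewrite /s1; upd_ext.
have s12 : upd s1 2 [::] = s1 by rewrite /s1; upd_ext.
split=> [hgf|hgt T out [cf [hrun hout]]].
  have e2 := ExPush (upd s1 2 [::]) 5 false.
  have e3 := @ExCaseE 2 (Push 5 false) Skip (Seq cw (Seq simP (Seq cv finishP))) (upd s1 2 [::]) _ _ (updE _ _ _) e2.
  rewrite hgf in hg1.
  have e4 := ExSeq e1 (ExSeq hg1 e3).
  have := @prog_runs W main 5 w _ _ false _ wmain e4.
  rewrite updE s12 /s1 /= => h; have {h} [||cc [hr ho]] := h _; [by rewrite /W; lia|by []|].
  exists cc; split=> //; apply: run_mono hr; apply: leq_trans _ (leq_trans (hprog (size w) 0) _).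
    by rewrite leq_mul // leq_exp // /total; lia.
  by rewrite addn0.
set w' := wout c t w in hc1 hsz hrun.
have [i1 i2 i3] := init_cfg M (wout_neq0 c t w).
pose s2 := upd s1 2 (pairs w').
have e3 : exec (Push 4 true) s2 (simst s1 [::] (map sym_of_bool w') [:: true]) 1.
  apply: exec_eq (ExPush s2 4 true) _.
  by rewrite /s2 /simst pairsE /s1; upd_ext.
have e4 := exec_simc s1 hrun; rewrite i1 i2 i3 /= in e4.
set s3 := simst s1 (cleft cf) (chead cf :: cright cf) [::] in e4.
have e34 := ExSeq e3 e4.
have hz : size (s3 2) <= zs (size w) T.
  have hs2 k : size (s2 k) <= size w + tp (size w).
    rewrite /s2 /s1 /upd; case: eqP => _; first by apply: leq_trans hsz _; apply: leq_addl.
    by case: eqP => _ //=; apply: leq_addr.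
  by have := exec_size e34 hs2 2; rewrite /zs -/K; lia.
have e5 : exec cv s3 (upd s3 5 (nseq (verdict c t w (tapeout (s3 2))) true)) (av * (size w + zs (size w) T).+1 ^ av).
  apply: ExWeak (hv w (s3 2) s3 _ erefl _) _.
  - by rewrite /s3 /simst /s1.
  - by move=> i hi; rewrite /s3 /simst /s1 !updN //; lia.
  - by rewrite leq_mul // leq_exp // ltnS leq_add2l.
have ev : verdict c t w (tapeout (s3 2)) = verdict c t w (nth false out).
  rewrite -hout /output /verdict; have -> : tapeout (s3 2) = nth false (read_bits (chead cf :: cright cf)); last by [].
  by apply: functional_extensionality => i; rewrite -tapeoutE.
rewrite ev in e5.
have [s6 e6 hs6] := exec_finish (b := verdict c t w (nth false out)) (updE s3 5 _).
have e7 := ExSeq hc1 (ExSeq e34 (ExSeq e5 e6)).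
rewrite hgt in hg1.
have eu : upd (upd s1 2 (nseq true true)) 2 [::] = s1 by rewrite /s1; upd_ext.
have e8 s' T' := @ExCase 2 (Push 5 false) Skip (Seq cw (Seq simP (Seq cv finishP)))
  (upd s1 2 (nseq true true)) true [::] s' T' (updE _ _ _).
rewrite eu in e8.
have := @prog_runs W main 5 w _ _ _ _ wmain (ExSeq e1 (ExSeq hg1 (e8 _ _ e7))) hs6.
have h5 : 5 <= W by rewrite /W; lia.
move=> /(_ h5) [cc [hr ho]]; exists cc; split=> //; apply: run_mono hr.
apply: leq_trans _ (hprog (size w) T).
by rewrite leq_mul // leq_exp // /total /K; lia.
Qed.

(** * Dense incidences force dense small sets *)

Lemma ex_subset (V : finType) (Q : {set V}) h : h <= #|Q| ->
  exists2 S : {set V}, S \subset Q & #|S| = h.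
Proof.
move=> hq; exists [set x in take h (enum Q)].
  by apply/subsetP => x; rewrite inE => /mem_take; rewrite mem_enum.
rewrite cardsE; have /card_uniqP -> : uniq (take h (enum Q)) by rewrite take_uniq ?enum_uniq.
by rewrite size_takel // -cardE.
Qed.

(** Peel off blocks of exactly [h] elements; the [+ 1] pays for the incomplete last block. *)
Lemma sum_blocks (V : finType) (f : V -> nat) (h B : nat) : 0 < h ->
  (forall S : {set V}, #|S| <= h -> \sum_(x in S) f x <= B) ->
  forall Q : {set V}, \sum_(x in Q) f x <= (#|Q| %/ h + 1) * B.
Proof.
move=> h0 hB Q; move: {2}#|Q| (leqnn #|Q|) => n; elim: n Q => [|n IH] Q hn.
  by apply: leq_trans (hB Q _) _; [lia|rewrite mulnDl mul1n leq_addl].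
case: (leqP #|Q| h) => hQ.
  by apply: leq_trans (hB Q hQ) _; rewrite mulnDl mul1n leq_addl.
have [S SQ cS] := ex_subset (ltnW hQ).
have cQ : #|Q| = h + #|Q :\: S| by rewrite -cS -(cardsID S Q) (setIidPr SQ).
rewrite (big_setID S) /= (setIidPr SQ) cQ divnDl // divnn h0.
rewrite (addnC 1) -addnA mulnDl.
have h2 := IH (Q :\: S); have {h2} : #|Q :\: S| <= n by lia.
move=> /IH h2; have h1 := hB S; rewrite cS leqnn in h1; have {}h1 := h1 isT.
by rewrite mulnDl in h2; rewrite mulnDl; lia.
Qed.

Definition nbr (V : finType) (E : rel V) (Q : {set V}) (p : V) : {set V} := [set q in Q | E p q].

Definition pairs_of (V : finType) (E : rel V) (P Q : {set V}) : nat := \sum_(p in P) #|nbr E Q p|.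

Lemma pairs_ofE (V : finType) (E : rel V) P Q :
  pairs_of E P Q = \sum_(p in P) \sum_(q in Q) E p q.
Proof.
apply: eq_bigr => p _; rewrite -sum1_card big_mkcond /= [RHS]big_mkcond.
by apply: eq_bigr => q _; rewrite /nbr inE; case: (q \in Q); case: (E p q).
Qed.

Lemma pairs_ofC (V : finType) (E : rel V) P Q : symmetric E -> pairs_of E P Q = pairs_of E Q P.
Proof.
move=> sE; rewrite !pairs_ofE exchange_big /=.
by apply: eq_bigr => p _; apply: eq_bigr => q _; rewrite sE.
Qed.

Lemma pairs_of_sub (V : finType) (E : rel V) (P P' Q Q' : {set V}) :
  P \subset P' -> Q \subset Q' -> pairs_of E P Q <= pairs_of E P' Q'.
Proof.
move=> hP hQ; rewrite /pairs_of [X in _ <= X](big_setID P) /= (setIidPr hP).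
apply: leq_trans (leq_addr _ _); apply: leq_sum => p _; apply: subset_leq_card.
by apply/subsetP => q; rewrite !inE => /andP [/(subsetP hQ) -> ->].
Qed.

(** Ordered pairs count every edge of a simple graph twice, hence the 2: sets of at most [k]
    vertices have density at most [s]. *)
Definition sparse (V : finType) (E : rel V) (s k : nat) : Prop :=
  forall S : {set V}, #|S| <= k -> pairs_of E S S <= 2 * s * #|S|.

Lemma sparse_small (V : finType) (E : rel V) s k h (P Q : {set V}) :
  sparse E s k -> 2 * h <= k -> #|P| <= h -> #|Q| <= h ->
  pairs_of E P Q <= 2 * s * (#|P| + #|Q|).
Proof.
move=> hs hk hP hQ.
have hu := leq_card_setU P Q.
apply: leq_trans (pairs_of_sub E (subsetUl P Q) (subsetUr P Q)) _.
apply: leq_trans (hs _ _) _; first by move: hu => [hu _]; lia.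
by rewrite leq_mul2l; case: hu => -> _; rewrite orbT.
Qed.

Lemma sparse_pairs (V : finType) (E : rel V) s k h (P Q : {set V}) :
  sparse E s k -> symmetric E -> 0 < h -> 2 * h <= k ->
  pairs_of E P Q <= (#|P| %/ h + 1) * ((#|Q| %/ h + 1) * (4 * s * h)).
Proof.
move=> hs sE h0 hk; apply: (@sum_blocks _ (fun p => #|nbr E Q p|) h) => // S hS.
rewrite -/(pairs_of E S Q) pairs_ofC //.
apply: (@sum_blocks _ (fun p => #|nbr E S p|) h) => // S' hS'.
rewrite -/(pairs_of E S' S).
by apply: leq_trans (sparse_small hs hk hS' hS) _; nia.
Qed.

(* Cut P and Q into blocks of h <= k / 2 vertices: sparsity bounds the edges between any two blocks
   by 4 s h, hence those between P and Q by about 16 s |P| |Q| / h. *)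
Lemma min_degree_growth (V : finType) (E : rel V) s k h r Dl (P Q : {set V}) :
  sparse E s k -> symmetric E -> 0 < h -> 2 * h <= k -> 16 * s * r <= h ->
  0 < s -> 16 * s <= Dl -> P != set0 ->
  (forall p, p \in P -> Dl <= #|nbr E Q p|) ->
  (forall q, q \in Q -> Dl <= #|nbr E P q|) ->
  Dl * r <= #|P|.
Proof.
move=> hs sE h0 hk hr s0 hD P0 hP hQ.
set a := #|P|; set b := #|Q|; set e := pairs_of E P Q.
have a0 : 0 < a by rewrite card_gt0.
have e1 : a * Dl <= e by rewrite -sum_nat_const; apply: leq_sum.
have e2 : b * Dl <= e by rewrite /e pairs_ofC // -sum_nat_const; apply: leq_sum.
have e3 : e <= (a %/ h + 1) * ((b %/ h + 1) * (4 * s * h)) := sparse_pairs P Q hs sE h0 hk.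
have div2 x : h <= x -> (x %/ h + 1) * h <= 2 * x.
  by move=> hx; rewrite mulnDl; have := leq_trunc_div x h; lia.
(* Unless both sides have at least [h] vertices, the number of edges is at most [8 * s] times the
   larger side, against the minimum degree [16 * s]. *)
case: (ltnP a h) => ha; case: (ltnP b h) => hb.
- have e4 : e <= 2 * s * (a + b) := sparse_small hs hk (ltnW ha) (ltnW hb).
  by case: (leqP a b) => hab; nia.
- have e4 : e <= (b %/ h + 1) * h * (4 * s) by rewrite divn_small // add0n mul1n in e3; nia.
  by have := div2 b hb; nia.
- have e4 : e <= (a %/ h + 1) * h * (4 * s) by rewrite [b %/ h]divn_small // add0n mul1n in e3; nia.
  by have := div2 a ha; nia.
have da := div2 a ha; have db := div2 b hb.
have e5 : e * h <= 2 * a * (2 * b) * (4 * s).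
  apply: leq_trans (_ : ((a %/ h + 1) * h) * ((b %/ h + 1) * h) * (4 * s) <= _); last by rewrite leq_mul // leq_mul.
  have -> : ((a %/ h + 1) * h) * ((b %/ h + 1) * h) * (4 * s) = (a %/ h + 1) * ((b %/ h + 1) * (4 * s * h)) * h by nia.
  by rewrite leq_mul.
have b0 : 0 < b by lia.
(* Cancelling [b] leaves [Dl * h <= 16 * s * a], and [h] is at least [16 * s * r]. *)
have e6 : b * (Dl * h) <= b * (16 * s * a).
  have : b * Dl * h <= e * h by rewrite leq_mul.
  by nia.
rewrite leq_pmul2l // in e6.
have e7 : Dl * (16 * s * r) <= 16 * s * a by apply: leq_trans e6; rewrite leq_mul.
by have := leq_pmul2l (m := 16 * s) (n1 := Dl * r) (n2 := a); rewrite mulnCA => <- //; lia.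
Qed.

(** * Growth of families of clique tuples *)

Definition agree (t : nat) (V : finType) (J : {set 'I_t}) (u v : {ffun 'I_t -> V}) : bool :=
  [forall j, (j \notin J) ==> (u j == v j)].

Definition ext_of (t : nat) (V : finType) (C : {set {ffun 'I_t -> V}}) (J : {set 'I_t})
  (v : {ffun 'I_t -> V}) : {set {ffun 'I_t -> V}} := [set u in C | agree J u v].

Definition ends (t : nat) (V : finType) (C : {set {ffun 'I_t -> V}}) (J : {set 'I_t})
  (v : {ffun 'I_t -> V}) (i : 'I_t) : {set V} := [set (u : {ffun 'I_t -> V}) i | u in ext_of C J v].

Definition clique_tuple (t : nat) (V : finType) (E : rel V) (v : {ffun 'I_t -> V}) : bool :=
  [forall i, forall j, (i != j) ==> E (v i) (v j)].

Lemma agreeP t (V : finType) (J : {set 'I_t}) (u v : {ffun 'I_t -> V}) :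
  reflect (forall j, j \notin J -> u j = v j) (agree J u v).
Proof.
apply: (iffP forallP) => h j; last by apply/implyP => /h ->.
by move/implyP: (h j) => h' /h' /eqP.
Qed.

(* The two sets of end points in directions i and i' of J span a graph whose minimum degree is at
   least the bound for the sets obtained by freeing one coordinate less. *)
Lemma ends_card t (V : finType) (E : rel V) s k h r Dl (C : {set {ffun 'I_t -> V}}) (X : {set 'I_t}) :
  sparse E s k -> symmetric E -> 0 < h -> 2 * h <= k -> 16 * s * r <= h ->
  0 < s -> 16 * s <= Dl -> 0 < r ->
  (forall v, v \in C -> clique_tuple E v) ->
  (forall v i, v \in C -> i \in X -> Dl <= #|ext_of C [set i] v|) ->
  forall m (J : {set 'I_t}) v i, J \subset X -> #|J| = m.+1 -> v \in C -> i \in J ->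
  Dl * r ^ m <= #|ends C J v i|.
Proof.
move=> hs sE h0 hk hr s0 hD r0 hC hX; elim=> [|m IH] J v i JX cJ vC iJ.
  have eJ : J = [set i].
    by apply/eqP; rewrite eq_sym eqEcard sub1set iJ cards1 cJ.
  rewrite muln1 /ends card_in_imset; first by rewrite eJ; apply: hX => //; apply: (subsetP JX).
  move=> u u'; rewrite !inE eJ => /andP [_ /agreeP hu] /andP [_ /agreeP hu'] e.
  apply/ffunP => j; case: (eqVneq j i) => [->//|nj].
  by rewrite hu ?hu' // inE.
have cJi : #|J :\ i| = m.+1 by have := cardsD1 i J; rewrite iJ cJ; lia.
have [i' i'J] : exists i', i' \in J :\ i by apply/set0Pn; rewrite -card_gt0 cJi.
have ni : i' != i by move: i'J; rewrite !inE => /andP [].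
have i'J' : i' \in J by move: i'J; rewrite !inE => /andP [].
(* Let [u] have the value [p] at [a]. Freeing the coordinates of [J] other than [a] around [u] keeps
   this value, and since all members are clique tuples, the end points reached at [b] are neighbours
   of [p]. *)
have step a b : a \in J -> b \in J -> a != b -> forall p, p \in ends C J v a ->
    Dl * r ^ m <= #|nbr E (ends C J v b) p|.
  move=> aJ bJ nab p /imsetP [u]; rewrite inE => /andP [uC /agreeP hu] ->.
  have cJa : #|J :\ a| = m.+1 by apply/eqP; rewrite -eqSS -cJ (cardsD1 a J) aJ.
  have sJ : J :\ a \subset X by apply: subset_trans (subD1set _ _) JX.
  have bJa : b \in J :\ a by rewrite !inE eq_sym nab.
  apply: leq_trans (IH (J :\ a) u b sJ cJa uC bJa) _; apply: subset_leq_card.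
  apply/subsetP => q /imsetP [u']; rewrite inE => /andP [u'C /agreeP hu'] ->.
  have ea : u' a = u a by apply: hu'; rewrite !inE eqxx.
  rewrite inE; apply/andP; split.
    apply/imsetP; exists u' => //; rewrite inE u'C; apply/agreeP => j nj.
    by rewrite hu' ?hu // !inE negb_and nj orbT.
  by rewrite -ea; move/forallP: (hC u' u'C) => /(_ a) /forallP /(_ b) /implyP; apply.
have := @min_degree_growth V E s k h r (Dl * r ^ m) (ends C J v i) (ends C J v i') hs sE h0 hk hr s0.
rewrite -mulnA -expnSr; apply.
- by apply: leq_trans hD _; rewrite leq_pmulr // expn_gt0 r0.
- apply/set0Pn; exists (v i); apply/imsetP; exists v => //; rewrite inE vC.
  by apply/agreeP.
- by apply: step => //; rewrite eq_sym.
- exact: step.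
Qed.

(** Sort the extensions by their value at one coordinate of [J]. With [m.+1] free coordinates there
    are at least [r ^ m] values by [ends_card], and each leaves [m] coordinates free, so the
    exponents add up to a binomial coefficient. *)
Lemma ext_card t (V : finType) (E : rel V) s k h r Dl (C : {set {ffun 'I_t -> V}}) (X : {set 'I_t}) :
  sparse E s k -> symmetric E -> 0 < h -> 2 * h <= k -> 16 * s * r <= h ->
  0 < s -> 16 * s <= Dl -> 0 < r ->
  (forall v, v \in C -> clique_tuple E v) ->
  (forall v i, v \in C -> i \in X -> Dl <= #|ext_of C [set i] v|) ->
  forall m (J : {set 'I_t}) v, J \subset X -> #|J| = m -> v \in C ->
  r ^ 'C(m, 2) <= #|ext_of C J v|.
Proof.
move=> hs sE h0 hk hr s0 hD r0 hC hX; elim=> [|m IH] J v JX cJ vC.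
  by rewrite card_gt0; apply/set0Pn; exists v; rewrite inE vC; apply/agreeP.
have [i iJ] : exists i, i \in J by apply/set0Pn; rewrite -card_gt0 cJ.
have cJi : #|J :\ i| = m by have := cardsD1 i J; rewrite iJ cJ; lia.
have sJ : J :\ i \subset X by apply: subset_trans (subD1set _ _) JX.
have he := ends_card hs sE h0 hk hr s0 hD r0 hC hX JX cJ vC iJ.
rewrite binS bin1 expnD mulnC -[#|ext_of C J v|]sum1_card.
rewrite (partition_big (fun u : {ffun 'I_t -> V} => u i) (mem (ends C J v i))) /=; last first.
  by move=> u hu; apply/imsetP; exists u.
apply: leq_trans (_ : \sum_(p in ends C J v i) r ^ 'C(m, 2) <= _).
  rewrite sum_nat_const leq_mul //; apply: leq_trans he.
  by rewrite leq_pmull //; apply: leq_trans hD; rewrite muln_gt0.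
apply: leq_sum => p /imsetP [u]; rewrite inE => /andP [uC /agreeP hu] ->.
apply: leq_trans (IH _ u sJ cJi uC) _; rewrite -sum1_card big_mkcond [X in _ <= X]big_mkcond /=.
apply: leq_sum => u' _; case: ifP => // hu'.
move: hu'; rewrite inE => /andP [u'C /agreeP hu'].
have -> : u' \in ext_of C J v.
  rewrite inE u'C; apply/agreeP => j nj; rewrite hu' ?hu // !inE negb_and nj orbT //.
by rewrite (hu' i) ?eqxx // !inE eqxx.
Qed.

(** * From dense incidences to lines with many points *)

Definition fupd (t : nat) (V : finType) (v : {ffun 'I_t -> V}) (i : 'I_t) (a : V) : {ffun 'I_t -> V} :=
  [ffun j => if j == i then a else v j].

(** For a clique tuple [v] this is the degree of its T-node in direction [i] into the A-nodes [Y],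
    with copy numbers in [R]. *)
Definition mult (t : nat) (V : finType) (R : {set V}) (Y : {set 'I_t * {ffun 'I_t -> V}})
  (v : {ffun 'I_t -> V}) (i : 'I_t) : nat := #|[set a in R | (i, fupd v i a) \in Y]|.

Definition touched (t : nat) (V : finType) (R : {set V}) (X : {set 'I_t})
    (Y : {set 'I_t * {ffun 'I_t -> V}}) (C : {set {ffun 'I_t -> V}}) :=
  [set y in Y | (y.1 \in X) && [exists v in C, exists a in R, y == (y.1, fupd v y.1 a)]].

(* The potential [#|C| * r - 2 * c * D * #|touched C|] does not decrease when a line with fewer than
   [D] points is deleted, since each line meets at least [r / (2 * c)] touched nodes. *)
Lemma clean t (V : finType) (R : {set V}) (X : {set 'I_t}) (Y : {set 'I_t * {ffun 'I_t -> V}}) r c D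
    (C : {set {ffun 'I_t -> V}}) :
  (forall v i, v \in C -> i \in X -> r <= 2 * c * mult R Y v i) ->
  2 * c * D * #|touched R X Y C| < #|C| * r ->
  exists C' : {set {ffun 'I_t -> V}}, [/\ C' \subset C, C' != set0 &
    forall v i, v \in C' -> i \in X -> D <= #|ext_of C' [set i] v|].
Proof.
move: {2}#|C| (leqnn #|C|) => n; elim: n C => [|n IH] C hn hr hp.
  by move: hp; rewrite (_ : #|C| = 0) ?mul0n // ; lia.
case: (boolP [forall v in C, forall i in X, D <= #|ext_of C [set i] v|]) => hall.
  exists C; split=> //.
    by apply/negP => /eqP C0; move: hp; rewrite C0 cards0.
  move=> v i vC iX; move/forallP: hall => /(_ v) /implyP /(_ vC) /forallP /(_ i) /implyP; exact.
move: hall; rewrite negb_forall => /existsP [v]; rewrite negb_imply => /andP [vC].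
rewrite negb_forall => /existsP [i]; rewrite negb_imply -ltnNge => /andP [iX hD].
set L := ext_of C [set i] v in hD.
have LC : L \subset C by apply/subsetP => u; rewrite inE => /andP [].
have vL : v \in L by rewrite inE vC; apply/agreeP.
have cL : #|C| = #|L| + #|C :\: L| by rewrite -(cardsID L C) (setIidPr LC).
have L0 : 0 < #|L| by rewrite card_gt0; apply/set0Pn; exists v.
pose Z := [set (i, fupd v i a) | a in [set a in R | (i, fupd v i a) \in Y]].
have cZ : #|Z| = mult R Y v i.
  rewrite card_imset // => a b [] /ffunP /(_ i); by rewrite !ffunE eqxx.
have hT : #|touched R X Y (C :\: L)| + #|Z| <= #|touched R X Y C|.
  (* An A-node of direction [i] determines its line, so a tuple that touches a node of the deleted
     line lies on that line. *)
  have dis : [disjoint touched R X Y (C :\: L) & Z].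
    rewrite -setI_eq0; apply/eqP/setP => y; rewrite !inE; apply/negP => /andP [].
    move=> /and3P [yY _ /existsP [u /andP [uC /existsP [a /andP [aR /eqP e1]]]]].
    move=> /imsetP [b _ e2]; move: e1; rewrite e2 /= => -[] /ffunP e1.
    move: uC; rewrite inE => /andP [/negP nu uC]; apply: nu.
    rewrite inE uC; apply/agreeP => j; rewrite inE => nj.
    by have := e1 j; rewrite !ffunE (negbTE nj).
  rewrite -cardsUI; move: dis; rewrite -setI_eq0 => /eqP ->; rewrite cards0 addn0.
  apply: subset_leq_card; rewrite subUset; apply/andP; split.
    apply/subsetP => y; rewrite !inE => /and3P [-> -> /existsP [u /andP [uC h]]] /=.
    by apply/existsP; exists u; rewrite h andbT; move: uC; rewrite inE => /andP [].
  apply/subsetP => y /imsetP [a]; rewrite inE => /andP [aR aY] ->.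
  rewrite inE aY /= iX; apply/existsP; exists v; rewrite vC /=.
  by apply/existsP; exists a; rewrite aR eqxx.
have [|||C' [h1 h2 h3]] := IH (C :\: L).
- by lia.
- by move=> u j; rewrite inE => /andP [_ uC]; apply: hr.
- have := hr v i vC iX; rewrite -cZ.
  move: hp hT hD; rewrite cL.
  set T1 := #|touched _ _ _ _|; set T2 := #|touched _ _ _ _|; set z := #|Z|.
  set l := #|L|; set l' := #|C :\: L| => hp hT hD hz.
  have h1 : 2 * c * D * T2 + D * r <= 2 * c * D * T1.
    have : 2 * c * D * (T2 + z) <= 2 * c * D * T1 by rewrite leq_mul2l hT orbT.
    have : D * r <= D * (2 * c * z) by rewrite leq_mul2l hz orbT.
    by nia.
  have h2 : l * r <= D * r by rewrite leq_mul2r (ltnW hD) orbT.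
  by rewrite mulnDl in hp; lia.
exists C'; split=> //; apply: subset_trans h1 (subsetDl _ _).
Qed.

Lemma no_dense_incidence t (V : finType) (E : rel V) (R : {set V}) (Y : {set 'I_t * {ffun 'I_t -> V}})
    (C : {set {ffun 'I_t -> V}}) s k c d N sg :
  let r := #|R| in
  sparse E s k -> symmetric E -> (forall v, v \in C -> clique_tuple E v) ->
  0 < c -> d = 24 * c + 1 -> t = 4 * c * d -> N = c * t * r * k ^ t.-1 -> N <= sg ->
  #|C| <= sg -> #|Y| <= sg ->
  c.+1 * t * r * sg <= c * (\sum_(v in C) \sum_i mult R Y v i) + c * t * r * N ->
  r * r <= k < r.+1 * r.+1 -> 0 < s -> 128 * c ^ 3 * 2 ^ t * s < r -> c ^ 2 * t <= r ->
  False.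
Proof.
move=> r hs sE hC c0 hd ht hN Nsg Csg Ysg hdeg /andP [rk kr] s0 hr hr2.
have t0 : 0 < t by rewrite ht hd !muln_gt0 c0 addn1.
have p2 : 0 < 2 ^ t by rewrite expn_gt0.
have c3 : 0 < c ^ 3 by rewrite expn_gt0 c0.
have c32 : 0 < c ^ 3 * 2 ^ t by rewrite muln_gt0 c3.
have r32 : 128 * s < r.
  apply: leq_ltn_trans hr; rewrite -(mulnA 128); set P := c ^ 3 * 2 ^ t in c32 *.
  by rewrite -mulnA mulnCA leq_pmull.
have r0 : 0 < r by lia.
have k0 : 0 < k by nia.
have N0 : 0 < N by rewrite hN !muln_gt0 c0 t0 r0 expn_gt0 k0.
have tr0 : 0 < t * r by rewrite muln_gt0 t0.
have mult_le v i : mult R Y v i <= r.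
  by apply: subset_leq_card; apply/subsetP => a; rewrite inE => /andP [].
set Sm := \sum_(v in C) _ in hdeg.
have Sm_le : Sm <= #|C| * (t * r).
  rewrite -sum_nat_const; apply: leq_sum => v _.
  rewrite -[t in X in _ <= X]card_ord -sum_nat_const; exact: leq_sum.
(* Even if all T-nodes have full degree [t * r], the excess [t * r / c] of the density must be paid
   by the core, which has only [t * r * N] edges. *)
have sgN : sg <= c * N.
  rewrite -(leq_pmul2l tr0).
  have : c * Sm <= c * (sg * (t * r)) by rewrite leq_mul2l (leq_trans Sm_le) ?orbT // leq_mul2r Csg orbT.
  move: hdeg; rewrite -!mulnA !mulSn; set q := t * (r * sg).
  have -> : sg * (t * r) = q by rewrite /q; lia.
  have -> : t * (r * (c * N)) = c * (t * (r * N)) by lia.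
  lia.
pose rem v := [set i | r <= 2 * c * mult R Y v i].
(* As [N <= sg], the core pays at most density [t * r], so the degrees sum to at least
   [t * r * sg / c]. Directions that keep less than [r / (2 * c)] neighbours account for at most
   half of this. *)
have hrem : t * sg <= 2 * c * \sum_(v in C) #|rem v|.
  have h1 v : 2 * c * \sum_i mult R Y v i <= 2 * c * r * #|rem v| + r * t.
    have -> : r * t = \sum_(i < t) r by rewrite sum_nat_const card_ord mulnC.
    rewrite big_distrr /= -sum1_card big_distrr /=.
    rewrite [X in _ <= X + _]big_mkcond /= -big_split /=; apply: leq_sum => i _.
    rewrite inE; case: (leqP r (2 * c * mult R Y v i)) => hi.
      by apply: (leq_trans _ (leq_addr _ _)); rewrite muln1 leq_mul.
    by rewrite add0n ltnW.
  have h2 : 2 * c * Sm <= 2 * c * r * (\sum_(v in C) #|rem v|) + #|C| * (r * t).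
    rewrite /Sm big_distrr /= [X in _ <= X + _]big_distrr /= -sum_nat_const -big_split /=.
    by apply: leq_sum => v _; apply: h1.
  rewrite -(leq_pmul2l r0).
  have h3 : #|C| * (r * t) <= sg * (r * t) by rewrite leq_mul2r Csg orbT.
  have h4 : c * t * r * N <= c * t * r * sg by rewrite leq_mul2l Nsg orbT.
  set SR := \sum_(v in C) _ in h2 *.
  have -> : r * (2 * c * SR) = 2 * c * r * SR by lia.
  have -> : r * (t * sg) = sg * (r * t) by lia.
  have h5 : c.+1 * t * r * sg = c * t * r * sg + sg * (r * t) by rewrite -!mulnA mulSn; lia.
  by rewrite h5 in hdeg; lia.
pose good := [set v in C | d <= #|rem v|].
(* Since [t = 4 * c * d], the sum in [hrem] is at least [2 * d * sg], and tuples with fewer than [d]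
   directions account for at most half of that. *)
have hgood : sg <= 4 * c * #|good|.
  have h1 : \sum_(v in C) #|rem v| <= d * #|C| + t * #|good|.
    rewrite [d * _]mulnC [t * _]mulnC -!sum_nat_const.
    rewrite [X in _ <= _ + X]big_mkcond /= [X in _ <= X + _]big_mkcond [X in X <= _]big_mkcond /=.
    rewrite -big_split /=; apply: leq_sum => v _.
    rewrite inE; case: (v \in C) => //=; case: (leqP d #|rem v|) => hv; last by rewrite addn0 ltnW.
    by apply: (leq_trans _ (leq_addl _ _)); apply: leq_trans (max_card _) _; rewrite card_ord.
  have d0 : 0 < 2 * c * d by rewrite hd; nia.
  rewrite -(leq_pmul2l d0).
  have h2 : d * #|C| <= d * sg by rewrite leq_mul2l Csg orbT.
  have h3 : t * sg <= 2 * c * (d * sg + t * #|good|).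
    by apply: leq_trans hrem _; rewrite leq_mul2l (leq_trans h1) ?orbT // leq_add2r.
  move: h3; move: #|good| => g; rewrite ht.
  have -> : 4 * c * d * sg = 2 * c * d * sg + 2 * c * d * sg by lia.
  have -> : 2 * c * (d * sg + 4 * c * d * g) = 2 * c * d * sg + 2 * c * d * (4 * c * g) by lia.
  by rewrite leq_add2l.
(* Pigeonhole over the [2 ^ t] values of [rem]: at the cost of a constant factor all tuples share
   their directions, as [clean] requires. *)
have [X hX] : exists X : {set 'I_t}, #|good| <= 2 ^ t * #|[set v in good | rem v == X]|.
  apply/existsP; apply: contraT; rewrite negb_exists => /forallP h.
  have : \sum_(X : {set 'I_t}) 2 ^ t * #|[set v in good | rem v == X]| < \sum_(X : {set 'I_t}) #|good|.
    have lt X : 2 ^ t * #|[set v in good | rem v == X]| < #|good| by rewrite ltnNge h.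
    rewrite (bigD1 set0) //= [X in _ < X](bigD1 set0) //= -addSn leq_add //.
    by apply: leq_sum => X _; apply: ltnW.
  rewrite -big_distrr /= sum_nat_const.
  have -> : #|{set 'I_t}| = 2 ^ t by rewrite -cardsT -powersetT card_powerset cardsT card_ord.
  rewrite ltn_mul2l => /andP [_].
  suff -> : \sum_(X : {set 'I_t}) #|[set v in good | rem v == X]| = #|good| by rewrite ltnn.
  rewrite -[RHS]sum1_card (partition_big rem predT) //=; apply: eq_bigr => X _.
  by rewrite -sum1_card; apply: eq_bigl => v; rewrite inE.
set C1 := [set v in good | rem v == X] in hX.
have C1C v : v \in C1 -> v \in C by rewrite !inE => /andP [/andP []].
have C10 : 0 < #|C1|.
  rewrite lt0n; apply/negP => /eqP e; move: hX hgood; rewrite e muln0; lia.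
have [v0 v0C1] : exists v, v \in C1 by apply/set0Pn; rewrite -card_gt0.
have dX : d <= #|X| by move: v0C1; rewrite !inE => /andP [/andP [_ h] /eqP <-].
(* There are at most [c * N] A-nodes, and [C1] has at least [N / (4 * c * 2 ^ t)] tuples. The
   product [2 * c * (16 * s) * c * (4 * c * 2 ^ t)] is the constant [128 * c ^ 3 * 2 ^ t * s]
   compared with [r]. *)
have [||C2 [C21 C20 hC2]] := @clean t V R X Y r c (16 * s) C1.
- by move=> v i; rewrite !inE => /andP [_ /eqP <-]; rewrite inE.
- have h1 : #|touched R X Y C1| <= c * N.
    apply: leq_trans (leq_trans Ysg sgN); apply: subset_leq_card.
    by apply/subsetP => y; rewrite inE => /andP [].
  have h2 : N <= 4 * c * 2 ^ t * #|C1|.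
    by apply: leq_trans Nsg (leq_trans hgood _); rewrite -[_ * 2 ^ t * _]mulnA leq_mul2l hX orbT.
  have h3 : 2 * c * (16 * s) * #|touched R X Y C1| <= 128 * c ^ 3 * 2 ^ t * s * #|C1|.
    apply: leq_trans (_ : 2 * c * (16 * s) * (c * (4 * c * 2 ^ t * #|C1|)) <= _).
      by rewrite leq_mul2l (leq_trans h1) ?orbT // leq_mul2l h2 orbT.
    by rewrite !expnS expn0; lia.
  by apply: leq_ltn_trans h3 _; rewrite mulnC ltn_pmul2l.
have [J JX cJ] := ex_subset dX.
have [v vC2] : exists v, v \in C2 by apply/set0Pn.
have C2C u : u \in C2 -> u \in C by move=> /(subsetP C21); apply: C1C.
(* Blocks have [k %/ 2] vertices, so that two of them together remain within the reach of
   sparsity. *)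
have h16 : 16 * s * r <= k %/ 2 by rewrite leq_divRL //; nia.
have hk2 : 2 * (k %/ 2) <= k by rewrite mulnC leq_trunc_div.
have hh0 : 0 < k %/ 2 by apply: leq_trans h16; rewrite !muln_gt0 s0 r0.
have := @ext_card t V E s k (k %/ 2) r (16 * s) C2 X hs sE hh0 hk2 h16 s0 (leqnn _) r0
  (fun v hv => hC v (C2C v hv)) hC2 d J v JX cJ vC2.
apply/negP; rewrite -ltnNge.
have e1 : #|ext_of C2 J v| <= #|C|.
  by apply: subset_leq_card; apply/subsetP => u; rewrite inE => /andP [/C2C].
(* Here [c * N] is [c ^ 2 * t * r] times [k ^ t.-1], and [c ^ 2 * t <= r] makes the first factor at
   most [r * r <= k]. *)
have e2 : c * N <= k ^ t.
  rewrite hN -(prednK t0) expnS /=.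
  apply: leq_trans (_ : (c ^ 2 * t * r) * k ^ t.-1 <= _).
    by rewrite expnS expn1 (prednK t0); lia.
  by rewrite leq_mul2r (leq_trans _ rk) ?orbT // leq_mul2r hr2 orbT.
apply: leq_ltn_trans (leq_trans e1 (leq_trans Csg (leq_trans sgN e2))) _.
(* With [d = 24 * c + 1] this is [d * (24 * c) / 2 = 12 * c * d]. The factor 3 suffices because
   [r ^ 3 >= r.+1 ^ 2 > k]. *)
have -> : 'C(d, 2) = 3 * t.
  rewrite bin2 ht hd addn1 succnK.
  have -> : (24 * c).+1 * (24 * c) = (3 * (4 * c * (24 * c).+1)).*2 by rewrite -muln2; nia.
  by rewrite doubleK.
rewrite expnM ltn_exp2r //.
by apply: leq_trans kr _; rewrite !expnS expn0 muln1; nia.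
Qed.

(** * The constructed graph *)

Lemma sum_pairs n (E : rel 'I_n) (S : {set 'I_n}) : simple_graph E ->
  \sum_(x in S) \sum_(y in S) E x y = 2 * n_edges E S.
Proof.
move=> [sE iE].
pose f (x y : 'I_n) : nat := [&& E x y, x \in S & y \in S].
have -> : \sum_(x in S) \sum_(y in S) E x y = \sum_x \sum_y f x y.
  rewrite [LHS]big_mkcond; apply: eq_bigr => x _; rewrite /f.
  case: (x \in S); last by rewrite big1 // => y _; rewrite andbF.
  by rewrite big_mkcond; apply: eq_bigr => y _; case: (y \in S); rewrite ?andbT ?andbF.
have -> : n_edges E S = \sum_(x : 'I_n) \sum_(y : 'I_n | x < y) f x y.
  rewrite /n_edges -sum1_card big_mkcond pair_big_dep big_mkcond /=.
  rewrite [RHS]big_mkcond; apply: eq_bigr => -[x y] _; rewrite inE /f /=.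
  by case: (x < y) => //=; case: [&& _, _ & _].
have sf x y : f x y = f y x by rewrite /f sE; case: (E y x) => //=; rewrite andbC.
rewrite mul2n -addnn.
have -> : \sum_(x : 'I_n) \sum_(y : 'I_n | x < y) f x y + \sum_(x : 'I_n) \sum_(y : 'I_n | x < y) f x y =
  \sum_(x : 'I_n) \sum_(y : 'I_n | x < y) f x y + \sum_(x : 'I_n) \sum_(y : 'I_n | y < x) f x y.
  congr (_ + _); rewrite (exchange_big_dep predT) //=.
  by apply: eq_bigr => x _; apply: eq_bigr => y _; rewrite sf.
rewrite -big_split /=; apply: eq_bigr => x _.
rewrite (bigID (fun y : 'I_n => x < y)) /=; congr (_ + _).
rewrite (bigID (fun y : 'I_n => y < x)) /= [X in _ + X]big1 ?addn0.
  by apply: eq_bigl => y; case: ltngtP.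
move=> y; rewrite -leqNgt -leqNgt => h; have -> : y = x by apply/val_inj; apply/eqP; rewrite eqn_leq.
by rewrite /f (negbTE (iE x)).
Qed.

Lemma digits_inj n t x y : x %/ n ^ t = y %/ n ^ t ->
  (forall j, j < t -> digit n j x = digit n j y) -> x = y.
Proof.
elim: t => [|t IH]; first by rewrite expn0 !divn1.
rewrite expnSr !divnMA => h hd; apply: IH; last by move=> j hj; apply: hd; lia.
by rewrite (divn_eq (x %/ n ^ t) n) (divn_eq (y %/ n ^ t) n) h; congr (_ + _); apply: hd.
Qed.

(** Reading off type and digits is injective between sets of equal size, so an inverse exists
    without being written down. *)
Lemma node_ex n t : 0 < n -> exists node : 'I_(t + 3) * {ffun 'I_t -> 'I_n} -> 'I_(big_n t n),
  bijective node /\ forall p, node_type t n (node p) = p.1 /\ forall j : 'I_t, digit n j (node p) = p.2 j.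
Proof.
move=> n0; have nt0 : 0 < n ^ t by rewrite expn_gt0 n0.
have ht (x : 'I_(big_n t n)) : node_type t n x < t + 3 by rewrite /node_type ltn_divLR.
pose phi (x : 'I_(big_n t n)) : 'I_(t + 3) * {ffun 'I_t -> 'I_n} :=
  (Ordinal (ht x), [ffun j : 'I_t => Ordinal (ltn_pmod (x %/ n ^ j) n0)]).
have inj : injective phi.
  move=> x y [e1 /ffunP e2]; apply/val_inj; apply: (@digits_inj n t) => // j hj.
  by have := e2 (Ordinal hj); rewrite !ffunE => -[].
have [|node h1 h2] := inj_card_bij inj.
  by rewrite card_prod card_ffun !card_ord.
exists node; split; first by exists phi.
by move=> p; split=> [|j]; rewrite -[in RHS](h2 p) //= ffunE.
Qed.

Lemma all_iota_ord t (P : nat -> bool) : all P (iota 0 t) = [forall j : 'I_t, P j].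
Proof.
apply/allP/forallP => [h j|h j]; first by apply: h; rewrite mem_iota ltn_ord.
by rewrite mem_iota => /andP [_ hj]; exact: (h (Ordinal hj)).
Qed.

Lemma has_iota_ord t (P : nat -> bool) : has P (iota 0 t) = [exists j : 'I_t, P j].
Proof. by apply: negb_inj; rewrite -all_predC all_iota_ord negb_exists. Qed.

Lemma card_low n t tau a : #|[set x : 'I_(big_n t n) | (node_type t n x == tau) && (node_low t n x < a)]| <= a.
Proof.
rewrite -[X in _ <= X](size_iota 0) cardE -(size_map (fun x : 'I_(big_n t n) => node_low t n x)).
apply: uniq_leq_size.
  rewrite map_inj_in_uniq ?enum_uniq // => x y; rewrite !mem_enum !inE => /andP [/eqP e1 _] /andP [/eqP e2 _] e.
  apply/val_inj; rewrite /= (divn_eq x (n ^ t)) (divn_eq y (n ^ t)).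
  by rewrite -/(node_type t n x) -/(node_type t n y) e1 e2 -/(node_low t n x) e.
by move=> l /mapP [x]; rewrite mem_enum inE => /andP [_ h] ->; rewrite mem_iota.
Qed.

Lemma card_low_ge n t tau a : a <= n ^ t -> tau < t + 3 ->
  a <= #|[set x : 'I_(big_n t n) | (node_type t n x == tau) && (node_low t n x < a)]|.
Proof.
case: a => // a ha ht.
have hb (l : 'I_a.+1) : tau * n ^ t + l < big_n t n.
  have := ltn_ord l; rewrite /big_n => hl.
  apply: leq_trans (_ : tau.+1 * n ^ t <= _); first by rewrite mulSn; lia.
  by rewrite leq_mul2r ht orbT.
pose f (l : 'I_a.+1) : 'I_(big_n t n) := Ordinal (hb l).
have inj : injective f by move=> l l' [] /addnI /val_inj.
rewrite -[X in X <= _](card_ord a.+1) -(card_imset _ inj).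
apply: subset_leq_card; apply/subsetP => x /imsetP [l _ ->].
have hl := ltn_ord l; have nt0 : 0 < n ^ t by lia.
rewrite inE /node_type /node_low /= divnMDl // modnMDl divn_small ?modn_small; [|lia|lia].
by rewrite addn0 eqxx hl.
Qed.

Definition biggraph (c t n k : nat) (A : nat -> nat -> bool) : rel 'I_(big_n t n) :=
  fun x y => edge c t n k A x y.

(** The graph is bipartite: T-nodes and one core side are always the first argument, A-nodes and the
    other core side the second. Hence [inc] counts every edge once. *)
Lemma inc_asym c t n k A x y : inc c t n k A x y -> inc c t n k A y x = false.
Proof.
have h u v : inc c t n k A u v -> (t <= node_type t n u <= t.+1) && ((node_type t n v < t) || (node_type t n v == t.+2)).
  case/orP; first by case/hasP => i; rewrite mem_iota => hi /and5P [/eqP -> _ /eqP -> _ _]; lia.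
  by case/and4P => /eqP -> /eqP -> _ _; lia.
by move=> /h h1; apply/negP => /h h2; lia.
Qed.

Lemma biggraph_simple c t n k A : simple_graph (@biggraph c t n k A).
Proof.
split=> [x y|x]; first by rewrite /biggraph /edge orbC.
rewrite /biggraph /edge orbb; apply/negP => h; have := inc_asym h; by rewrite h.
Qed.

Lemma biggraph_edges c t n k A (S : {set 'I_(big_n t n)}) :
  n_edges (@biggraph c t n k A) S = \sum_(x in S) \sum_(y in S) inc c t n k A x y.
Proof.
apply/eqP; rewrite -(eqn_pmul2l (isT : 0 < 2)) -sum_pairs; last exact: biggraph_simple.
have -> : \sum_(x in S) \sum_(y in S) biggraph c k A x y =
  \sum_(x in S) \sum_(y in S) inc c t n k A x y + \sum_(x in S) \sum_(y in S) inc c t n k A y x.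
  rewrite -big_split; apply: eq_bigr => x _; rewrite -big_split; apply: eq_bigr => y _ /=.
  rewrite /biggraph /edge; case e: (inc c t n k A x y) => //=.
  by rewrite (inc_asym e).
by rewrite [X in _ + X]exchange_big /= mul2n addnn.
Qed.

Definition tyA t (i : 'I_t) : 'I_(t + 3) := lshift 3 i.
Definition tyT t : 'I_(t + 3) := rshift t ord0.

Definition Tset n t (E : rel 'I_n) (node : 'I_(t + 3) * {ffun 'I_t -> 'I_n} -> 'I_(big_n t n))
  (S : {set 'I_(big_n t n)}) : {set {ffun 'I_t -> 'I_n}} :=
  [set v | clique_tuple E v && (node (tyT t, v) \in S)].

Definition Aset n t (node : 'I_(t + 3) * {ffun 'I_t -> 'I_n} -> 'I_(big_n t n))
  (S : {set 'I_(big_n t n)}) : {set 'I_t * {ffun 'I_t -> 'I_n}} :=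
  [set y | node (tyA y.1, y.2) \in S].

Definition low_set n r : {set 'I_n} := [set a : 'I_n | a < r].

Lemma incA_node n t k (A : nat -> nat -> bool) (E : rel 'I_n) (x y : 'I_(big_n t n)) (tau : 'I_(t + 3)) (f g : {ffun 'I_t -> 'I_n}) (tau' : 'I_(t + 3)) :
  (forall i j : 'I_n, A i j = E i j) ->
  node_type t n x = tau -> (forall j : 'I_t, digit n j x = f j) ->
  node_type t n y = tau' -> (forall j : 'I_t, digit n j y = g j) ->
  incA t n k A x y = (tau == tyT t) && clique_tuple E f &&
    [exists i : 'I_t, [&& tau' == tyA i, g i < root2 k & g == fupd f i (g i)]].
Proof.
move=> hA tx dx ty dy; rewrite /incA has_iota_ord tx ty.
have eT : ((tau : nat) == t) = (tau == tyT t) by rewrite -val_eqE /= addn0.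
have eA (i : 'I_t) : ((tau' : nat) == i) = (tau' == tyA i) by [].
have ec : all (fun j => all (fun j' => (j == j') || A (digit n j x) (digit n j' x)) (iota 0 t)) (iota 0 t)
   = clique_tuple E f.
  rewrite all_iota_ord /clique_tuple; apply: eq_forallb => j; rewrite all_iota_ord.
  by apply: eq_forallb => j'; rewrite !dx hA -val_eqE; case: (_ == _).
apply/existsP/andP => [[i /and5P [h1 h2 h3 h4 h5]]|[/andP [h1 h2] /existsP [i /and3P [h3 h4 h5]]]].
  split; first by rewrite -eT h3 -ec.
  apply/existsP; exists i; rewrite -eA h1 -dy h2 /=.
  apply/eqP/ffunP => j; rewrite ffunE; case: eqP => [->//|/eqP nj].
  move: h4; rewrite all_iota_ord => /forallP /(_ j); rewrite val_eqE (negbTE nj) /= dx dy => /eqP e.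
  exact/val_inj.
exists i; rewrite eA h3 dy h4 eT h1 ec h2 andbT /= all_iota_ord.
apply/forallP => j; rewrite val_eqE dx dy (eqP h5) !ffunE.
by case: (j == i) => //=.
Qed.

(** Translates incidences between numbered nodes into the degrees [mult] of clique tuples, the
    language of [no_dense_incidence]. *)
Lemma sum_incA n t k (A : nat -> nat -> bool) (E : rel 'I_n) (node : 'I_(t + 3) * {ffun 'I_t -> 'I_n} -> 'I_(big_n t n))
    (S : {set 'I_(big_n t n)}) :
  (forall i j : 'I_n, A i j = E i j) -> bijective node ->
  (forall p, node_type t n (node p) = p.1 /\ forall j : 'I_t, digit n j (node p) = p.2 j) ->
  \sum_(x in S) \sum_(y in S) incA t n k A x y =
  \sum_(v in Tset E node S) \sum_i mult (low_set n (root2 k)) (Aset node S) v i.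
Proof.
move=> hA bn hn; have injn := bij_inj bn.
have hsurj x : exists p, x = node p by case: bn => g _ gk; exists (g x); rewrite gk.
have injT : injective (fun v => node (tyT t, v)) by move=> v w /injn [].
pose G x := \sum_(y in S) incA t n k A x y.
have hG tau f : G (node (tau, f)) =
   if (tau == tyT t) && clique_tuple E f then \sum_i mult (low_set n (root2 k)) (Aset node S) f i else 0.
  have [tx dx] := hn (tau, f).
  have hi tau' g := @incA_node n t k A E (node (tau, f)) (node (tau', g)) tau f g tau' hA tx dx
     (hn (tau', g)).1 (hn (tau', g)).2.
  case: ifP => hc; last first.
    by rewrite /G big1 // => y _; have [[tau' g] ->] := hsurj y; rewrite hi hc.
  pose Z := [set p : 'I_t * 'I_n | (p.2 < root2 k) && (node (tyA p.1, fupd f p.1 p.2) \in S)].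
  have -> : \sum_i mult (low_set n (root2 k)) (Aset node S) f i = #|Z|.
    transitivity (\sum_(i : 'I_t) \sum_(a : 'I_n) if (i, a) \in Z then 1 else 0).
      apply: eq_bigr => i _; rewrite /mult -sum1_card big_mkcond; apply: eq_bigr => a _.
      by rewrite !inE.
    by rewrite pair_bigA /= -sum1_card [RHS]big_mkcond; apply: eq_bigr => -[i a] _.
  have injZ : injective (fun p : 'I_t * 'I_n => node (tyA p.1, fupd f p.1 p.2)).
    move=> [i a] [i' a'] /injn [e1 e2]; have ei : i = i' by apply/val_inj.
    by subst i'; move/ffunP: e2 => /(_ i); rewrite !ffunE eqxx => ->.
  rewrite -(card_imset _ injZ) /G.
  have -> : \sum_(y in S) incA t n k A (node (tau, f)) y = #|[set y in S | incA t n k A (node (tau, f)) y]|.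
    rewrite -sum1_card big_mkcond [RHS]big_mkcond; apply: eq_bigr => y _.
    by rewrite inE; case: (y \in S) => //; case: incA.
  apply: eq_card => y; rewrite inE; have [[tau' g] ->] := hsurj y; rewrite hi hc /=.
  apply/andP/imsetP => [[yS /existsP [i /and3P [/eqP e1 h2 /eqP e3]]]|[[i a]]].
    exists (i, g i); rewrite ?inE /= -?e3 -?e1 ?h2 //.
  rewrite inE /= => /andP [h1 h2] /injn [e1 e2]; rewrite e1 e2 h2; split=> //.
  by apply/existsP; exists i; rewrite !ffunE !eqxx h1.
rewrite -[LHS]/(\sum_(x in S) G x).
pose I := [set node (tyT t, v) | v in Tset E node S].
have IS : I \subset S by apply/subsetP => x /imsetP [v]; rewrite inE => /andP [_ h] ->.
rewrite (big_setID I) /= (setIidPr IS) [X in _ + X]big1 ?addn0.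
  rewrite big_imset /=; last by move=> v w _ _ /injT.
  by apply: eq_bigr => v; rewrite inE => /andP [h _]; rewrite hG eqxx h.
move=> x; have [[tau f] ->] := hsurj x; rewrite inE => /andP [nI xS]; rewrite hG.
case: ifP => // /andP [/eqP et hc]; case/negP: nI; rewrite et.
by apply/imsetP; exists f => //; rewrite inE hc -et.
Qed.

Lemma sum_incC c t n k (S : {set 'I_(big_n t n)}) :
  let a := c * t * root2 k in let b := t * root2 k * k ^ t.-1 in
  let L := [set x : 'I_(big_n t n) | (node_type t n x == t.+1) && (node_low t n x < a)] in
  let Q := [set x : 'I_(big_n t n) | (node_type t n x == t.+2) && (node_low t n x < b)] in
  \sum_(x in S) \sum_(y in S) incC c t n k x y = #|S :&: L| * #|S :&: Q|.
Proof.
move=> a b L Q.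
have -> : #|S :&: L| * #|S :&: Q| = \sum_(x in S) \sum_(y in S) ((x \in L) && (y \in Q)).
  rewrite -!sum1_card big_distrl /= big_mkcond [RHS]big_mkcond; apply: eq_bigr => x _.
  rewrite inE; case: (x \in S) => //=; case: (x \in L) => /=; last by rewrite big1.
  rewrite mul1n big_mkcond [RHS]big_mkcond; apply: eq_bigr => y _.
  by rewrite inE; case: (y \in S) => //=; case: (y \in Q).
apply: eq_bigr => x _; apply: eq_bigr => y _; rewrite !inE /incC -/a -/b.
by case: (_ == _); case: (_ == _); case: (_ < _); case: (_ < _).
Qed.

Lemma sum_inc c t n k A (S : {set 'I_(big_n t n)}) :
  \sum_(x in S) \sum_(y in S) inc c t n k A x y =
  \sum_(x in S) \sum_(y in S) incA t n k A x y + \sum_(x in S) \sum_(y in S) incC c t n k x y.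
Proof.
rewrite -big_split; apply: eq_bigr => x _; rewrite -big_split; apply: eq_bigr => y _ /=.
rewrite /inc; case e: (incA t n k A x y) => //=; case e2: incC => //.
move: e => /hasP [i]; rewrite mem_iota => hi /and5P [_ _ /eqP e _ _].
by move: e2; rewrite /incC e => /and4P [/eqP]; lia.
Qed.

Lemma root2P k : root2 k * root2 k <= k < (root2 k).+1 * (root2 k).+1.
Proof.
have [h1 h2] := PeanoNat.Nat.sqrt_spec k (PeanoNat.Nat.le_0_l k).
have -> : root2 k = PeanoNat.Nat.sqrt k; last by lia.
have hk : PeanoNat.Nat.sqrt k <= k by have := PeanoNat.Nat.sqrt_le_lin k; lia.
by rewrite -[RHS](sum_ltn hk); apply: eq_bigr => i _; congr (nat_of_bool _); nia.
Qed.

Lemma card_low_set n r : r <= n -> #|low_set n r| = r.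
Proof.
move=> h; have inj : injective (widen_ord h) by move=> x y [] /val_inj.
rewrite -[RHS](card_ord r) -(card_imset _ inj).
apply: eq_card => a; rewrite inE; apply/idP/imsetP => [ha|[l _ ->]]; last exact: (ltn_ord l).
by exists (Ordinal ha) => //; apply/val_inj.
Qed.

Lemma card_Tset n t (E : rel 'I_n) (node : 'I_(t + 3) * {ffun 'I_t -> 'I_n} -> 'I_(big_n t n)) S :
  injective node -> #|Tset E node S| <= #|S|.
Proof.
move=> injn; have inj : injective (fun v => node (tyT t, v)) by move=> v w /injn [].
rewrite -(card_imset _ inj); apply: subset_leq_card; apply/subsetP => x /imsetP [v].
by rewrite inE => /andP [_ h] ->.
Qed.

Lemma card_Aset n t (node : 'I_(t + 3) * {ffun 'I_t -> 'I_n} -> 'I_(big_n t n)) S :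
  injective node -> #|Aset node S| <= #|S|.
Proof.
move=> injn; have inj : injective (fun p : 'I_t * {ffun 'I_t -> 'I_n} => node (tyA p.1, p.2)).
  by move=> [i v] [i' w] /injn [e ->]; congr (_, _); apply/val_inj.
rewrite -(card_imset _ inj); apply: subset_leq_card; apply/subsetP => x /imsetP [v].
by rewrite inE => h ->.
Qed.

(** Whatever [S] takes of the core, it gets at most [t * r * N] edges from it; the remaining edges
    are incidences of T-nodes with A-nodes, which [no_dense_incidence] bounds. The refuted
    inequality is density at least (1 + 1/c) t r, cleared of denominators. *)
Lemma reduction_no n (E : rel 'I_n) (A : nat -> nat -> bool) c t k s (S : {set 'I_(big_n t n)}) :
  simple_graph E -> (forall i j : 'I_n, A i j = E i j) ->
  (forall S' : {set 'I_n}, #|S'| <= k -> n_edges E S' <= s * #|S'|) ->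
  0 < n -> k <= n -> 0 < c -> t = 4 * c * (24 * c + 1) -> 0 < s ->
  128 * c ^ 3 * 2 ^ t * s < root2 k -> c ^ 2 * t <= root2 k ->
  big_k c t k <= #|S| ->
  ~ (c.+1 * t * root2 k * #|S| <= c * n_edges (@biggraph c t n k A) S).
Proof.
move=> sE hA hs n0 kn c0 ht s0 hr hr2 hN hv.
have [node [bn hn]] := @node_ex n t n0; have injn := bij_inj bn.
have /andP [rk kr] := root2P k.
have rn : root2 k <= n by nia.
move: hv; rewrite biggraph_edges sum_inc (@sum_incA n t k A E node S hA bn hn) sum_incC.
set C := Tset _ _ _; set Y := Aset _ _; set LQ := #|S :&: _| * _ => hv.
have hLQ : LQ <= c * t * root2 k * (t * root2 k * k ^ t.-1).
  by apply: leq_mul; apply: leq_trans (subset_leq_card (subsetIr _ _)) _; apply: card_low.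
have sp : sparse E s k.
  move=> S' hS'; have := sum_pairs S' sE; rewrite pairs_ofE => ->.
  by rewrite -mulnA leq_mul2l hs.
apply: (@no_dense_incidence t _ E (low_set n (root2 k)) Y C s k c (24 * c + 1) (big_k c t k) #|S|);
  rewrite ?card_low_set //.
- by case: sE.
- by move=> v; rewrite inE => /andP [].
- exact: card_Tset.
- exact: card_Aset.
- apply: leq_trans hv _; rewrite mulnDr leq_add2l -!mulnA leq_mul2l.
  by apply/orP; right; move: hLQ; rewrite /big_k; lia.
- by rewrite rk.
Qed.

(** Each clique is listed in the order of [enum]; one ordering per clique is enough for a lower
    bound on the tuples. *)
Lemma cliques_tuples n (E : rel 'I_n) t (S : {set 'I_n}) : 0 < n ->
  n_cliques E t S <= #|[set v : {ffun 'I_t -> 'I_n} | clique_tuple E v && [forall j, v j \in S]]|.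
Proof.
move=> n0; pose x0 := Ordinal n0.
pose f (T : {set 'I_n}) : {ffun 'I_t -> 'I_n} := [ffun j : 'I_t => nth x0 (enum T) j].
rewrite /n_cliques -(@card_in_imset _ _ f); last first.
  move=> T T'; rewrite !inE => /and3P [_ /eqP c1 _] /and3P [_ /eqP c2 _] /ffunP e.
  apply/setP => x; rewrite -[x \in T]mem_enum -[x \in T']mem_enum.
  suff -> : enum T = enum T' by [].
  apply: (@eq_from_nth _ x0); first by rewrite -!cardE c1 c2.
  move=> j; rewrite -cardE c1 => hj; have := e (Ordinal hj); rewrite !ffunE; exact.
apply: subset_leq_card; apply/subsetP => v /imsetP [T]; rewrite inE => /and3P [TS /eqP cT hT] ->.
have hm (j : 'I_t) : f T j \in T by rewrite ffunE -mem_enum mem_nth // -cardE cT.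
rewrite inE; apply/andP; split; last by apply/forallP => j; apply: (subsetP TS).
apply/forallP => j; apply/forallP => j'; apply/implyP => nj.
move/forallP: hT => /(_ (f T j)) /implyP /(_ (hm j)) /forallP /(_ (f T j')) /implyP /(_ (hm j')).
move/implyP; apply; rewrite !ffunE nth_uniq ?enum_uniq // -cardE cT //.
Qed.

(** Counts the A-nodes of direction [i] over [S]: a copy number in [R], the other coordinates in
    [S]. *)
Lemma card_lines n t (S R : {set 'I_n}) (i : 'I_t) :
  #|[set w : {ffun 'I_t -> 'I_n} | [forall j, w j \in (if j == i then R else S)]]| = #|R| * #|S| ^ t.-1.
Proof.
have -> : #|[set w : {ffun 'I_t -> 'I_n} | [forall j, w j \in (if j == i then R else S)]]| =
   #|(family (fun j => mem (if j == i then R else S)) : simpl_pred {ffun 'I_t -> 'I_n})|.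
  by apply: eq_card => w; rewrite inE; apply/forallP/familyP => h j; exact: h.
rewrite card_family /image_mem foldrE big_map big_enum /= (bigD1 i) //= eqxx; congr (_ * _).
rewrite (eq_bigr (fun=> #|S|)); last by move=> j /negbTE ->.
rewrite prod_nat_const; congr (_ ^ _).
by rewrite cardC1 card_ord.
Qed.

(** [S'] takes [N] clique tuples over [S], all A-nodes over [S] and both core sides. The last three
    have at most [N / c] nodes each, hence the 3; the T-nodes and the core contribute [t * r * N]
    edges each. *)
Lemma reduction_yes n (E : rel 'I_n) (A : nat -> nat -> bool) c t k (S : {set 'I_n}) :
  (forall i j : 'I_n, A i j = E i j) ->
  0 < n -> k <= n -> 0 < c -> 1 < t -> #|S| = k -> c * t * root2 k <= k -> c <= k ->
  big_k c t k <= n_cliques E t S ->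
  exists S' : {set 'I_(big_n t n)},
    [/\ big_k c t k <= #|S'|, c * #|S'| <= (c + 3) * big_k c t k
      & 2 * t * root2 k * big_k c t k <= n_edges (@biggraph c t n k A) S'].
Proof.
move=> hA n0 kn c0 t1 cS hctr hck hN.
have [node [bn hn]] := @node_ex n t n0; have injn := bij_inj bn.
set N := big_k c t k in hN *; set r := root2 k in hctr *.
have rk : r <= k by apply: leq_trans hctr; rewrite leq_pmull // muln_gt0 c0; lia.
have [C0 C0s cC0] := ex_subset (leq_trans hN (cliques_tuples E t S n0)).
set R := low_set n r; have cR : #|R| = r by rewrite card_low_set // (leq_trans rk).
pose Y0 := [set p : 'I_t * {ffun 'I_t -> 'I_n} | [forall j, p.2 j \in (if j == p.1 then R else S)]].
have cY0 : #|Y0| = t * (r * k ^ t.-1).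
  transitivity (\sum_(i : 'I_t) \sum_(w : {ffun 'I_t -> 'I_n}) if (i, w) \in Y0 then 1 else 0).
    by rewrite pair_bigA /= -sum1_card [LHS]big_mkcond; apply: eq_bigr => -[i w] _.
  rewrite (eq_bigr (fun=> r * k ^ t.-1)); first by rewrite sum_nat_const card_ord.
  move=> i _; rewrite -cR -cS -(card_lines S R i) -sum1_card [RHS]big_mkcond.
  by apply: eq_bigr => w _; rewrite !inE.
set a := c * t * r; set b := t * r * k ^ t.-1.
pose L := [set x : 'I_(big_n t n) | (node_type t n x == t.+1) && (node_low t n x < a)].
pose Q := [set x : 'I_(big_n t n) | (node_type t n x == t.+2) && (node_low t n x < b)].
pose I1 := [set node (tyT t, v) | v in C0].
pose I2 := [set node (tyA p.1, p.2) | p in Y0].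
pose S' := I1 :|: I2 :|: L :|: Q.
have injT : injective (fun v => node (tyT t, v)) by move=> v w /injn [].
have injA : injective (fun p : 'I_t * {ffun 'I_t -> 'I_n} => node (tyA p.1, p.2)).
  by move=> [i v] [i' w] /injn [e ->]; congr (_, _); apply/val_inj.
have t0 : 0 < t by lia.
have hb : b * c = N by rewrite /b /N /big_k -/r; lia.
have hac : a * c <= N.
  rewrite /N /big_k -/r leq_mul // (leq_trans hck) //.
  by rewrite -{1}(expn1 k) leq_pexp2l //; lia.
have kt : k ^ t <= n ^ t by rewrite leq_exp.
have bk : b <= n ^ t.
  apply: leq_trans kt; rewrite -[X in _ <= _ ^ X](prednK t0) expnS leq_mul2r.
  by rewrite (leq_trans _ hctr) ?orbT // -mulnA leq_pmull.
have ak : a <= n ^ t.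
  apply: leq_trans kt; apply: leq_trans hctr _.
  by rewrite -{1}(expn1 k) leq_pexp2l //; lia.
have cL : #|L| = a by apply/eqP; rewrite eqn_leq card_low card_low_ge //; lia.
have cQ : #|Q| = b by apply/eqP; rewrite eqn_leq card_low card_low_ge //; lia.
have c1 : #|I1| = N by rewrite card_imset.
have c2 : #|I2| = b by rewrite card_imset // cY0 /b mulnA.
have I1S : I1 \subset S' by rewrite /S' -!setUA subsetUl.
have I2S : I2 \subset S' by rewrite /S' -!setUA setUCA subsetUl.
have LS : L \subset S' by rewrite /S'; apply: subset_trans (subsetUl _ _); apply: subsetUr.
have QS : Q \subset S' by rewrite /S' subsetUr.
exists S'; split.
- by rewrite -c1 subset_leq_card.
- have h : #|S'| <= N + b + a + b.
    rewrite /S'; apply: leq_trans (leq_card_setU _ _) _; rewrite cQ leq_add2r.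
    apply: leq_trans (leq_card_setU _ _) _; rewrite cL leq_add2r.
    by apply: leq_trans (leq_card_setU _ _) _; rewrite c1 c2.
  by apply: leq_trans (leq_mul (leqnn c) h) _; lia.
rewrite biggraph_edges sum_inc (@sum_incA n t k A E node S' hA bn hn) sum_incC -/r -/a -/b -/L -/Q.
rewrite (setIidPr LS) (setIidPr QS) cL cQ.
have -> : 2 * t * r * N = N * (t * r) + t * r * N by lia.
apply: leq_add; last by rewrite -hb /a; lia.
have C0T : C0 \subset Tset E node S'.
  apply/subsetP => v vC; rewrite inE; apply/andP; split.
    by move: (subsetP C0s v vC); rewrite inE => /andP [].
  by apply: (subsetP I1S); apply/imsetP; exists v.
rewrite (big_setID C0) /= (setIidPr C0T); apply: leq_trans (leq_addr _ _).
rewrite -cC0 -sum_nat_const; apply: leq_sum => v vC.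
have -> : t * r = \sum_(i < t) r by rewrite sum_nat_const card_ord.
apply: leq_sum => i _; rewrite -{1}cR; apply: subset_leq_card.
apply/subsetP => x xR; rewrite inE xR inE /=.
apply: (subsetP I2S); apply/imsetP; exists (i, fupd v i x) => //.
rewrite inE; apply/forallP => j /=; rewrite ffunE; case: eqP => // _.
by move: (subsetP C0s v vC); rewrite inE => /andP [_ /forallP].
Qed.

(** * Encodings and densities *)

Lemma sum_prefix (u : nat -> bool) n m : (forall j, j < n -> u j) -> u n = false -> n <= m ->
  \sum_(0 <= i < m) all u (iota 0 i.+1) = n.
Proof.
move=> h1 h2 hm; rewrite -[RHS](sum_ltn hm); apply: eq_bigr => i _; congr nat_of_bool.
apply/allP/idP => [h|hi j]; last by rewrite mem_iota => /andP [_ hj]; apply: h1; lia.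
rewrite ltnNge; apply/negP => hi; have := h n; rewrite h2 mem_iota => h'.
by apply: notF; apply: h'; lia.
Qed.

Lemma nth_flatten_blocks (T : Type) (x0 : T) (ss : seq (seq T)) m i j :
  all (fun s => size s == m) ss -> j < m ->
  nth x0 (flatten ss) (i * m + j) = nth x0 (nth [::] ss i) j.
Proof.
move=> + hj; elim: ss i => [|s ss IH] i /=; first by rewrite !nth_nil.
case/andP => /eqP hs hss; rewrite nth_cat hs; case: i => [|i] /=.
  by rewrite mul0n hj.
have -> : (i.+1 * m + j < m) = false by lia.
by rewrite -IH //; congr nth; lia.
Qed.

Definition adj_bits n (E : rel 'I_n) : seq bool :=
  [seq E p.1 p.2 | p <- [seq (i, j) | i <- enum 'I_n, j <- enum 'I_n]].

Lemma adj_bitsE n (E : rel 'I_n) :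
  adj_bits E = flatten [seq [seq E i j | j <- enum 'I_n] | i <- enum 'I_n].
Proof.
rewrite /adj_bits map_flatten -map_comp; congr flatten; apply: eq_map => i /=.
by rewrite -map_comp.
Qed.

Lemma nth_adj_bits n (E : rel 'I_n) (i j : 'I_n) : nth false (adj_bits E) (i * n + j) = E i j.
Proof.
rewrite adj_bitsE nth_flatten_blocks //.
  have sz : size (enum 'I_n) = n by rewrite size_enum_ord.
  rewrite (nth_map i) ?sz // (nth_map i) ?sz //.
  by rewrite !nth_ord_enum.
by apply/allP => s /mapP [x _ ->]; rewrite size_map size_enum_ord.
Qed.

Lemma encodeE n (E : rel 'I_n) k :
  encode E k = nseq n true ++ false :: nseq k true ++ false :: adj_bits E.
Proof. by []. Qed.

Lemma n_of_encode n (E : rel 'I_n) k : n_of (encode E k) = n.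
Proof.
rewrite /n_of; apply: sum_prefix.
- by move=> j hj; rewrite encodeE nth_cat size_nseq hj nth_nseq hj.
- by rewrite encodeE nth_cat size_nseq ltnn subnn.
- by rewrite encodeE size_cat size_nseq leq_addr.
Qed.

Lemma k_of_encode n (E : rel 'I_n) k : k_of (encode E k) = k.
Proof.
rewrite /k_of n_of_encode.
have e j : nth false (encode E k) (n.+1 + j) = nth false (nseq k true ++ false :: adj_bits E) j.
  rewrite encodeE nth_cat size_nseq; have -> : (n.+1 + j < n) = false by lia.
  by have -> : n.+1 + j - n = j.+1 by lia.
apply: sum_prefix.
- by move=> j hj; rewrite e nth_cat size_nseq hj nth_nseq hj.
- by rewrite e nth_cat size_nseq ltnn subnn.
- by rewrite encodeE !size_cat /= size_cat !size_nseq; lia.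
Qed.

Lemma adj_of_encode n (E : rel 'I_n) k (i j : 'I_n) : adj_of (encode E k) i j = E i j.
Proof.
rewrite /adj_of n_of_encode k_of_encode encodeE -[RHS]nth_adj_bits.
rewrite nth_cat size_nseq; case: ifP => h; first by lia.
have -> : (n + k).+2 + (i * n + j) - n = (k.+1 + (i * n + j)).+1 by lia.
rewrite /= nth_cat size_nseq; case: ifP => h'; first by lia.
by have -> : k.+1 + (i * n + j) - k = (i * n + j).+1 by lia.
Qed.

Lemma flatten_bits (N : nat) (f : nat -> nat -> bool) :
  flatten [seq flatten [seq [:: f i j] | j <- iota 0 N] | i <- iota 0 N] =
  adj_bits (fun i j : 'I_N => f i j).
Proof.
have fl T (g : T -> bool) l : flatten [seq [:: g j] | j <- l] = map g l.
  by elim: l => //= j l ->.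
rewrite adj_bitsE -val_enum_ord -map_comp; congr flatten.
by apply: eq_map => i /=; rewrite fl -map_comp.
Qed.

Lemma wout_encode c t n (E : rel 'I_n) k :
  wout c t (encode E k) = encode (@biggraph c t n k (adj_of (encode E k))) (big_k c t k).
Proof. by rewrite encodeE /wout /edgew n_of_encode k_of_encode flatten_bits. Qed.

Lemma verdict_encode c t n (E : rel 'I_n) k out :
  let D := decode_set (big_n t n) out in
  verdict c t (encode E k) (nth false out) =
  (c.+1 * t * root2 k * #|D| <= c * n_edges (@biggraph c t n k (adj_of (encode E k))) D).
Proof.
move=> D; rewrite /verdict /edgew n_of_encode k_of_encode !big_mkord.
have -> : \sum_(i < big_n t n) nth false out i = #|D|.
  rewrite -sum1_card [RHS]big_mkcond; apply: eq_bigr => i _.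
  by rewrite inE; case: nth.
have -> : \sum_(i < big_n t n) \sum_(0 <= j < big_n t n)
   [&& nth false out i, nth false out j & edge c t n k (adj_of (encode E k)) i j] =
   2 * n_edges (@biggraph c t n k (adj_of (encode E k))) D.
  rewrite -sum_pairs; last exact: biggraph_simple.
  rewrite [RHS]big_mkcond; apply: eq_bigr => i _; rewrite big_mkord inE.
  case: nth; last by rewrite big1.
  by rewrite [RHS]big_mkcond; apply: eq_bigr => j _; rewrite inE; case: nth.
have -> : 2 * c.+1 * t * root2 k * #|D| = 2 * (c.+1 * t * root2 k * #|D|) by rewrite !mulnA.
by rewrite [c * (2 * _)]mulnCA leq_pmul2l.
Qed.

(** * Real exponents and the choice of constants *)

Local Open Scope R_scope.

Lemma INR_mul m n : INR (m * n)%N = INR m * INR n.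
Proof. exact: mult_INR. Qed.

Lemma INR_add m n : INR (m + n)%N = INR m + INR n.
Proof. exact: plus_INR. Qed.

Lemma INR_leq m n : (m <= n)%N -> INR m <= INR n.
Proof. by move/leP; apply: le_INR. Qed.

Lemma INR_leqE m n : INR m <= INR n -> (m <= n)%N.
Proof. by move=> h; apply/leP/INR_le. Qed.

Lemma INR_gt0 n : (0 < n)%N -> 0 < INR n.
Proof. by move/ltP; apply: lt_0_INR. Qed.

Lemma INR_exp m n : INR (m ^ n)%N = INR m ^ n.
Proof. by elim: n => [|n IH]; rewrite ?expn0 // expnS INR_mul IH. Qed.

Lemma bigRmax_ub (I : finType) (P : pred I) (F : I -> R) j : P j ->
  F j <= \big[Rmax/R0]_(i | P i) F i.
Proof.
move=> Pj; have : j \in index_enum I by rewrite mem_index_enum.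
elim: (index_enum I) => // i l IH; rewrite inE big_cons => /orP [/eqP <-|/IH h].
  by rewrite Pj; apply: Rmax_l.
by case: (P i) => //; apply: Rle_trans h (Rmax_r _ _).
Qed.

Lemma sound_edges delta n (E : rel 'I_n) k s : gap_sound delta E k ->
  Rpower (INR k) delta <= INR s -> forall S : {set 'I_n}, (#|S| <= k)%N -> (n_edges E S <= s * #|S|)%N.
Proof.
move=> hs hk S hS; case: (posnP #|S|) => S0.
  rewrite /n_edges (_ : [set p | _] = set0) ?cards0 //.
  by apply/setP => p; rewrite !inE (cards0_eq S0) !inE !andbF.
have h1 : den E S <= den_le E k by apply: (bigRmax_ub (den E)); rewrite S0.
have h2 : den E S <= INR s by have := Rlt_le _ _ hs; rewrite -/(den_le E k); lra.
apply: INR_leqE; rewrite INR_mul; have hp := INR_gt0 S0.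
have -> : INR (n_edges E S) = den E S * INR #|S| by rewrite /den; field; lra.
by apply: Rmult_le_compat_r; lra.
Qed.

Lemma cliques_half n (E : rel 'I_n) t (S : {set 'I_n}) : (1 < t)%N ->
  (2 * n_cliques E t S <= #|S| ^ t)%N.
Proof.
move=> t1.
have h1 : (n_cliques E t S <= 'C(#|S|, t))%N.
  rewrite -cards_draws; apply: subset_leq_card; apply/subsetP => T; rewrite !inE.
  by case/and3P => -> ->.
have h2 : (2 <= t`!)%N.
  by case: t t1 {h1} => [|[|t]] // _; rewrite factS; have := fact_gt0 t.+1; lia.
have h3 m : (#|S| ^_ m <= #|S| ^ m)%N.
  elim: m => // m IH; rewrite ffactnSr expnSr leq_mul //; exact: leq_subr.
apply: leq_trans (h3 t); rewrite -bin_ffact mulnC.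
exact: leq_mul.
Qed.

Lemma Rpower_root (k q : nat) : (0 < k)%N -> (0 < q)%N -> (k < 2 ^ q)%N ->
  Rpower (INR k) (/ INR q) < 2.
Proof.
move=> k0 q0 hk.
have hq := INR_gt0 q0; have hk0 := INR_gt0 k0.
have -> : 2 = Rpower (INR (2 ^ q)%N) (/ INR q).
  rewrite INR_exp /= -/(IZR 2) -Rpower_pow; last by lra.
  rewrite Rpower_mult Rinv_r; last lra.
  by rewrite Rpower_1; lra.
apply: Rlt_Rpower_l; first exact: Rinv_0_lt_compat.
by split=> //; apply: lt_INR; apply/ltP.
Qed.

(** For [k < 2 ^ q] the loss [k^(1/q)] is below 2, so completeness asks for more than half of
    [k ^ t] cliques; but there are at most [k ^ t / t!] of them. *)
Lemma incomplete_small q t n (E : rel 'I_n) k : (0 < k)%N -> (0 < q)%N -> (k < 2 ^ q)%N -> (1 < t)%N ->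
  ~ gap_complete (/ INR q) t E k.
Proof.
move=> k0 q0 hk t1 [S [cS hS]].
have hr := Rpower_root k0 q0 hk.
have hc := cliques_half E S t1; rewrite cS in hc.
have hk0 := INR_gt0 k0.
move: hS; rewrite /Rminus Rpower_plus Rpower_Ropp Rpower_pow //.
set P := Rpower _ _ in hr *; have P0 : 0 < P by apply: exp_pos.
move=> hS; have := INR_leq hc; rewrite INR_mul INR_exp.
set K := INR k ^ t in hS *; set X := INR (n_cliques _ _ _) in hS *.
have K0 : 0 < K by apply: pow_lt.
rewrite [INR 2]/= => h.
have : K <= X * P.
  have -> : K = K * / P * P by field; lra.
  by apply: Rmult_le_compat_r; lra.
move=> hK; have X0 : 0 < X by apply: (Rmult_lt_reg_r P); lra.
have : X * P < X * 2 by apply: Rmult_lt_compat_l.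
lra.
Qed.

Lemma complete_cliques delta t n (E : rel 'I_n) k s : (0 < k)%N ->
  Rpower (INR k) delta <= INR s -> gap_complete delta t E k ->
  exists2 S : {set 'I_n}, #|S| = k & (k ^ t <= s * n_cliques E t S)%N.
Proof.
move=> k0 hs [S [cS hS]]; exists S => //; apply: INR_leqE; rewrite INR_mul INR_exp.
have hk0 := INR_gt0 k0.
move: hS; rewrite /Rminus Rpower_plus Rpower_Ropp Rpower_pow //.
set P := Rpower _ _ in hs *; have P0 : 0 < P by apply: exp_pos.
set X := INR (n_cliques _ _ _); set K := _ ^ t => hS.
have X0 : 0 <= X by apply: pos_INR.
have : K <= X * P.
  have -> : K = K * / P * P by field; lra.
  by apply: Rmult_le_compat_r; lra.
have : P * X <= INR s * X by apply: Rmult_le_compat_r.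
lra.
Qed.

(** Let B be the sum without the 3, and [s] the least integer with [k <= s ^ 4]. Then
    [root2 k >= s.-1 ^ 2], which exceeds [B * s] as soon as [s >= B + 3]. *)
Definition threshold (c t : nat) : nat := ((128 * c ^ 3 * 2 ^ t + c ^ 2 * t) + 3) ^ 4.

Lemma large_root c t k : (threshold c t <= k)%N ->
  exists2 s, (k <= s ^ 4)%N & ((128 * c ^ 3 * 2 ^ t + c ^ 2 * t) * s < root2 k)%N /\ (0 < s)%N.
Proof.
rewrite /threshold; set B := (_ * _ + _)%N => hk.
have hex : exists s, (k <= s ^ 4)%N by exists k; rewrite -{1}(expn1 k); case: (k) => // k'; rewrite leq_pexp2l.
case: (ex_minnP hex) => s hs hmin; exists s => //.
have sB : (B + 3 <= s)%N by rewrite -(@leq_exp2r _ _ 4) //; apply: leq_trans hk hs.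
have h1 : (s.-1 ^ 4 < k)%N by rewrite ltnNge; apply/negP => /hmin; lia.
have /andP [_ h2] := root2P k.
have h3 : (s.-1 ^ 2 < (root2 k).+1)%N.
  rewrite -(@ltn_exp2r _ _ 2) // -expnM; apply: ltn_trans h1 _.
  by rewrite expnS expn1.
split; last by lia.
have h4 : (s.-1 ^ 2 <= root2 k)%N by lia.
by apply: leq_trans h4; rewrite expnS expn1; nia.
Qed.

Lemma Rpower_quarter k s k0 : (0 < k)%N -> (0 < s)%N -> (k <= s ^ 4)%N -> (4 <= k0)%N ->
  Rpower (INR k) (/ INR k0) <= INR s.
Proof.
move=> k1 s1 hk h4.
have hk1 : 1 <= INR k by apply: (INR_leq k1).
have hs := INR_gt0 s1.
have i4 : INR 4 = 4 by rewrite /=; lra.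
have h4' : 4 <= INR k0 by rewrite -i4; apply: INR_leq.
have e1 : Rpower (INR k) (/ INR k0) <= Rpower (INR k) (/ 4).
  by apply: Rle_Rpower => //; apply: Rinv_le_contravar; lra.
have e2 : Rpower (INR k) (/ 4) <= Rpower (INR (s ^ 4)%N) (/ 4).
  by apply: Rle_Rpower_l; [lra|split; [lra|apply: INR_leq]].
have e3 : Rpower (INR (s ^ 4)%N) (/ 4) = INR s.
  rewrite INR_exp -Rpower_pow // Rpower_mult i4.
  by have -> : 4 * / 4 = 1 by [lra|field]; rewrite Rpower_1.
lra.
Qed.

Lemma verdict_complete eps c t n (E : rel 'I_n) k (A : nat -> nat -> bool) s (D : {set 'I_(big_n t n)}) :
  0 < eps -> eps < 2 -> 14 <= INR c * eps -> (1 < t)%N -> (0 < k <= n)%N ->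
  (forall i j : 'I_n, A i j = E i j) ->
  (0 < s)%N -> ((128 * c ^ 3 * 2 ^ t + c ^ 2 * t) * s < root2 k)%N ->
  (big_k c t k <= #|D|)%N ->
  den_ge (@biggraph c t n k A) (big_k c t k) / (2 - eps) <= den (@biggraph c t n k A) D ->
  (exists2 S : {set 'I_n}, #|S| = k & (k ^ t <= s * n_cliques E t S)%N) ->
  (c.+1 * t * root2 k * #|D| <= c * n_edges (@biggraph c t n k A) D)%N.
Proof.
move=> e0 e2 hc t1 /andP [k0 kn] hA s0 hB hD hden [S cS hS].
set G := @biggraph c t n k A in hden *; set N := big_k c t k in hD hden; set r := root2 k in hB *.
have c0 : (0 < c)%N.
  by case: (c) hc => // /=; lra.
have /andP [rk _] := root2P k; rewrite -/r in rk.
have r0 : (0 < r)%N by lia.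
have c2t : (c * t <= 128 * c ^ 3 * 2 ^ t + c ^ 2 * t)%N.
  by apply: leq_trans (leq_addl _ _); rewrite expnS expn1 leq_mul2r leq_pmull ?orbT.
have hscr : (c * t * s <= r)%N.
  by apply: leq_trans (ltnW hB); rewrite leq_mul2r c2t orbT.
(* From [c * t * s <= r] and [r * r <= k]. It yields [s * N <= k ^ t], so the cliques that
   completeness guarantees are at least [N]. *)
have hctr : (s * (c * t * r) <= k)%N by nia.
have kt0 : (0 < k ^ t.-1)%N by rewrite expn_gt0 k0.
have hN : (N <= n_cliques E t S)%N.
  rewrite -(leq_pmul2l s0); apply: leq_trans hS.
  rewrite /N /big_k -/r mulnA -[X in (_ <= _ ^ X)%N](prednK (ltnW t1)) expnS.
  by rewrite leq_mul2r hctr orbT.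
have [|||S' [h1 h2 h3]] := @reduction_yes n E A c t k S hA _ kn c0 t1 cS _ _ hN.
- lia.
- by rewrite -/r; apply: leq_trans hctr; rewrite leq_pmull.
- by nia.
rewrite -/N -/r in h1 h2 h3; rewrite -/G in h3.
have N0 : (0 < N)%N by rewrite /N /big_k -/r !muln_gt0 c0 r0 kt0 !andbT; lia.
have S'0 : 0 < INR #|S'| by apply: INR_gt0; lia.
have D0 : 0 < INR #|D| by apply: INR_gt0; lia.
have hge : den G S' <= den_ge G N by apply: (bigRmax_ub (den G)).
have RC := INR_gt0 c0; have RN := INR_gt0 N0; have Rr := INR_gt0 r0; have Rt := INR_gt0 (ltnW t1).
have := INR_leq h2; rewrite 2!INR_mul INR_add; have := INR_leq h3; rewrite 3!INR_mul.
have -> : INR 2 = 2 by []. have -> : INR 3 = 3 by rewrite /=; lra.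
move=> r3 r2.
apply: INR_leqE; rewrite 4!INR_mul S_INR.
move: hge hden; rewrite /den; set eS := INR (n_edges G S') in r3 *; set eD := INR (n_edges G D).
set c' := INR c in RC r2 hc *; set t' := INR t in Rt r3 *; set r' := INR r in Rr r3 *.
set N' := INR N in RN r2 r3; set x := INR #|S'| in S'0 r2 *; set y := INR #|D| in D0 *.
set g := den_ge G N => hge hden.
have h5 : 2 * t' * r' * c' / (c' + 3) <= eS / x.
  apply: (Rmult_le_reg_r (x * (c' + 3))); first by nra.
  have -> : 2 * t' * r' * c' / (c' + 3) * (x * (c' + 3)) = 2 * t' * r' * (c' * x) by field; lra.
  have -> : eS / x * (x * (c' + 3)) = eS * (c' + 3) by field; lra.
  have htr : 0 < 2 * t' * r' by nra.
  apply: Rle_trans (_ : 2 * t' * r' * ((c' + 3) * N') <= _); first by apply: Rmult_le_compat_l; lra.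
  by nra.
(* Origin of the 14: [(c' + 1) * (c' + 3)] is at most [c' * (c' + 7)], and
   [(c' + 7) * (2 - eps) <= 2 * c'] follows from [c' * eps >= 14]. *)
have h6 : (c' + 1) * t' * r' / c' <= 2 * t' * r' * c' / (c' + 3) / (2 - eps).
  apply: (Rmult_le_reg_r (c' * (c' + 3) * (2 - eps))); first by apply: Rmult_lt_0_compat; nra.
  have -> : (c' + 1) * t' * r' / c' * (c' * (c' + 3) * (2 - eps)) = (t' * r') * ((c' + 1) * (c' + 3) * (2 - eps)) by field; lra.
  have -> : 2 * t' * r' * c' / (c' + 3) / (2 - eps) * (c' * (c' + 3) * (2 - eps)) = (t' * r') * (2 * c' * c') by field; lra.
  apply: Rmult_le_compat_l; first by nra.
  have c1 : 1 <= c' by apply: (INR_leq c0).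
  apply: Rle_trans (_ : (c' * (c' + 7)) * (2 - eps) <= _).
    by apply: Rmult_le_compat_r; nra.
  by nra.
have h7 : g / (2 - eps) <= eD / y by exact: hden.
have h8 : 2 * t' * r' * c' / (c' + 3) / (2 - eps) <= g / (2 - eps).
  by apply: Rmult_le_compat_r; [apply/Rlt_le/Rinv_0_lt_compat; lra|lra].
have h9 : (c' + 1) * t' * r' / c' <= eD / y by lra.
have -> : (c' + 1) * t' * r' * y = (c' + 1) * t' * r' / c' * (c' * y) by field; lra.
have -> : c' * eD = eD / y * (c' * y) by field; lra.
by apply: Rmult_le_compat_r => //; nra.
Qed.

(** One [k0] serves twice. For [k < k0] also [k < 2 ^ k0], so completeness with exponent [1 / k0]
    fails; for [k >= k0] the threshold provides [s], and [k0 >= 4] gives [k^(1/k0) <= s]. *)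
Lemma gap_reduction eps : 0 < eps -> eps < 2 -> exists c t k0 : nat,
  [/\ (0 < k0)%N & forall n (E : rel 'I_n) k, simple_graph E -> (1 <= k)%N ->
   let w := encode E k in let delta := / INR k0 in
   let G := @biggraph c t n k (adj_of w) in
   (guard k0 w = false -> ~ gap_complete delta t E k) /\
   (guard k0 w -> (1 <= big_k c t k <= big_n t n)%N /\ forall out,
      let D := decode_set (big_n t n) out in
      (big_k c t k <= #|D|)%N -> den_ge G (big_k c t k) / (2 - eps) <= den G D ->
      (gap_complete delta t E k -> verdict c t w (nth false out) = true) /\
      (gap_sound delta E k -> verdict c t w (nth false out) = false))].
Proof.
move=> e0 e2.
have [c hc] := INR_unbounded (14 / eps).
have hce : 14 <= INR c * eps.
  have -> : 14 = 14 / eps * eps by field; lra.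
  by apply: Rmult_le_compat_r; lra.
have c0 : (0 < c)%N by case: (c) hce => // /=; lra.
have [t ht] : exists t, t = (4 * c * (24 * c + 1))%N by eexists.
have t1 : (1 < t)%N by rewrite ht; nia.
pose k0 := threshold c t.
have k04 : (4 <= k0)%N.
  rewrite /k0 /threshold; apply: leq_trans (_ : 3 ^ 4 <= _)%N => //.
  by rewrite leq_exp // leq_addl.
exists c, t, k0; split; first by lia.
move=> n E k sE k1 w delta G.
rewrite /guard n_of_encode k_of_encode; split=> [hg|/andP [hk kn]].
  move=> hcomp; have [S [cS _]] := hcomp.
  have kn : (k <= n)%N by rewrite -cS; apply: leq_trans (max_card _) _; rewrite card_ord.
  move: hg; rewrite kn andbT => /negbT; rewrite -ltnNge => hlt.
  move: hcomp; apply: incomplete_small => //; first by lia.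
  by apply: ltn_trans hlt _; apply: ltn_expl.
have [s hs [hB s0]] := large_root hk.
have hR := Rpower_quarter k1 s0 hs k04.
have hA (i j : 'I_n) : adj_of w i j = E i j by apply: adj_of_encode.
have /andP [rk _] := root2P k.
have t0 := ltnW t1.
have r0 : (0 < root2 k)%N by lia.
have kt0 : (0 < k ^ t.-1)%N by rewrite expn_gt0 k1.
have B1 : (128 * c ^ 3 * 2 ^ t * s < root2 k)%N.
  by apply: leq_ltn_trans hB; rewrite leq_mul2r leq_addr orbT.
have B2' : (c ^ 2 * t * s <= root2 k)%N.
  by apply: leq_trans (ltnW hB); rewrite leq_mul2r leq_addl orbT.
have B2 : (c ^ 2 * t <= root2 k)%N by apply: leq_trans B2'; rewrite leq_pmulr.
have ct : (c * t <= c ^ 2 * t)%N by rewrite leq_mul2r expnS expn1 leq_pmull ?orbT.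
split.
  apply/andP; split; first by rewrite /big_k !muln_gt0 c0 t0 r0 kt0.
  apply: leq_trans (_ : k ^ t <= _)%N.
    rewrite /big_k -[X in (_ <= _ ^ X)%N](prednK t0) expnS leq_mul2r; apply/orP; right.
    by apply: leq_trans rk; rewrite leq_mul2r (leq_trans ct) ?orbT.
  apply: leq_trans (leq_exp t kn) _; rewrite /big_n leq_pmull //; lia.
move=> out; set D := decode_set _ out; move=> hD hden; rewrite verdict_encode -/D -/w -/G; split=> [hcomp|hsound].
  apply: (@verdict_complete eps c t n E k (adj_of w) s) => //; first by rewrite k1.
  exact: complete_cliques hR hcomp.
apply/negP; apply: (@reduction_no n E (adj_of w) c t k s D sE hA) => //; first exact: sound_edges hR.
by lia.
Qed.

Local Close Scope R_scope.

(** * The theorem *)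

Lemma size_wout c t : exists a, forall w, size (wout c t w) <= a * (size w).+1 ^ a.
Proof.
have [[a h] _] := comp_wout c t (comp_var (fun w : seq bool => [:: w]) 0).
by exists a => w; have := h w; rewrite /tot /= addn0.
Qed.

Lemma runs_within_mono M T T' w out : T <= T' -> runs_within M T w out -> runs_within M T' w out.
Proof. by move=> h [c [hr ho]]; exists c; split=> //; apply: run_mono hr. Qed.

(** For positive [n], [n.+1 <= 2 * n] absorbs the successor into [2 ^ a]. The form without additive
    term also fits [fpt_bound]. *)
Lemma poly_bounded_poly_bound T : poly_bounded (fun n : nat => n) T -> exists c, forall n, 0 < n -> T n <= c * n ^ c.
Proof.
move=> [a h]; exists (a * 2 ^ a + a) => n n0; apply: leq_trans (h n) _.
have -> : n = n.-1.+1 by lia.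
apply: leq_trans (_ : a * 2 ^ a * n.-1.+1 ^ a <= _).
  by rewrite -mulnA leq_mul2l -expnMn leq_exp ?orbT //; lia.
by rewrite leq_monom ?leq_addr ?leq_addl.
Qed.

(** [bound] is arbitrary, which serves both time classes. The new parameter is at most evaluated at
    [kap k], a function of [k] alone, so the reduction is also a parameterized one. *)
Lemma gap_machine (eps : R) : Rlt R0 eps -> Rlt eps 2 ->
  exists (delta : R) (t : nat) (kap : nat -> nat), (Rlt R0 delta /\ Rle delta R1) /\
  forall M, exists M' a, forall bound, approximates_dalks bound (Rminus 2 eps) M ->
  forall n (E : rel 'I_n) k, simple_graph E -> 1 <= k -> let w := encode E k in
  exists sz out, [/\ sz <= a * (size w).+1 ^ a,
    runs_within M' (a * (size w + bound sz (kap k)).+1 ^ a) w out,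
    gap_complete delta t E k -> out = [:: true]
  & gap_sound delta E k -> out = [:: false]].
Proof.
move=> e0 e2; have [c [t [k0 [k0p hred]]]] := gap_reduction e0 e2.
have hk0 := INR_gt0 k0p; have hk1 : Rle R1 (INR k0) by apply: (INR_leq k0p).
exists (Rinv (INR k0)), t, (big_k c t); split.
  split; first exact: Rinv_0_lt_compat.
  by have := Rinv_le_contravar 1 (INR k0) Rlt_0_1 hk1; rewrite Rinv_1.
move=> M; have [M' [a1 hM']] := machine c t k0 M; have [a2 hsz] := size_wout c t.
exists M', (a1 + a2) => bound happ n E k sE k1 w.
have [hg0 hg1] := hred n E k sE k1; have [hm0 hm1] := hM' w.
exists (size (wout c t w)).
have hs : size (wout c t w) <= (a1 + a2) * (size w).+1 ^ (a1 + a2).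
  by apply: leq_trans (hsz w) _; rewrite leq_monom ?leq_addl.
case hg: (guard k0 w); last first.
  exists [:: false]; split=> //; last by move/(hg0 hg).
  apply: runs_within_mono (hm0 hg).
  apply: leq_trans (_ : a1 * (size w + bound (size (wout c t w)) (big_k c t k)).+1 ^ a1 <= _).
    by rewrite leq_mul2l leq_exp ?orbT // ltnS leq_addr.
  by rewrite leq_monom ?leq_addr.
have [hk hdec] := hg1 hg.
have [out [hrun [hsize hden]]] := happ _ _ _ (@biggraph_simple c t n k (adj_of w)) hk.
rewrite -wout_encode -/w in hrun.
have [hc hsd] := hdec out hsize hden.
exists [:: verdict c t w (nth false out)]; split=> //.
- by apply: runs_within_mono (hm1 hg _ _ hrun); rewrite leq_monom ?leq_addr.
- by move=> /hc ->.
- by move=> /hsd ->.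
Qed.

Theorem theorem2 :
  (* part 1: polynomial time *)
  ((forall (delta : R) (t : nat), Rlt R0 delta /\ Rle delta R1 ->
      ~ exists (M : TM) (c : nat), solves_gap (poly_bound c) delta t M) ->
   forall eps : R, Rlt R0 eps -> Rlt eps 2 ->
      ~ exists (M : TM) (c : nat), approximates_dalks (poly_bound c) (Rminus 2 eps) M)
  /\
  (* part 2: f(k) * n^{O(1)} time *)
  ((forall (delta : R) (t : nat), Rlt R0 delta /\ Rle delta R1 ->
      ~ exists (M : TM) (c : nat), solves_gap (poly_bound c) delta t M) ->
   (forall (delta : R) (t : nat) (f : nat -> nat), Rlt R0 delta /\ Rle delta R1 ->
      ~ exists (M : TM) (c : nat), solves_gap (fpt_bound f c) delta t M) ->
   forall (eps : R) (f : nat -> nat), Rlt R0 eps -> Rlt eps 2 ->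
      ~ exists (M : TM) (c : nat), approximates_dalks (fpt_bound f c) (Rminus 2 eps) M).
Proof.
have size_pos n (E : rel 'I_n) k : 0 < size (encode E k) by rewrite encodeE size_cat /=; lia.
split=> [hgap eps e0 e2 [M [c happ]]|_ hgap eps f e0 e2 [M [c happ]]].
  have [delta [t [kap [hd hM]]]] := gap_machine e0 e2.
  have [M' [a hM']] := hM M.
  have [c' hc'] : exists c', forall N, 0 < N ->
      a * (N + (c * (a * N.+1 ^ a) ^ c + c)).+1 ^ a <= c' * N ^ c'.
    apply: poly_bounded_poly_bound; apply: poly_bounded_mul (poly_bounded_const _ _) _.
    apply: (@poly_bounded_exp _ _ (fun N => (N + (c * (a * N.+1 ^ a) ^ c + c)).+1)).
    apply: poly_bounded_le (poly_bounded_add (poly_bounded_add (poly_bounded_id _) (poly_bounded_add (poly_bounded_mul (poly_bounded_const _ c)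
      (poly_bounded_exp c (_ : poly_bounded _ (fun N => a * N.+1 ^ a)))) (poly_bounded_const _ c))) (poly_bounded_const _ 1)) _ => [|N].
      by exists a.
    by rewrite addn1.
  apply: (hgap delta t hd); exists M', c' => n E k sE k1.
  have [sz [out [hsz hrun hc hs]]] := hM' _ happ n E k sE k1.
  exists out; split=> //; apply: runs_within_mono hrun.
  apply: leq_trans (leq_trans (hc' _ (size_pos n E k)) (leq_addr _ _)).
  by rewrite leq_mul2l leq_exp ?orbT // ltnS leq_add2l /poly_bound leq_add2r leq_mul2l leq_exp ?orbT.
have [delta [t [kap [hd hM]]]] := gap_machine e0 e2.
have [M' [a hM']] := hM M.
have [c' hc'] : exists c', forall N, 0 < N -> a * (N + (a * N.+1 ^ a) ^ c).+1 ^ a <= c' * N ^ c'.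
  apply: poly_bounded_poly_bound; apply: poly_bounded_mul (poly_bounded_const _ _) _.
  apply: (@poly_bounded_exp _ _ (fun N => (N + (a * N.+1 ^ a) ^ c).+1)).
  apply: poly_bounded_le (poly_bounded_add (poly_bounded_add (poly_bounded_id _) (poly_bounded_exp c (_ : poly_bounded _ (fun N => a * N.+1 ^ a)))) (poly_bounded_const _ 1)) _ => [|N].
    by exists a.
  by rewrite addn1.
(* Writing [y] for [f (kap k)], the successor of [N + y * x] is at most [y.+1 * (N + x).+1]. So the
   factor depending on [k] splits off before the power [a] is taken, and the rest is polynomial in
   [N]. *)
apply: (hgap delta t (fun k => (f (kap k)).+1 ^ a * c') hd); exists M', c' => n E k sE k1.
have [sz [out [hsz hrun hc hs]]] := hM' _ happ n E k sE k1.
exists out; split=> //; apply: runs_within_mono hrun.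
rewrite /fpt_bound -mulnA; set N := size _ in hsz *.
apply: leq_trans (leq_mul (leqnn _) (hc' _ (size_pos n E k))).
rewrite mulnCA leq_mul2l -expnMn leq_exp ?orbT //.
apply: leq_trans (_ : N + f (kap k) * (a * N.+1 ^ a) ^ c < _).
  by rewrite ltnS leq_add2l leq_mul2l leq_exp ?orbT.
move: (f (kap k)) ((a * N.+1 ^ a) ^ c) => y x.
by rewrite mulSn mulnS; have := leq0n (y * N); rewrite mulnDr; lia.
Qed.
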